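(* Let $G$ be a Lie group, $K$ a compact subgroup of $G$, and $U$ a finite-dimensional real projective representation of $K$, so that $K$ acts on the associative algebra $\mathfrak{gl}(U)$ by conjugation. Then there is an isomorphism of real algebras $$\mathfrak{A}(G,K,\mathfrak{gl}(U))\cong\bigoplus_{r}\mathfrak{gl}(r,\mathbb{R})\oplus\bigoplus_{c}\mathfrak{gl}(c,\mathbb{C})\oplus\bigoplus_{h}\mathfrak{gl}(h,\mathbb{H}),$$ where $r$ ranges over the multiplicities of projective $K$-irreps in $U_{\mathbb{C}}=U\otimes_{\mathbb{R}}\mathbb{C}$ of real type, $c$ ranges over the multiplicities of conjugate pairs of projective $K$-irreps in $U_{\mathbb{C}}$ of complex type, and $h$ ranges over the multiplicities of pairs of projective $K$-irreps in $U_{\mathbb{C}}$ of quaternionic (symplectic) type.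
   Context: $\mathfrak{gl}(U)$ denotes the associative algebra $\mathrm{End}(U)$, and $\mathfrak{gl}(n,\mathbb{D})$ the algebra of $n\times n$ matrices over $\mathbb{D}=\mathbb{R},\mathbb{C}$ or the quaternions $\mathbb{H}$, regarded as a real algebra. ''Irrep'' means irreducible representation. A real projective representation of $K$ on $U$ is a (continuous) homomorphism $\sigma:K\to\mathrm{PGL}(U)$; $K$ acts on $\mathfrak{gl}(U)$ by $k\cdot m=\sigma(k)m\sigma(k)^{-1}$. For a closed subgroup $H\subset G$ and an algebra $\mathfrak{a}$ on which $H$ acts by algebra automorphisms, $\mathfrak{A}(G,H,\mathfrak{a})$ is the algebra of $G$-invariants in $\{f:G\to\mathfrak{a}\mid f(gh)=h^{-1}f(g)\ \forall h\in H,\ g\in G\}$, with pointwise product and $G$-action $(g_1\cdot f)(g)=f(g_1^{-1}g)$ (no regularity condition on the maps). The projective $K$-irreps in $U_{\mathbb{C}}$ and their multiplicities are understood via the linear lift of $\sigma$: let $\tilde K=\{(k,a)\in K\times\mathrm{GL}(U)\mid \sigma(k)=[a],\ |\det a|=1\}$, a compact double cover of $K$ acting linearly on $U$ through the second factor; the projective irreps in $U_{\mathbb{C}}$ are the complex irreps of $\tilde K$ occurring in $U_{\mathbb{C}}$, with isomorphism and multiplicity taken as linear representations of $\tilde K$. A complex irrep $W$ is of complex type if it is not isomorphic to its conjugate $\overline{W}$; otherwise it is of real type if it admits an equivariant antilinear map $j$ with $j^2=1$ and of quaternionic type if it admits one with $j^2=-1$. For $W$ of complex type occurring in $U_{\mathbb{C}}$,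 $c$ is the number of copies of the pair $W\oplus\overline{W}$ in $U_{\mathbb{C}}$ (one summand for each unordered pair $\{W,\overline{W}\}$); for $W$ of quaternionic type occurring in $U_{\mathbb{C}}$, $h$ is the number of copies of $W\oplus W$ in $U_{\mathbb{C}}$. *)

(* Defs.v *)
From HB Require Import structures.
From mathcomp Require Import all_boot all_order all_algebra.
From mathcomp Require Import complex.
From mathcomp Require Import ring.
From mathcomp Require Import all_classical all_reals all_analysis.

Set Implicit Arguments.
Unset Strict Implicit.
Unset Printing Implicit Defensive.

Import Order.TTheory GRing.Theory Num.Theory.
Import numFieldNormedType.Exports.

Local Open Scope classical_set_scope.
Local Open Scope ring_scope.

(* [Ck k D f]: [f] is of class C^k on the open set [D].  The partial derivatives
   are derivatives of functions of one real variable: the library's ['D_v f]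
   asks for a normed module, and ['rV[R]_d] is one only when [d] is a successor,
   whereas zero-dimensional (discrete) Lie groups have to be covered. *)
Fixpoint Ck (R : realType) (d k : nat) (D : set 'rV[R]_d) (f : 'rV[R]_d -> R) :
    Prop :=
  {within D, continuous f} /\
  if k is k'.+1 then
    forall i : 'I_d,
      (forall x, D x -> derivable (fun t : R => f (x + t *: delta_mx 0 i)) 0 1) /\
      Ck k' D (fun x => derive1 (fun t : R => f (x + t *: delta_mx 0 i)) 0)
  else True.

Definition smooth (R : realType) (d e : nat) (D : set 'rV[R]_d)
    (f : 'rV[R]_d -> 'rV[R]_e) : Prop :=
  forall (k : nat) (j : 'I_e), Ck k D (fun x => f x 0 j).

(* The maps are total; only their values on [chart_dom], resp. on its image,
   are meaningful. *)
Record chart (R : realType) (M : topologicalType) (d : nat) := Chart {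
  chart_dom : set M;
  chart_map : M -> 'rV[R]_d;
  chart_inv : 'rV[R]_d -> M;
  chart_dom_open : open chart_dom;
  chart_img_open : open (chart_map @` chart_dom);
  chart_mapK : forall x, chart_dom x -> chart_inv (chart_map x) = x;
  chart_map_cts : {within chart_dom, continuous chart_map};
  chart_inv_cts : {within chart_map @` chart_dom, continuous chart_inv} }.

Definition chart_img (R : realType) (M : topologicalType) (d : nat)
  (c : chart R M d) : set 'rV[R]_d := chart_map c @` chart_dom c.

(* [lie_smooth_mul] and [lie_smooth_inv] say that the group operations, read
   in charts, are smooth wherever the charts allow one to compare; points of
   R^d x R^d are row vectors of size [d + d]. *)
HB.mixin Record isLieGroup (R : realType) G of Group G & Topological G := {
  lie_dim : nat;
  lie_atlas : set (chart R G lie_dim);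
  lie_hausdorff : hausdorff_space G;
  lie_second_countable : @second_countable G;
  lie_cover : forall g : G, exists2 c, lie_atlas c & chart_dom c g;
  lie_compat : forall c1 c2, lie_atlas c1 -> lie_atlas c2 ->
    smooth (chart_map c1 @` (chart_dom c1 `&` chart_dom c2))
           (fun x => chart_map c2 (chart_inv c1 x));
  lie_continuous_mul : continuous (fun p : G * G => (p.1 * p.2)%g);
  lie_continuous_inv : continuous (fun g : G => (g^-1)%g);
  lie_smooth_mul : forall c1 c2 c3,
    lie_atlas c1 -> lie_atlas c2 -> lie_atlas c3 ->
    let mul (z : 'rV[R]_(lie_dim + lie_dim)) : G :=
      (chart_inv c1 (lsubmx z) * chart_inv c2 (rsubmx z))%g in
    smooth [set z | [/\ chart_img c1 (lsubmx z), chart_img c2 (rsubmx z) &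
                        chart_dom c3 (mul z)]]
           (fun z => chart_map c3 (mul z));
  lie_smooth_inv : forall c1 c2, lie_atlas c1 -> lie_atlas c2 ->
    let inv (x : 'rV[R]_lie_dim) : G := ((chart_inv c1 x)^-1)%g in
    smooth [set x | chart_img c1 x /\ chart_dom c2 (inv x)]
           (fun x => chart_map c2 (inv x)) }.

#[short(type="lieGroupType")]
HB.structure Definition LieGroup (R : realType) :=
  { G of Group G & Topological G & isLieGroup R G }.

Record subgroup (G : groupType) := Subgroup {
  sgset :> set G;
  subgroup1 : sgset 1%g;
  subgroupM : forall g h, sgset g -> sgset h ->
    sgset (g * h)%g;
  subgroupV : forall g, sgset g -> sgset (g^-1)%g }.

(* The library's [algType] excludes the zero algebra, which occurs here both
   as gl(0) and as an empty direct sum; its [pzRingType] and [lmodType] have no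
   common extension other than [lalgType], whence a separate product [amul]. *)
HB.mixin Record isAssocAlgebra (R : pzRingType) A of GRing.Lmodule R A := {
  amul : A -> A -> A;
  aone : A;
  amulA : associative amul;
  amul1l : left_id aone amul;
  amul1r : right_id aone amul;
  amulDl : left_distributive amul +%R;
  amulDr : right_distributive amul +%R;
  amulZl : forall (c : R) (x y : A), amul (c *: x) y = c *: amul x y;
  amulZr : forall (c : R) (x y : A), amul x (c *: y) = c *: amul x y }.

#[short(type="assocAlgType")]
HB.structure Definition AssocAlgebra (R : pzRingType) :=
  { A of GRing.Lmodule R A & isAssocAlgebra R A }.

Definition alg_morphism (R : pzRingType) (A B : assocAlgType R) (f : A -> B) :
    Prop :=
  [/\ linear f, {morph f : x y / amul x y} & f aone = aone].

Definition alg_iso (R : pzRingType) (A B : assocAlgType R) : Prop :=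
  exists2 f : A -> B, alg_morphism f & bijective f.

Section RcomplexAlg.
Variable R : realType.
Fact Rcomplex_scalerAr (c : R) (x y : Rcomplex R) :
  c *: (x * y) = x * (c *: y).
Proof. by rewrite mulrC scalerAl mulrC. Qed.
HB.instance Definition _ :=
  GRing.Lalgebra_isAlgebra.Build R (Rcomplex R) Rcomplex_scalerAr.
End RcomplexAlg.

(* [(a, b, c, d)] stands for a + b i + c j + d k. *)
Definition quaternion (R : realType) : Type := (R * R * R * R)%type.

Section Quaternion.
Variable R : realType.
Local Notation H := (quaternion R).

HB.instance Definition _ := GRing.Zmodule.copy H (R * R * R * R)%type.

Definition quat_one : H := (1, 0, 0, 0).
Definition quat_mul (x y : H) : H :=
  let: (a1, b1, c1, d1) := x in
  let: (a2, b2, c2, d2) := y in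
  (a1 * a2 - b1 * b2 - c1 * c2 - d1 * d2,
   a1 * b2 + b1 * a2 + c1 * d2 - d1 * c2,
   a1 * c2 - b1 * d2 + c1 * a2 + d1 * b2,
   a1 * d2 + b1 * c2 - c1 * b2 + d1 * a2).

Fact quat_eq (a b c d a' b' c' d' : R) :
  a = a' -> b = b' -> c = c' -> d = d' ->
  (a, b, c, d) = (a', b', c', d') :> H.
Proof. by move=> -> -> -> ->. Qed.

Fact quat_mulA : associative quat_mul.
Proof.
move=> [[[a1 b1] c1] d1] [[[a2 b2] c2] d2] [[[a3 b3] c3] d3].
by apply: quat_eq; ring.
Qed.
Fact quat_mul1l : left_id quat_one quat_mul.
Proof. by move=> [[[a b] c] d]; apply: quat_eq; ring. Qed.
Fact quat_mul1r : right_id quat_one quat_mul.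
Proof. by move=> [[[a b] c] d]; apply: quat_eq; ring. Qed.
Fact quat_mulDl : left_distributive quat_mul +%R.
Proof.
move=> [[[a1 b1] c1] d1] [[[a2 b2] c2] d2] [[[a3 b3] c3] d3].
by apply: quat_eq; rewrite /=; ring.
Qed.
Fact quat_mulDr : right_distributive quat_mul +%R.
Proof.
move=> [[[a1 b1] c1] d1] [[[a2 b2] c2] d2] [[[a3 b3] c3] d3].
by apply: quat_eq; rewrite /=; ring.
Qed.
Fact quat_oner_neq0 : quat_one != 0.
Proof. by apply/eqP => -[/eqP]; rewrite oner_eq0. Qed.
HB.instance Definition _ := GRing.Zmodule_isNzRing.Build H
  quat_mulA quat_mul1l quat_mul1r quat_mulDl quat_mulDr quat_oner_neq0.

Definition quat_scale (k : R) (x : H) : H :=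
  let: (a, b, c, d) := x in (k * a, k * b, k * c, k * d).

Fact quat_scalerA (k l : R) (x : H) :
  quat_scale k (quat_scale l x) = quat_scale (k * l) x.
Proof. by move: x => [[[a b] c] d]; apply: quat_eq; exact: mulrA. Qed.
Fact quat_scale1r : left_id 1 quat_scale.
Proof. by move=> [[[a b] c] d]; apply: quat_eq; exact: mul1r. Qed.
Fact quat_scalerDr : right_distributive quat_scale +%R.
Proof.
by move=> k [[[a b] c] d] [[[a' b'] c'] d']; apply: quat_eq; exact: mulrDr.
Qed.
Fact quat_scalerDl (x : H) : {morph quat_scale^~ x : k l / k + l}.
Proof. by move: x => [[[a b] c] d] k l; apply: quat_eq; exact: mulrDl. Qed.
HB.instance Definition _ := GRing.Zmodule_isLmodule.Build R H
  quat_scalerA quat_scale1r quat_scalerDr quat_scalerDl.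

Fact quat_scalerAl (k : R) (x y : H) : k *: (x * y) = (k *: x) * y.
Proof.
by move: x y => [[[a1 b1] c1] d1] [[[a2 b2] c2] d2]; apply: quat_eq; ring.
Qed.
HB.instance Definition _ := GRing.Lmodule_isLalgebra.Build R H quat_scalerAl.

Fact quat_scalerAr (k : R) (x y : H) : k *: (x * y) = x * (k *: y).
Proof.
by move: x y => [[[a1 b1] c1] d1] [[[a2 b2] c2] d2]; apply: quat_eq; ring.
Qed.
HB.instance Definition _ := GRing.Lalgebra_isAlgebra.Build R H quat_scalerAr.
End Quaternion.

(* The n x n matrices over an algebra [D] over [R], as an algebra over [R]; the
   library's scaling on ['M[D]_n] is by elements of [D]. *)
Definition gl (R : pzRingType) (D : algType R) (n : nat) : Type := 'M[D]_n.

Section MatrixAlgebra.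
Variables (R : pzRingType) (D : algType R) (n : nat).
Local Notation A := (gl D n).

HB.instance Definition _ := GRing.Zmodule.copy A 'M[D]_n.

Definition gl_scale (c : R) (m : A) : A := map_mx (fun d : D => c *: d) m.

Fact gl_scalerA (c d : R) (m : A) :
  gl_scale c (gl_scale d m) = gl_scale (c * d) m.
Proof. by apply/matrixP => i j; rewrite !mxE scalerA. Qed.
Fact gl_scale1r : left_id 1 gl_scale.
Proof. by move=> m; apply/matrixP => i j; rewrite !mxE scale1r. Qed.
Fact gl_scalerDr : right_distributive gl_scale +%R.
Proof. by move=> c m m'; apply/matrixP => i j; rewrite !mxE scalerDr. Qed.
Fact gl_scalerDl (m : A) : {morph gl_scale^~ m : c d / c + d}.
Proof. by move=> c d; apply/matrixP => i j; rewrite !mxE scalerDl. Qed.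
HB.instance Definition _ := GRing.Zmodule_isLmodule.Build R A
  gl_scalerA gl_scale1r gl_scalerDr gl_scalerDl.

Definition gl_mul (x y : A) : A := (x : 'M[D]_n) *m y.
Definition gl_one : A := 1%:M.

Fact gl_mulA : associative gl_mul. Proof. exact: mulmxA. Qed.
Fact gl_mul1l : left_id gl_one gl_mul. Proof. exact: mul1mx. Qed.
Fact gl_mul1r : right_id gl_one gl_mul. Proof. exact: mulmx1. Qed.
Fact gl_mulDl : left_distributive gl_mul +%R.
Proof. by move=> x y z; exact: mulmxDl. Qed.
Fact gl_mulDr : right_distributive gl_mul +%R.
Proof. by move=> x y z; exact: mulmxDr. Qed.
Fact gl_mulZl (c : R) (x y : A) : gl_mul (c *: x) y = c *: gl_mul x y.
Proof.
apply/matrixP => i j; rewrite !mxE scaler_sumr; apply: eq_bigr => k _.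
by rewrite !mxE scalerAl.
Qed.
Fact gl_mulZr (c : R) (x y : A) : gl_mul x (c *: y) = c *: gl_mul x y.
Proof.
apply/matrixP => i j; rewrite !mxE scaler_sumr; apply: eq_bigr => k _.
by rewrite !mxE scalerAr.
Qed.
HB.instance Definition _ := isAssocAlgebra.Build R A
  gl_mulA gl_mul1l gl_mul1r gl_mulDl gl_mulDr gl_mulZl gl_mulZr.
End MatrixAlgebra.

Section ProductAlgebra.
Variables (R : pzRingType) (A B : assocAlgType R).
Local Notation P := (A * B)%type.

Definition pair_amul (x y : P) : P := (amul x.1 y.1, amul x.2 y.2).
Definition pair_aone : P := (aone, aone).

Fact pair_amulA : associative pair_amul.
Proof. by move=> x y z; congr pair; exact: amulA. Qed.
Fact pair_amul1l : left_id pair_aone pair_amul.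
Proof. by move=> [x1 x2]; congr pair; exact: amul1l. Qed.
Fact pair_amul1r : right_id pair_aone pair_amul.
Proof. by move=> [x1 x2]; congr pair; exact: amul1r. Qed.
Fact pair_amulDl : left_distributive pair_amul +%R.
Proof. by move=> x y z; congr pair; exact: amulDl. Qed.
Fact pair_amulDr : right_distributive pair_amul +%R.
Proof. by move=> x y z; congr pair; exact: amulDr. Qed.
Fact pair_amulZl (c : R) (x y : P) : pair_amul (c *: x) y = c *: pair_amul x y.
Proof. by congr pair; exact: amulZl. Qed.
Fact pair_amulZr (c : R) (x y : P) : pair_amul x (c *: y) = c *: pair_amul x y.
Proof. by congr pair; exact: amulZr. Qed.
HB.instance Definition _ := isAssocAlgebra.Build R P
  pair_amulA pair_amul1l pair_amul1r pair_amulDl pair_amulDr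
  pair_amulZl pair_amulZr.
End ProductAlgebra.

Definition direct_sum (R : pzRingType) (I : finType) (A : I -> assocAlgType R) :
  Type := forall i, A i.

Section DirectSum.
Variables (R : pzRingType) (I : finType) (A : I -> assocAlgType R).
Local Notation S := (direct_sum A).

HB.instance Definition _ := Choice.copy S (forall i, A i).

Let ext (f g : S) : (forall i, f i = g i) -> f = g.
Proof. exact: functional_extensionality_dep. Qed.

Definition dsum_zero : S := fun=> 0.
Definition dsum_opp (f : S) : S := fun i => - f i.
Definition dsum_add (f g : S) : S := fun i => f i + g i.
Definition dsum_scale (c : R) (f : S) : S := fun i => c *: f i.
Definition dsum_mul (f g : S) : S := fun i => amul (f i) (g i).
Definition dsum_one : S := fun=> aone.

Fact dsum_addA : associative dsum_add.
Proof. by move=> f g h; apply: ext => i; exact: addrA. Qed.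
Fact dsum_addC : commutative dsum_add.
Proof. by move=> f g; apply: ext => i; exact: addrC. Qed.
Fact dsum_add0 : left_id dsum_zero dsum_add.
Proof. by move=> f; apply: ext => i; exact: add0r. Qed.
Fact dsum_addN : left_inverse dsum_zero dsum_opp dsum_add.
Proof. by move=> f; apply: ext => i; exact: addNr. Qed.
HB.instance Definition _ := GRing.isZmodule.Build S
  dsum_addA dsum_addC dsum_add0 dsum_addN.

Fact dsum_scalerA (c d : R) (f : S) :
  dsum_scale c (dsum_scale d f) = dsum_scale (c * d) f.
Proof. by apply: ext => i; exact: scalerA. Qed.
Fact dsum_scale1r : left_id 1 dsum_scale.
Proof. by move=> f; apply: ext => i; exact: scale1r. Qed.
Fact dsum_scalerDr : right_distributive dsum_scale +%R.
Proof. by move=> c f g; apply: ext => i; exact: scalerDr. Qed.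
Fact dsum_scalerDl (f : S) : {morph dsum_scale^~ f : c d / c + d}.
Proof. by move=> c d; apply: ext => i; exact: scalerDl. Qed.
HB.instance Definition _ := GRing.Zmodule_isLmodule.Build R S
  dsum_scalerA dsum_scale1r dsum_scalerDr dsum_scalerDl.

Fact dsum_mulA : associative dsum_mul.
Proof. by move=> f g h; apply: ext => i; exact: amulA. Qed.
Fact dsum_mul1l : left_id dsum_one dsum_mul.
Proof. by move=> f; apply: ext => i; exact: amul1l. Qed.
Fact dsum_mul1r : right_id dsum_one dsum_mul.
Proof. by move=> f; apply: ext => i; exact: amul1r. Qed.
Fact dsum_mulDl : left_distributive dsum_mul +%R.
Proof. by move=> f g h; apply: ext => i; exact: amulDl. Qed.
Fact dsum_mulDr : right_distributive dsum_mul +%R.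
Proof. by move=> f g h; apply: ext => i; exact: amulDr. Qed.
Fact dsum_mulZl (c : R) (x y : S) : dsum_mul (c *: x) y = c *: dsum_mul x y.
Proof. by apply: ext => i; exact: amulZl. Qed.
Fact dsum_mulZr (c : R) (x y : S) : dsum_mul x (c *: y) = c *: dsum_mul x y.
Proof. by apply: ext => i; exact: amulZr. Qed.
HB.instance Definition _ := isAssocAlgebra.Build R S
  dsum_mulA dsum_mul1l dsum_mul1r dsum_mulDl dsum_mulDr dsum_mulZl dsum_mulZr.
End DirectSum.

(* An action of the subgroup [H] by algebra automorphisms; the function is
   total on [G], its values outside [H] being irrelevant. *)
Record alg_action (R : pzRingType) (G : groupType) (H : subgroup G)
    (a : assocAlgType R) := AlgAction {
  act :> G -> a -> a;
  act1 : forall m, act 1%g m = m;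
  actM : forall h k m, sgset H h -> sgset H k -> act (h * k)%g m = act h (act k m);
  act_morph : forall h, sgset H h -> alg_morphism (act h) }.

Section AutAlgebra.
Variables (R : pzRingType) (G : groupType) (H : subgroup G).
Variables (a : assocAlgType R) (alpha : alg_action H a).

Definition H_equivariant (f : G -> a) : Prop :=
  forall g h, sgset H h -> f (g * h)%g = alpha (h^-1)%g (f g).

Definition translate (g1 : G) (f : G -> a) : G -> a :=
  fun g => f (g1^-1 * g)%g.

Definition aut_pred : pred (G -> a) :=
  fun f => `[< H_equivariant f /\ forall g1, translate g1 f = f >].

Fact aut_predP (f : G -> a) :
  reflect (H_equivariant f /\ forall g1, translate g1 f = f) (f \in aut_pred).
Proof. exact: asboolP. Qed.

Fact aut_submod_closed : submod_closed aut_pred.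
Proof.
split.
  apply/aut_predP; split => // g h Hh.
  have [L _ _] := act_morph alpha (subgroupV Hh).
  have := L (-1) 0 0; rewrite scaler0 addr0 scaleN1r => E.
  by rewrite -[LHS](addNr (alpha (h^-1)%g 0)) -E.
move=> c f f' /aut_predP[Ef If] /aut_predP[Ef' If']; apply/aut_predP; split.
  move=> g h Hh; have [L _ _] := act_morph alpha (subgroupV Hh).
  transitivity (c *: f (g * h)%g + f' (g * h)%g) => //.
  by rewrite Ef// Ef'// -L.
move=> g1; apply/funext => g.
transitivity (c *: translate g1 f g + translate g1 f' g) => //.
by rewrite If If'.
Qed.

HB.instance Definition _ :=
  GRing.isSubmodClosed.Build R (G -> a) aut_pred aut_submod_closed.

Definition autAlg : Type := {f : G -> a | f \in aut_pred}.
HB.instance Definition _ := SubChoice.on autAlg.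
HB.instance Definition _ := [SubChoice_isSubLmodule of autAlg by <:].

Fact aut_mul_closed (f f' : autAlg) :
  (fun g => amul (val f g) (val f' g)) \in aut_pred.
Proof.
have /aut_predP[Ef If] := valP f; have /aut_predP[Ef' If'] := valP f'.
apply/aut_predP; split.
  move=> g h Hh; have [_ M _] := act_morph alpha (subgroupV Hh).
  by rewrite Ef// Ef'// M.
move=> g1; apply/funext => g.
transitivity (amul (translate g1 (val f) g) (translate g1 (val f') g)) => //.
by rewrite If If'.
Qed.
Fact aut_one_closed : (fun _ : G => aone : a) \in aut_pred.
Proof.
apply/aut_predP; split => // g h Hh.
by have [_ _ ->] := act_morph alpha (subgroupV Hh).
Qed.

Definition aut_mul (f f' : autAlg) : autAlg :=
  exist (fun h => h \in aut_pred) _ (aut_mul_closed f f').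
Definition aut_one : autAlg :=
  exist (fun h => h \in aut_pred) _ aut_one_closed.

Let ext (f f' : autAlg) : (forall g, val f g = val f' g) -> f = f'.
Proof. by move=> E; apply/val_inj/funext. Qed.

Fact aut_mulA : associative aut_mul.
Proof. by move=> x y z; apply: ext => g; exact: amulA. Qed.
Fact aut_mul1l : left_id aut_one aut_mul.
Proof. by move=> x; apply: ext => g; exact: amul1l. Qed.
Fact aut_mul1r : right_id aut_one aut_mul.
Proof. by move=> x; apply: ext => g; exact: amul1r. Qed.
Fact aut_mulDl : left_distributive aut_mul +%R.
Proof. by move=> x y z; apply: ext => g; exact: amulDl. Qed.
Fact aut_mulDr : right_distributive aut_mul +%R.
Proof. by move=> x y z; apply: ext => g; exact: amulDr. Qed.
Fact aut_mulZl (c : R) (x y : autAlg) :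
  aut_mul (c *: x) y = c *: aut_mul x y.
Proof. by apply: ext => g; exact: amulZl. Qed.
Fact aut_mulZr (c : R) (x y : autAlg) :
  aut_mul x (c *: y) = c *: aut_mul x y.
Proof. by apply: ext => g; exact: amulZr. Qed.
HB.instance Definition _ := isAssocAlgebra.Build R autAlg
  aut_mulA aut_mul1l aut_mul1r aut_mulDl aut_mulDr aut_mulZl aut_mulZr.
End AutAlgebra.

Section ProjectiveGroup.
Variables (R : realType) (n : nat).

(* GL(U) for U = R^n, with the topology induced from the n x n matrices. *)
Definition GL : topologicalType := set_type [set A : 'M[R]_n | A \in unitmx].
Implicit Types u v : GL.

Definition GLval (u : GL) : 'M[R]_n := set_val u.
Lemma GLvalP u : GLval u \in unitmx.
Proof. exact: (set_valP u). Qed.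
Definition mkGL (A : 'M[R]_n) (uA : A \in unitmx) : GL :=
  exist _ A (mem_set uA).

Fact GL_mul_subproof u v : GLval u *m GLval v \in unitmx.
Proof. by rewrite unitmx_mul !GLvalP. Qed.
Definition GL_mul u v : GL := mkGL (GL_mul_subproof u v).
Lemma GLvalM u v : GLval (GL_mul u v) = GLval u *m GLval v.
Proof. by []. Qed.

Definition proportional u v : bool :=
  `[< exists2 c : R, c != 0 & GLval u = c *: GLval v >].

Fact proportional_equiv : equiv_class_of proportional.
Proof.
split=> [u|u v|v u w].
- by apply/asboolP; exists 1; rewrite ?oner_eq0// scale1r.
- by apply/asboolP/asboolP => -[c c0 ->]; exists c^-1;
    rewrite ?invr_eq0// scalerA mulVf// scale1r.
- move=> /asboolP[c c0 E] /asboolP[d d0 F]; apply/asboolP.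
  by exists (c * d); rewrite ?mulf_neq0// E F scalerA.
Qed.
Canonical proportional_rel := EquivRelPack proportional_equiv.

Local Open Scope quotient_scope.
Definition PGL : topologicalType := quotient_topology {eq_quot proportional}.
Definition GL_class (u : GL) : PGL := \pi_{eq_quot proportional} u.
Definition PGL_repr (x : PGL) : GL := repr (x : {eq_quot proportional}).
Local Close Scope quotient_scope.

Lemma GL_classE u v : GL_class u = GL_class v <-> proportional u v.
Proof. by split => [/eqmodP|?]; last exact/eqmodP. Qed.
Lemma PGL_reprK x : GL_class (PGL_repr x) = x.
Proof. exact: reprK. Qed.

Definition PGL_mul (x y : PGL) : PGL :=
  GL_class (GL_mul (PGL_repr x) (PGL_repr y)).

Lemma PGL_mulE u v :
  PGL_mul (GL_class u) (GL_class v) = GL_class (GL_mul u v).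
Proof.
have /GL_classE/asboolP[c c0 E] := PGL_reprK (GL_class u).
have /GL_classE/asboolP[d d0 F] := PGL_reprK (GL_class v).
apply/GL_classE/asboolP; exists (c * d); first by rewrite mulf_neq0.
by rewrite !GLvalM E F -scalemxAl -scalemxAr scalerA.
Qed.

(* Conjugation by a class; [PGL_conjE] shows that the choice of the
   representative is immaterial. *)
Definition PGL_conj (x : PGL) (m : 'M[R]_n) : 'M[R]_n :=
  GLval (PGL_repr x) *m m *m invmx (GLval (PGL_repr x)).

Lemma PGL_conjE u m :
  PGL_conj (GL_class u) m = GLval u *m m *m invmx (GLval u).
Proof.
have /GL_classE/asboolP[c c0 E] := PGL_reprK (GL_class u).
rewrite /PGL_conj E invmxZ ?GLvalP// -?scalemxAl -?scalemxAr ?scalerA.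
  by rewrite mulfV// scale1r.
by rewrite unitmxZ ?GLvalP ?unitfE.
Qed.
End ProjectiveGroup.

(* The function is total on [G]; its values outside [K] are irrelevant. *)
Record proj_rep (R : realType) (G : lieGroupType R) (K : subgroup G) (n : nat)
    := ProjRep {
  proj_fun :> G -> PGL R n;
  proj_mul : forall g h, sgset K g -> sgset K h ->
    proj_fun (g * h)%g = PGL_mul (proj_fun g) (proj_fun h);
  proj_continuous : {within sgset K, continuous proj_fun} }.

Section ConjugationAction.
Variables (R : realType) (G : lieGroupType R) (K : subgroup G) (n : nat).
Variable sigma : proj_rep K n.
Local Notation glU := (gl R^o n).

Definition conj_act (k : G) (m : glU) : glU := PGL_conj (sigma k) m.

Fact conj_actM h k m : sgset K h -> sgset K k ->
  conj_act (h * k)%g m = conj_act h (conj_act k m).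
Proof.
move=> Kh Kk; rewrite /conj_act proj_mul//.
rewrite -(PGL_reprK (sigma h)) -(PGL_reprK (sigma k)) PGL_mulE !PGL_conjE.
set u := PGL_repr _; set v := PGL_repr _.
rewrite GLvalM.
have -> : invmx (GLval u *m GLval v) = invmx (GLval v) *m invmx (GLval u).
  apply: (can_inj (mulKmx (GL_mul_subproof u v))).
  rewrite mulmxV ?GL_mul_subproof// -mulmxA (mulmxA (GLval v)).
  by rewrite mulmxV ?GLvalP// mul1mx mulmxV ?GLvalP.
by rewrite !mulmxA.
Qed.

Fact conj_act_inj k : injective (conj_act k).
Proof.
move=> m m' /(congr1 (mulmxr (GLval (PGL_repr (sigma k))))) /=.
rewrite !mulmxKV ?GLvalP// => /(congr1 (mulmx (invmx (GLval (PGL_repr (sigma k)))))).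
by rewrite !mulKmx ?GLvalP.
Qed.

Fact conj_act1 m : conj_act 1%g m = m.
Proof.
apply: (@conj_act_inj 1%g); rewrite -conj_actM; [|exact: subgroup1..].
by rewrite mulg1.
Qed.

Fact conj_act_morph h : sgset K h -> alg_morphism (conj_act h).
Proof.
move=> _; split.
- move=> c x y; rewrite /conj_act /PGL_conj mulmxDr mulmxDl; congr (_ + _).
  have sE (z : glU) : c *: z = (c *: (z : 'M[R]_n) : 'M[R]_n).
    by apply/matrixP => i j; rewrite !mxE.
  by rewrite !sE -scalemxAr -scalemxAl.
- move=> x y; rewrite /conj_act /PGL_conj /amul /= /gl_mul.
  by rewrite !mulmxA mulmxKV ?GLvalP.
- by rewrite /conj_act /PGL_conj /aone /= /gl_one mulmx1 mulmxV ?GLvalP.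
Qed.

Definition conj_action : alg_action K glU :=
  AlgAction conj_act1 conj_actM conj_act_morph.
End ConjugationAction.

(* A complex representation on [E] is given by the operators [rho x], for [x]
   in a set [S] (the group); the subrepresentations are the [S]-stable
   subspaces. *)
Section Constituents.
Variables (R : realType) (E : vectType R[i]) (X : Type) (S : set X).
Variable rho : X -> E -> E.
Implicit Types V W : {vspace E}.

Definition subrep V : Prop := forall x v, S x -> v \in V -> rho x v \in V.

Definition irrep V : Prop :=
  [/\ subrep V, V != 0%VS &
      forall W, subrep W -> (W <= V)%VS -> W = 0%VS \/ W = V].

Definition antilinear (f : E -> E) : Prop :=
  forall (c : R[i]) u v, f (c *: u + v) = conjc c *: f u + f v.

Definition commutes_on V (f : E -> E) : Prop :=
  forall x v, S x -> v \in V -> f (rho x v) = rho x (f v).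

Definition iso_rep V W : Prop :=
  exists f : E -> E, [/\ linear f, set_bij [set` V] [set` W] f & commutes_on V f].

(* [W] is isomorphic to the conjugate of [V]; a linear map from the conjugate
   of [V] is an antilinear map from [V]. *)
Definition conj_iso_rep V W : Prop :=
  exists f : E -> E,
    [/\ antilinear f, set_bij [set` V] [set` W] f & commutes_on V f].

Definition structure_map V (eps : R[i]) : Prop :=
  exists j : E -> E, [/\ antilinear j, commutes_on V j,
    forall v, v \in V -> j v \in V & forall v, v \in V -> j (j v) = eps *: v].

Definition complex_irrep V : Prop := irrep V /\ ~ conj_iso_rep V V.
Definition real_irrep V : Prop := irrep V /\ structure_map V 1.
Definition quaternionic_irrep V : Prop := irrep V /\ structure_map V (-1).

Definition decomposition (N : nat) (V : 'I_N -> {vspace E}) : Prop :=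
  [/\ forall j, irrep (V j), directv (\sum_j V j) & (\sum_j V j)%VS = fullv].

(* The number of summands related to [W] by [r] in a decomposition of [E] into
   irreducible subrepresentations (0 if there is no decomposition). *)
Definition multiplicity_for (r : {vspace E} -> {vspace E} -> Prop) W : nat :=
  xget 0%N [set m | exists N (V : 'I_N -> {vspace E}),
    decomposition V /\ #|[pred j | `[< r W (V j) >]]| = m].

Definition multiplicity W : nat := multiplicity_for iso_rep W.

(* The number of copies of the sum of [W] and its conjugate. *)
Definition conj_pair_multiplicity W : nat :=
  minn (multiplicity_for iso_rep W) (multiplicity_for conj_iso_rep W).

(* The number of copies of the sum of [W] and [W]. *)
Definition pair_multiplicity W : nat := (multiplicity W)./2.

(* The [W i] meet every class, for [r], of the subrepresentations satisfying
   [P], exactly once. *)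
Definition representatives (P : {vspace E} -> Prop)
    (r : {vspace E} -> {vspace E} -> Prop) (p : nat) (W : 'I_p -> {vspace E}) :
    Prop :=
  (forall i, P (W i)) /\ forall V, P V -> exists! i, r (W i) V.

Definition iso_or_conj V W : Prop := iso_rep V W \/ conj_iso_rep V W.
End Constituents.

Section LinearLift.
Variables (R : realType) (G : lieGroupType R) (K : subgroup G) (n : nat).
Variable sigma : proj_rep K n.

Definition lift_group : set (G * GL R n) :=
  [set x | [/\ sgset K x.1, sigma x.1 = GL_class x.2 &
               `|\det (GLval x.2)| = 1]].

(* The action on the complexification C^n of R^n. *)
Definition lift_act (x : G * GL R n) (v : 'cV[R[i]]_n) : 'cV[R[i]]_n :=
  map_mx (real_complex R) (GLval x.2) *m v.
End LinearLift.

(* Main.v *)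
(* A map in A(G, K, gl(U)) is constant, so the algebra is the commutant of the
   lifted group in gl(U), that is, the real points of its commutant in the
   complex matrices.

   Compactness of K only enters through the boundedness of the lifted group,
   which gives an invariant scalar product: on a convex invariant set of
   positive definite forms, the supremum of the squared Frobenius norm over an
   orbit is an invariant and uniformly convex function, so its minimising
   sequences converge to a fixed form.  Adjoints for this form turn the complex
   commutant into a *-algebra; irreducible subrepresentations of the
   complexification are the images of its minimal self-adjoint idempotents, and
   an isomorphism between two of them is a partial isometry of the commutant.

   The identity is an orthogonal sum of real idempotents of the form p, with p
   minimal and real (real type), or p + conj(p), with p minimal, orthogonal to
   conj(p) and not of real type (complex or quaternionic type).  Equivalent
   blocks are related by real partial isometries, which are matrix units over
   the real algebra e A e of a block e; the latter is R, C or H. *)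
Require Import Defs.
From mathcomp Require Import all_boot all_order all_algebra.
From mathcomp Require Import complex ring lra.
From mathcomp Require Import all_classical all_reals all_analysis.

Set Implicit Arguments.
Unset Strict Implicit.
Unset Printing Implicit Defensive.

Import Order.TTheory GRing.Theory Num.Theory.
Import numFieldNormedType.Exports.

Local Open Scope classical_set_scope.
Local Open Scope ring_scope.

(** * Invariant scalar products of bounded matrix groups *)

(** The choice between p and p + conj(p) is forced: if p * conj(p) is nonzero for a minimal p, it
    is, up to scaling, a real structure on the image of p. A minimal p not of real type is therefore
    automatically orthogonal to its conjugate. A block of complex type contains one copy of each
    member of a conjugate pair; in quaternionic type p and conj(p) are equivalent, so a block
    contains two copies of the same irrep, whence the halved multiplicity. In all three types the
    size of the matrix algebra is the number of blocks in a class.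

    The multiplicities are counted in an unspecified decomposition, which need not be orthogonal, so
    their values require a uniqueness argument. The sum of the projections of one class is the
    projection onto an isotypic component; its image is the sum of the summands of that type in
    every decomposition, and comparing dimensions gives the count. *)

Definition normsq (R : realFieldType) m n (X : 'M[R]_(m, n)) : R :=
  \sum_i \sum_j X i j ^+ 2.

Section NormSq.
Variable R : realFieldType.
Implicit Types m n k : nat.

Lemma normsq_ge0 m n (X : 'M[R]_(m, n)) : 0 <= normsq X.
Proof. by do 2!(apply: sumr_ge0 => ? _); exact: sqr_ge0. Qed.

Lemma sqr_le_normsq m n (X : 'M[R]_(m, n)) i j : X i j ^+ 2 <= normsq X.
Proof.
rewrite /normsq (bigD1 i)//= (bigD1 j)//= -addrA lerDl addr_ge0//.
  by apply: sumr_ge0 => ? _; exact: sqr_ge0.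
by do 2!(apply: sumr_ge0 => ? _); exact: sqr_ge0.
Qed.

Lemma normsq0_eq0 m n (X : 'M[R]_(m, n)) : normsq X <= 0 -> X = 0.
Proof.
move=> X0; apply/matrixP => i j; rewrite mxE; apply/eqP.
by rewrite -sqrf_eq0 eq_le sqr_ge0 andbT (le_trans (sqr_le_normsq X i j)).
Qed.

Lemma normsqZ m n c (X : 'M[R]_(m, n)) : normsq (c *: X) = c ^+ 2 * normsq X.
Proof.
rewrite /normsq mulr_sumr; apply: eq_bigr => i _; rewrite mulr_sumr.
by apply: eq_bigr => j _; rewrite mxE exprMn.
Qed.

Lemma normsqN m n (X : 'M[R]_(m, n)) : normsq (- X) = normsq X.
Proof. by rewrite -scaleN1r normsqZ sqrrN expr1n mul1r. Qed.

Lemma normsq_tr m n (X : 'M[R]_(m, n)) : normsq X^T = normsq X.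
Proof.
rewrite /normsq exchange_big; apply: eq_bigr => i _.
by apply: eq_bigr => j _; rewrite mxE.
Qed.

Lemma parallelogram m n (X Y : 'M[R]_(m, n)) :
  normsq (X + Y) + normsq (X - Y) = 2 * normsq X + 2 * normsq Y.
Proof.
rewrite /normsq !mulr_sumr -!big_split; apply: eq_bigr => i _.
rewrite /= !mulr_sumr -!big_split; apply: eq_bigr => j _ /=.
by rewrite !mxE; ring.
Qed.

Lemma normsqD_le m n (X Y : 'M[R]_(m, n)) :
  normsq (X + Y) <= 2 * normsq X + 2 * normsq Y.
Proof. by rewrite -parallelogram lerDl normsq_ge0. Qed.

Lemma cauchy_schwarz_sum k (a b : 'I_k -> R) :
  (\sum_i a i * b i) ^+ 2 <= (\sum_i a i ^+ 2) * (\sum_i b i ^+ 2).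
Proof.
have : 0 <= \sum_i \sum_j (a i * b j - a j * b i) ^+ 2.
  by do 2!(apply: sumr_ge0 => ? _); exact: sqr_ge0.
have -> : \sum_i \sum_j (a i * b j - a j * b i) ^+ 2 =
    2 * ((\sum_i a i ^+ 2) * (\sum_i b i ^+ 2)) - 2 * (\sum_i a i * b i) ^+ 2.
  pose s := \sum_i \sum_j (a i ^+ 2 * b j ^+ 2).
  pose t := \sum_i \sum_j (a i * b i * (a j * b j)).
  have -> : (\sum_i a i ^+ 2) * (\sum_i b i ^+ 2) = s.
    rewrite mulr_suml; apply: eq_bigr => i _; by rewrite mulr_sumr.
  have -> : (\sum_i a i * b i) ^+ 2 = t.
    rewrite expr2 mulr_suml; apply: eq_bigr => i _; by rewrite mulr_sumr.
  have -> : 2 * s = s + \sum_i \sum_j (a j ^+ 2 * b i ^+ 2).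
    by rewrite mulrDl mul1r; congr (_ + _); exact: exchange_big.
  rewrite /s /t mulr_sumr -big_split -sumrB; apply: eq_bigr => i _ /=.
  rewrite mulr_sumr -big_split -sumrB; apply: eq_bigr => j _ /=; ring.
by rewrite subr_ge0 ler_pM2l.
Qed.

Lemma normsqM_le m n k (X : 'M[R]_(m, n)) (Y : 'M[R]_(n, k)) :
  normsq (X *m Y) <= normsq X * normsq Y.
Proof.
rewrite /normsq mulr_suml; apply: ler_sum => i _.
rewrite [X in _ * X]exchange_big mulr_sumr.
by apply: ler_sum => j _; rewrite mxE; exact: cauchy_schwarz_sum.
Qed.

End NormSq.

Section InvariantForm.
Variables (R : realType) (n : nat) (Gam : set 'M[R]_n) (B : R).
Hypothesis Gam1 : Gam 1%:M.
Hypothesis GamM : forall a b, Gam a -> Gam b -> Gam (a *m b).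
Hypothesis GamV : forall a, Gam a -> exists2 b, Gam b & a *m b = 1%:M.
Hypothesis GamB : forall a, Gam a -> normsq a <= B.
Implicit Types (P Q X a b g h : 'M[R]_n) (x : 'cV[R]_n).

Let conj g X := g^T *m X *m g.
Let F P := sup [set normsq (conj g P) | g in Gam].
(** The symmetric forms whose value at [x] is at least the infimum of [normsq (g *m x)] over [Gam];
    quantifying over lower bounds [t] states this without an infimum. The condition is convex and
    invariant, and it keeps a limit of such forms definite. *)
Let Cset : set 'M[R]_n := [set P | P^T = P /\
  forall x t, (forall g, Gam g -> t <= normsq (g *m x)) ->
    t <= (x^T *m P *m x) 0 0].

Let B_ge0 : 0 <= B.
Proof. exact: le_trans (normsq_ge0 _) (GamB Gam1). Qed.

Let conj_le g X : Gam g -> normsq (conj g X) <= B ^+ 2 * normsq X.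
Proof.
move=> Gg; have gB := GamB Gg.
apply: le_trans (normsqM_le _ _) _.
rewrite (_ : B ^+ 2 * _ = B * normsq X * B); last by ring.
apply: ler_pM => //; rewrite ?normsq_ge0//.
apply: le_trans (normsqM_le _ _) _; rewrite normsq_tr.
by apply: ler_pM => //; rewrite ?normsq_ge0.
Qed.

Let conjM g h X : conj h (conj g X) = conj (g *m h) X.
Proof. by rewrite /conj trmx_mul !mulmxA. Qed.

Let F_has P : has_sup [set normsq (conj g P) | g in Gam].
Proof.
split; first by exists (normsq (conj 1%:M P)); exists 1%:M.
by exists (B ^+ 2 * normsq P) => _ [g Gg <-]; exact: conj_le.
Qed.

Let F_ub P g : Gam g -> normsq (conj g P) <= F P.
Proof.
move=> Gg; apply: ub_le_sup; first by have [] := F_has P.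
by exists g.
Qed.

Let F_le P t : (forall g, Gam g -> normsq (conj g P) <= t) -> F P <= t.
Proof.
move=> H; apply: ge_sup; first by have [] := F_has P.
by move=> _ [g Gg <-]; exact: H.
Qed.

Let F_ge0 P : 0 <= F P.
Proof. exact: le_trans (normsq_ge0 _) (F_ub P Gam1). Qed.

Let F_conj P h : Gam h -> F (conj h P) <= F P.
Proof.
by move=> Gh; apply: F_le => g Gg; rewrite conjM; apply/F_ub/GamM.
Qed.

(** The inverse of [g] also lies in [Gam] and undoes [conj g] at the cost of a factor [B ^+ 2]. *)
Let conj_lower g X : Gam g -> normsq X <= B ^+ 2 * normsq (conj g X).
Proof.
move=> Gg; have [h Gh gh1] := GamV Gg.
rewrite -[X in normsq X <= _](_ : conj h (conj g X) = X); first exact: conj_le.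
by rewrite conjM gh1 /conj trmx1 mul1mx mulmx1.
Qed.

(* The uniform convexity of [F] makes minimising sequences Cauchy. *)
Let F_mid P Q :
  normsq (P - Q) <=
    B ^+ 2 * (2 * F P + 2 * F Q - 4 * F (2^-1 *: (P + Q))).
Proof.
(* The main argument divides by [B ^+ 2]; for [B = 0] the lower bound already forces [P - Q] to
   vanish. *)
have [B0|Bn0] := eqVneq B 0.
  rewrite B0 expr0n mul0r.
  by have := conj_lower (P - Q) Gam1; rewrite B0 expr0n mul0r.
have B2 : 0 < B ^+ 2 by rewrite exprn_gt0// lt_neqAle eq_sym Bn0.
rewrite mulrC -ler_pdivrMr// lerBrDr -lerBrDl -ler_pdivlMl//.
apply: F_le => g Gg; rewrite ler_pdivlMl// lerBrDl.
have -> : 4 * normsq (conj g (2^-1 *: (P + Q))) = normsq (conj g P + conj g Q).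
  rewrite /conj -scalemxAr -scalemxAl normsqZ mulmxDr mulmxDl.
  by rewrite mulrA (_ : 4 * _ = 1) ?mul1r//; field.
apply: le_trans (_ : normsq (conj g (P - Q)) + normsq (conj g P + conj g Q)
  <= _).
  by rewrite lerD2r ler_pdivrMr// mulrC conj_lower.
have -> : conj g (P - Q) = conj g P - conj g Q.
  by rewrite /conj mulmxBr mulmxBl.
by rewrite addrC parallelogram lerD// ler_pM2l// F_ub.
Qed.

Let Cset1 : Cset 1%:M.
Proof.
split; first exact: trmx1.
move=> x t /(_ _ Gam1); rewrite mulmx1 mul1mx => /le_trans; apply.
rewrite /normsq mxE; apply: ler_sum => i _.
by rewrite big_ord1 mxE expr2.
Qed.

Let Cset_conj P h : Gam h -> Cset P -> Cset (conj h P).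
Proof.
move=> Gh [PT PP]; split; first by rewrite /conj !trmx_mul trmxK PT mulmxA.
move=> x t H.
have := PP (h *m x) t; rewrite trmx_mul !mulmxA; apply=> g Gg.
by rewrite mulmxA; apply/H/GamM.
Qed.

Let Cset_mid P Q : Cset P -> Cset Q -> Cset (2^-1 *: (P + Q)).
Proof.
move=> [PT PP] [QT QQ]; split; first by rewrite linearZ linearD /= PT QT.
move=> x t H; have := PP x t H; have := QQ x t H.
rewrite -scalemxAr -scalemxAl mulmxDr mulmxDl !mxE; lra.
Qed.

Let quad_sqr (X : 'M[R]_n) x :
  ((x^T *m X *m x) 0 0) ^+ 2 <= normsq x ^+ 2 * normsq X.
Proof.
apply: le_trans (sqr_le_normsq _ _ _) _.
apply: le_trans (normsqM_le _ _) _; rewrite expr2 mulrAC.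
rewrite ler_wpM2r ?normsq_ge0//; apply: le_trans (normsqM_le _ _) _.
by rewrite normsq_tr.
Qed.

Let minF := inf (F @` Cset).

Let minF_le P : Cset P -> minF <= F P.
Proof.
move=> CP; apply: ge_inf; last by exists P.
by exists 0 => _ [Q _ <-]; exact: F_ge0.
Qed.

(** The midpoint stays in [Cset], so [F] is at least [minF] there; in [F_mid] the multiples of
    [minF] cancel and [4 * e] remains. *)
Let near_min P Q (e : R) : Cset P -> Cset Q -> F P <= minF + e -> F Q
  <= minF + e ->
  normsq (P - Q) <= B ^+ 2 * (4 * e).
Proof.
move=> CP CQ Pe Qe; apply: le_trans (F_mid P Q) _.
apply: ler_wpM2l; first exact: sqr_ge0.
have := minF_le (Cset_mid CP CQ); lra.
Qed.

Let minimizing : exists2 P_ : nat -> 'M[R]_n, forall k, Cset (P_ k) &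
  forall k, F (P_ k) <= minF + k.+1%:R^-1.
Proof.
have /choice[P_ HP] : forall k : nat, exists P, Cset P /\ F P
  <= minF + k.+1%:R^-1.
  move=> k; have : minF < minF + k.+1%:R^-1 by rewrite ltrDl.
  have hi : F @` Cset !=set0 by exists (F 1%:M); exists 1%:M; [exact: Cset1|].
  case/(inf_lt hi) => _ [P CP <-] /ltW ?; exists P; split => //.
by exists P_ => k; have [] := HP k.
Qed.

Let near_inv (e : R) : 0 < e -> \forall k \near \oo, k.+1%:R^-1 < e.
Proof. by move=> e0; exact: near_infty_natSinv_lt (PosNum e0). Qed.

Lemma invariant_form : exists P : 'M[R]_n, [/\ P^T = P,
  forall x, x != 0 -> 0 < (x^T *m P *m x) 0 0 &
  forall g, Gam g -> g^T *m P *m g = P].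
Proof.
have [P_ CP minP] := minimizing.
have close k l : (k <= l)%N ->
    normsq (P_ k - P_ l) <= B ^+ 2 * (4 * k.+1%:R^-1).
  move=> kl; apply: near_min => //; apply: le_trans (minP _) _.
  by rewrite lerD2l lef_pV2 ?posrE// ler_nat.
have smallB (e : R) : 0 < e -> \forall k \near \oo, B ^+ 2 * (4 * k.+1%:R^-1) <
  e.
  move=> e0; have c0 : 0 < (B ^+ 2 * 4 + 1) :> R.
    by rewrite ltr_wpDl// mulr_ge0// sqr_ge0.
  near=> k.
  have : k.+1%:R^-1 < e / (B ^+ 2 * 4 + 1).
    by near: k; apply: near_inv; rewrite divr_gt0.
  rewrite ltr_pdivlMr// => /le_lt_trans; apply.
  by rewrite mulrA mulrC ler_pM2l// lerDl.
have cvgP i j : cvg ((fun k => P_ k i j) @ \oo).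
  apply/cauchy_cvgP/cauchy_exP => e e0.
  have /smallB [N _ HN] : 0 < e ^+ 2 by rewrite exprn_gt0.
  exists (P_ N i j); exists N => // k /= Nk.
  rewrite /ball /= -(ltr_pXn2r (n := 2))// ?nnegrE ?(ltW e0)// real_normK
    ?num_real//.
  have := HN N (leqnn N); apply: le_lt_trans; apply: le_trans (close _ _ Nk).
  by have := sqr_le_normsq (P_ N - P_ k) i j; rewrite !mxE.
pose L := \matrix_(i, j) lim ((fun k => P_ k i j) @ \oo).
have nearL (e : R) : 0 < e -> \forall k \near \oo, normsq (L - P_ k) <= e.
  (* An entrywise error below [d] makes the [n * n] squares add up to at most [e]; the successor
     keeps the denominator positive for [n = 0]. *)
  move=> e0; pose d := Num.sqrt (e / (n * n).+1%:R).
  have d0 : 0 < d by rewrite sqrtr_gt0 divr_gt0.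
  have H : \forall k \near \oo, forall ij : 'I_n * 'I_n,
      `|L ij.1 ij.2 - P_ k ij.1 ij.2| < d.
    apply: filter_forall => -[i j] /=; rewrite mxE.
    by move/cvgrPdist_lt : (cvgP i j) => /(_ _ d0).
  near=> k.
  have Hd : forall i j, `|L i j - P_ k i j| < d.
    suff H' : forall ij : 'I_n * 'I_n, `|L ij.1 ij.2 - P_ k ij.1 ij.2| < d.
      by move=> i j; exact: H' (i, j).
    by near: k; exact: H.
  have Hk i j : (L - P_ k) i j ^+ 2 <= e / (n * n).+1%:R.
    rewrite -(sqr_sqrtr (a := e / _)) ?divr_ge0 ?(ltW e0)// -/d !mxE.
    have := Hd i j; rewrite !mxE => /ltW Hij.
    by rewrite -real_normK ?num_real// ler_pXn2r ?nnegrE// ltW.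
  apply: le_trans (_ : \sum_(i < n) \sum_(j < n) (e / (n * n).+1%:R) <= _).
    by apply: ler_sum => i _; apply: ler_sum => j _.
  rewrite !sumr_const !card_ord -mulrnA -[leLHS]mulr_natr -mulrA ger_pMr//.
  by rewrite mulrC ler_pdivrMr// mul1r ler_nat.
have approx (e : R) : 0 < e ->
    exists k, normsq (L - P_ k) <= e /\ B ^+ 2 * (4 * k.+1%:R^-1) <= e.
  move=> e0.
  have : \forall k \near \oo,
      normsq (L - P_ k) <= e /\ B ^+ 2 * (4 * k.+1%:R^-1) <= e.
    near=> k; split; first by near: k; exact: nearL.
    by apply: ltW; near: k; exact: smallB.
  by case=> N _ /(_ N (leqnn N)); exists N.
exists L; split.
- apply/matrixP => i j; rewrite !mxE.
  suff -> : (fun k => P_ k j i) = (fun k => P_ k i j) by [].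
  by apply/funext => k; have [/matrixP/(_ i j) <- _] := CP k; rewrite mxE.
- move=> x x0.
  have Bx : 0 < normsq x / (B + 1).
    rewrite divr_gt0//; last by rewrite ltr_wpDl.
    rewrite lt_neqAle normsq_ge0 andbT eq_sym; apply: contra x0 => /eqP N0.
    by apply/eqP/normsq0_eq0; rewrite N0.
  (* An inverse of [g] in [Gam] bounds [normsq x] by [B * normsq (g *m x)], and membership in [Cset]
     turns this into a lower bound uniform in [k]; [B + 1] is positive even if [B] is 0. *)
  have lowP k : normsq x / (B + 1) <= (x^T *m P_ k *m x) 0 0.
    have [_] := CP k; apply=> g Gg; have [h Gh gh] := GamV Gg.
    have hg : h *m g = 1%:M by exact: mulmx1C.
    rewrite ler_pdivrMr ?ltr_wpDl//.
    rewrite -{1}(mul1mx x) -hg -mulmxA mulrC.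
    apply: le_trans (normsqM_le _ _) _.
    by rewrite ler_wpM2r ?normsq_ge0// (le_trans (GamB Gh))// lerDl.
  apply: lt_le_trans Bx _; rewrite leNgt; apply/negP => lt.
  pose d := normsq x / (B + 1) - (x^T *m L *m x) 0 0.
  have d0 : 0 < d by rewrite subr_gt0.
  have x2 : 0 < normsq x ^+ 2 + 1 by rewrite ltr_wpDl// sqr_ge0.
  (* With this tolerance the squared error of the quadratic form at [x] is at most [d ^+ 2 / 2],
     whereas the assumed gap is at least [d]. *)
  have [|k [Lk _]] := approx (d ^+ 2 / (2 * (normsq x ^+ 2 + 1))).
    by rewrite divr_gt0 ?exprn_gt0// mulr_gt0.
  have := quad_sqr (L - P_ k) x.
  have -> : (x^T *m (L - P_ k) *m x) 0 0 =
      (x^T *m L *m x) 0 0 - (x^T *m P_ k *m x) 0 0.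
    by rewrite mulmxBr mulmxBl [LHS]mxE [X in _ + X]mxE.
  have dle : d <= (x^T *m P_ k *m x) 0 0 - (x^T *m L *m x) 0 0.
    by rewrite /d lerD2r.
  have {}dle : d ^+ 2 <= ((x^T *m P_ k *m x) 0 0 - (x^T *m L *m x) 0 0) ^+ 2.
    by rewrite ler_pXn2r ?nnegrE ?(le_trans _ dle)// ltW.
  rewrite -[X in X ^+ 2 <= _]opprB sqrrN => /(le_trans dle).
  apply/negP; rewrite -ltNge.
  apply: (@le_lt_trans _ _ ((normsq x ^+ 2 + 1) *
      (d ^+ 2 / (2 * (normsq x ^+ 2 + 1))))).
    apply: ler_pM Lk => //; [exact: sqr_ge0|exact: normsq_ge0|].
    by rewrite lerDl.
  rewrite [ltLHS](_ : _ = d ^+ 2 / 2); last by field; rewrite gt_eqF.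
  have d2 : 0 < d ^+ 2 by rewrite exprn_gt0.
  by rewrite ltr_pdivrMr// ltr_pMr// ltr1n.
(* Invariance does not go through minimality of the limit: [P_ k] and [conj g (P_ k)] are both
   nearly minimal, hence close to each other, and both are close to [L] and [conj g L]. *)
- move=> g Gg; rewrite -/(conj g L); apply/eqP; rewrite -subr_eq0.
  apply/eqP/normsq0_eq0; rewrite leNgt; apply/negP => N0.
  (* The error terms below add up to at most [(2 * B ^+ 2 + 8) * e], and [2 * C] exceeds this
     coefficient. *)
  pose C := 4 * B ^+ 2 + 6.
  have C0 : 0 < C by rewrite /C; have := sqr_ge0 B; lra.
  have [|k [Lk kB]] := approx (normsq (conj g L - L) / (2 * C)).
    by rewrite divr_gt0// mulr_gt0.
  set e := normsq _ / _ in Lk kB.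
  have h1 : normsq (conj g L - conj g (P_ k)) <= B ^+ 2 * e.
    rewrite -[_ - _](_ : conj g (L - P_ k) = _);
      last by rewrite /conj mulmxBr mulmxBl.
    apply: le_trans (conj_le _ Gg) _.
    by rewrite ler_wpM2l// sqr_ge0.
  have h2 : normsq (conj g (P_ k) - P_ k) <= e.
    apply: le_trans kB; apply: near_min => //; first exact: Cset_conj.
    exact: le_trans (F_conj _ Gg) (minP k).
  have h3 : normsq (P_ k - L) <= e by rewrite -normsqN opprB.
  have e0 : 0 < e by rewrite divr_gt0// mulr_gt0.
  have : normsq (conj g L - L) <= 2 * (B ^+ 2 * e) + 2 * (2 * e + 2 * e).
    have -> : conj g L - L = (conj g L - conj g (P_ k)) +
       ((conj g (P_ k) - P_ k) + (P_ k - L)).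
      by rewrite !addrA !subrK.
    apply: le_trans (normsqD_le _ _) _.
    have := normsqD_le (conj g (P_ k) - P_ k) (P_ k - L); lra.
  have -> : normsq (conj g L - L) = 2 * C * e by rewrite /e; field; lra.
  rewrite /C; have : 0 <= B ^+ 2 * e by rewrite mulr_ge0 ?sqr_ge0// ltW.
  lra.
Unshelve. all: by end_near.
Qed.

End InvariantForm.

(** * The lifted group *)

Local Notation GLval := Defs.GLval.

Section LiftGroup.
Variables (R : realType) (G : lieGroupType R) (K : subgroup G) (n : nat).
Variable sigma : proj_rep K n.
Implicit Types u v : GL R n.

Lemma normsq_continuous m k : continuous (@normsq R m k).
Proof.
apply: continuous_big => [|i _]; first exact: add_continuous.
apply: continuous_big => [|j _ X]; first exact: add_continuous.
apply: (@continuous_comp _ _ _ (fun X : 'M[R]_(m, k) => X i j)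
  (fun x => x ^+ 2)).
  exact: coord_continuous.
exact: exprn_continuous.
Qed.

Lemma det_continuous k : continuous (fun A : 'M[R]_k => \det A).
Proof.
apply: continuous_big => [|s _]; first exact: add_continuous.
move=> X; apply: (@continuousM R _ (fun=> _) _ X).
  exact: cst_continuous.
move: X; rewrite -/(continuous _).
apply: continuous_big => [|? _]; first exact: mul_continuous.
exact: coord_continuous.
Qed.

(** Homogeneous of degree 0, so it descends to [PGL] and is bounded on the compact image of [K].
    Where the determinant has absolute value 1 it is the [n]-th power of [normsq], so it bounds the
    lifted group. *)
Let phi u : R := normsq (GLval u) ^+ n / \det (GLval u) ^+ 2.

Let phi_continuous : continuous phi.
Proof.
have valc : continuous (@GLval R n).
  exact: (@initial_continuous (set_type _) _ set_val).
move=> u; apply: (@continuousM R _ (fun u => normsq (GLval u) ^+ n)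
  (fun u => (\det (GLval u) ^+ 2)^-1) u).
  apply: (@continuous_comp _ _ _ (@GLval R n) (fun X => normsq X ^+ n)).
    exact: valc.
  apply: (@continuous_comp _ _ _ (@normsq R n n) (fun x => x ^+ n)).
    exact: normsq_continuous.
  exact: exprn_continuous.
apply: (@continuousV R _ (fun u => \det (GLval u) ^+ 2) u);
  first by rewrite expf_neq0// -unitfE -unitmxE GLvalP.
apply: (@continuous_comp _ _ _ (@GLval R n) (fun X => \det X ^+ 2)).
  exact: valc.
apply: (@continuous_comp _ _ _ (fun X : 'M[R]_n => \det X) (fun x => x ^+ 2)).
  exact: det_continuous.
exact: exprn_continuous.
Qed.

Let phi_prop u v : proportional u v -> phi u = phi v.
Proof.
move=> /asboolP[c c0 E]; rewrite /phi E normsqZ detZ.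
rewrite [X in X / _]exprMn [X in _ / X]exprMn -mulf_div.
rewrite (_ : (c ^+ 2) ^+ n = (c ^+ n) ^+ 2); last by rewrite -!exprM mulnC.
by rewrite divff ?mul1r// !expf_neq0.
Qed.

Lemma lift_group_bounded : compact (sgset K) ->
  exists B : R, forall x, lift_group sigma x -> normsq (GLval x.2) <= B.
Proof.
move=> cK; pose psi : PGL R n -> R := fun x => phi (PGL_repr x).
have psiE u : psi (GL_class u) = phi u.
  by apply: phi_prop; apply/GL_classE; exact: PGL_reprK.
have psic : continuous psi.
  apply: repr_comp_continuous; first exact: phi_continuous.
  by move=> u v /eqP/GL_classE /phi_prop ->.
have /compact_bounded[M [_ HM]] : compact ((psi \o sigma) @` sgset K).
  apply: continuous_compact => // x.
  apply: (@continuous_comp (subspace (sgset K)) (PGL R n) R sigma psi x).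
    exact: (@Defs.proj_continuous _ _ _ _ sigma x).
  exact: psic.
(* For [n = 0] the exponent in [phi] is zero and says nothing about [normsq], but then there are no
   entries. *)
case: (posnP n) => [n0|n0].
  exists 0 => x _; rewrite /normsq; suff -> : \sum_(i < n) \sum_(j < n)
    GLval x.2 i j ^+ 2 = 0 by [].
  by apply: big1 => i _; have := ltn_ord i; rewrite {2}n0.
exists (Num.max (M + 1) 1) => -[k a] /= [Kk Ek da].
have : phi a <= M + 1.
  rewrite (le_trans (ler_norm _))//; apply: (HM (M + 1));
    first by rewrite ltrDl.
  by exists k => //=; rewrite Ek psiE.
rewrite /phi -(real_normK (num_real (\det _))) da expr1n divr1 => aM.
case: (leP (normsq (GLval a)) 1) => [a1|a1].
  by rewrite le_max a1 orbT.
rewrite le_max (le_trans _ aM)// -[X in X <= _]expr1.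
by rewrite ler_eXn2l.
Qed.

End LiftGroup.

Section LiftMatrices.
Variables (R : realType) (G : lieGroupType R) (K : subgroup G) (n : nat).
Variable sigma : proj_rep K n.

Definition lift_mx : set 'M[R]_n :=
  [set GLval x.2 | x in lift_group sigma].

Let mk1 : GL R n := mkGL (unitmx1 R n).

(** Multiplicativity makes the class of 1 equal to its own square; cancelling an invertible
    representative shows that it is scalar. *)
Let sigma1 : sigma 1%g = GL_class mk1.
Proof.
have := @proj_mul _ _ _ _ sigma _ _ (subgroup1 K) (subgroup1 K); rewrite mulg1.
rewrite -(PGL_reprK (sigma 1%g)); set u := PGL_repr _.
rewrite PGL_mulE => /GL_classE/asboolP[c c0]; rewrite GLvalM => E.
apply/GL_classE/asboolP; exists c^-1; first by rewrite invr_eq0.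
suff -> : GLval mk1 = c *: GLval u by rewrite scalerA mulVf// scale1r.
rewrite -[LHS](mulVmx (GLvalP u)) [X in _ *m X]E -scalemxAr.
by rewrite mulKmx ?GLvalP.
Qed.

Lemma lift_mx1 : lift_mx 1%:M.
Proof.
exists (1%g, mk1) => //; split => //=; first exact: subgroup1.
by rewrite det1 normr1.
Qed.

Lemma lift_mxM a b : lift_mx a -> lift_mx b -> lift_mx (a *m b).
Proof.
move=> [[k u] /= [Kk Eu du] <-] [[l v] /= [Kl Ev dv] <-].
exists ((k * l)%g, GL_mul u v); last exact: GLvalM.
split => /=; first exact: subgroupM.
  by rewrite proj_mul// Eu Ev PGL_mulE.
by rewrite GLvalM det_mulmx normrM du dv mulr1.
Qed.

Lemma lift_mxV a : lift_mx a -> exists2 b, lift_mx b & a *m b = 1%:M.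
Proof.
move=> [[k u] /= [Kk Eu du] <-].
have uV : invmx (GLval u) \in unitmx by rewrite unitmx_inv GLvalP.
exists (invmx (GLval u)); last by rewrite mulmxV ?GLvalP.
exists (k^-1%g, mkGL uV) => //; split => /=; first exact: subgroupV.
  have := @proj_mul _ _ _ _ sigma _ _ Kk (subgroupV Kk).
  rewrite mulgV sigma1 Eu -(PGL_reprK (sigma _)) PGL_mulE.
  move=> /GL_classE/asboolP[c c0]; rewrite GLvalM => E.
  apply/GL_classE/asboolP; exists c^-1; first by rewrite invr_eq0.
  have Eu' : invmx (GLval u) = c *: GLval (PGL_repr (sigma k^-1%g)).
    rewrite -[LHS]mulmx1 [X in _ *m X]E -scalemxAr.
    by rewrite mulKmx ?GLvalP.
  have -> : GLval (mkGL uV) = c *: GLval (PGL_repr (sigma k^-1%g)) by [].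
  by rewrite scalerA mulVf// scale1r.
by rewrite det_inv normrV ?du ?invr1 // -unitmxE GLvalP.
Qed.

Lemma lift_group_surj k : sgset K k -> exists u, lift_group sigma (k, u).
Proof.
move=> Kk; set v := PGL_repr (sigma k).
have Ev : sigma k = GL_class v by rewrite PGL_reprK.
have dv : 0 < `|\det (GLval v)| by rewrite normr_gt0 -unitfE -unitmxE GLvalP.
case: (posnP n) => [n0|n0].
  exists v; split => //=.
  suff -> : GLval v = 1%:M by rewrite det1 normr1.
  by apply/matrixP => i; have := ltn_ord i; rewrite {2}n0.
(* The determinant of [c *: GLval v] is that of [GLval v] times [c ^+ n], so this exponent
   normalises its absolute value to 1. *)
pose c := `|\det (GLval v)| `^ (- n%:R^-1).
have c0 : 0 < c by rewrite powR_gt0.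
have uc : c *: GLval v \in unitmx.
  by rewrite unitmxZ ?GLvalP// unitfE gt_eqF.
exists (mkGL uc); split => //=.
  rewrite Ev; apply/GL_classE/asboolP; exists c^-1.
    by rewrite invr_eq0 gt_eqF.
  by rewrite /GLval /= scalerA mulVf ?scale1r// gt_eqF.
rewrite detZ normrM normrX gtr0_norm// /c -powR_mulrn ?powR_ge0//.
rewrite -powRrM mulNr mulVf ?pnatr_eq0 -?lt0n// powRN powRr1 ?mulVf//.
by rewrite gt_eqF.
Qed.

Lemma lift_mx_invariant (m : 'M[R]_n) :
  (forall k, sgset K k -> conj_act sigma k m = m) <->
  (forall a, lift_mx a -> a *m m = m *m a).
Proof.
have conjP k u : lift_group sigma (k, u) ->
    conj_act sigma k m = m <-> GLval u *m m = m *m GLval u.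
  move=> [Kk /= Eu du]; rewrite /conj_act Eu PGL_conjE; split => E.
    by rewrite -{2}E mulmxKV ?GLvalP.
  by rewrite E mulmxK ?GLvalP.
split=> H.
  by move=> _ [[k u] ku <-]; apply/(conjP _ _ ku)/H; have [] := ku.
move=> k Kk; have [u ku] := lift_group_surj Kk.
by apply/(conjP _ _ ku)/H; exists (k, u).
Qed.

Lemma lift_mx_bounded : compact (sgset K) ->
  exists B : R, forall a, lift_mx a -> normsq a <= B.
Proof.
by move=> /(lift_group_bounded sigma)[B HB]; exists B => _ [x /HB ? <-].
Qed.

End LiftMatrices.

(** * The commutant of a group of real matrices as a star-algebra *)

Section ConjugateMatrix.
Variable C : numClosedFieldType.

Definition bar m n (X : 'M[C]_(m, n)) : 'M[C]_(m, n) := map_mx Num.conj X.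

Lemma barK m n : involutive (@bar m n).
Proof. by move=> X; apply/matrixP => i j; rewrite !mxE conjCK. Qed.

Lemma barD m n (X Y : 'M[C]_(m, n)) : bar (X + Y) = bar X + bar Y.
Proof. exact: map_mxD. Qed.

Lemma barN m n (X : 'M[C]_(m, n)) : bar (- X) = - bar X.
Proof. exact: map_mxN. Qed.

Lemma barZ m n c (X : 'M[C]_(m, n)) : bar (c *: X) = c^* *: bar X.
Proof. exact: map_mxZ. Qed.

Lemma barM m n k (X : 'M[C]_(m, n)) (Y : 'M[C]_(n, k)) :
  bar (X *m Y) = bar X *m bar Y.
Proof. exact: map_mxM. Qed.

Lemma bar_tr m n (X : 'M[C]_(m, n)) : bar X^T = (bar X)^T.
Proof. by rewrite /bar map_trmx. Qed.

Lemma bar1 n : bar (1%:M : 'M[C]_n) = 1%:M.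
Proof. exact: map_mx1. Qed.

Lemma bar0 m n : bar (0 : 'M[C]_(m, n)) = 0.
Proof. exact: map_mx0. Qed.

Lemma bar_inv n (X : 'M[C]_n) : bar (invmx X) = invmx (bar X).
Proof. exact: map_invmx. Qed.

Lemma gt0_sqrtC (l : C) :
  0 < l -> exists s : C, [/\ 0 < s, s^* = s & s * s = l].
Proof.
move=> l0; exists (sqrtC l); split; first by rewrite sqrtC_gt0.
  by rewrite geC0_conj// sqrtC_ge0 ltW.
by rewrite -expr2 sqrtCK.
Qed.

End ConjugateMatrix.

Lemma mulmx_cV_ext (K : pzRingType) m n (A B : 'M[K]_(m, n)) :
  (forall v : 'cV_n, A *m v = B *m v) -> A = B.
Proof.
move=> AB; apply/matrixP => i j.
by have /colP/(_ i) := AB (delta_mx j 0); rewrite -!colE !mxE.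
Qed.

Lemma unitmx_ker (K : fieldType) n (A : 'M[K]_n) :
  (forall v : 'cV_n, A *m v = 0 -> v = 0) -> A \in unitmx.
Proof.
move=> A0; rewrite -unitmx_tr -row_free_unit; apply/inj_row_free => v vA.
apply: trmx_inj; rewrite trmx0; apply: A0.
by apply: trmx_inj; rewrite trmx_mul trmxK vA trmx0.
Qed.

(* Locked: otherwise [mulmxA] would look for products inside adjoints. *)
Fact star_key : unit. Proof. exact: tt. Qed.

Section StarAlgebra.
Variables (C : numClosedFieldType) (n : nat) (Gam : set 'M[C]_n) (P : 'M[C]_n).
Local Notation M := 'M[C]_n.
Implicit Types (X Y e f p q u w : M) (v : 'cV[C]_n) (c l : C).

Definition star X : M := locked_with star_key (invmx P *m (bar X)^T *m P).

Lemma starE X : star X = invmx P *m (bar X)^T *m P.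
Proof. by rewrite /star unlock. Qed.

Definition hform v (w : 'cV[C]_n) : C := ((bar v)^T *m P *m w) 0 0.

Definition commutant X := forall a, Gam a -> a *m X = X *m a.

(** Everything the star-algebra uses about the group and the form. For an invariant form the adjoint
    of a group element is its inverse, which is why each element of [Gam] is the adjoint of
    another. *)
Definition adjoint_setting := [/\ forall a, Gam a -> bar a = a,
  forall a, Gam a -> exists2 b, Gam b & star b = a, bar P = P, P^T = P &
  forall v, v != 0 -> 0 < hform v v].

Hypothesis H : adjoint_setting.

Let Gam_bar : forall a, Gam a -> bar a = a. Proof. by case: H. Qed.
Let Gam_star : forall a, Gam a -> exists2 b, Gam b & star b = a.
Proof. by case: H. Qed.
Let P_bar : bar P = P. Proof. by case: H. Qed.
Let P_tr : P^T = P. Proof. by case: H. Qed.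
Let hform_gt0 : forall v, v != 0 -> 0 < hform v v. Proof. by case: H. Qed.

Let unitP : P \in unitmx.
Proof.
apply: unitmx_ker => x Px0; apply/eqP; apply: contraT => /hform_gt0.
by rewrite /hform -mulmxA Px0 mulmx0 mxE ltxx.
Qed.

Lemma starD X Y : star (X + Y) = star X + star Y.
Proof. by rewrite !starE barD linearD mulmxDr mulmxDl. Qed.

Lemma starZ c X : star (c *: X) = c^* *: star X.
Proof. by rewrite !starE barZ linearZ -scalemxAr -scalemxAl. Qed.

Lemma starN X : star (- X) = - star X.
Proof. by rewrite !starE barN linearN mulmxN mulNmx. Qed.

Lemma starM X Y : star (X *m Y) = star Y *m star X.
Proof. by rewrite !starE barM trmx_mul -!mulmxA (mulKVmx unitP). Qed.

Lemma bar_star X : bar (star X) = star (bar X).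
Proof. by rewrite !starE !barM bar_inv bar_tr P_bar. Qed.

Lemma starK : involutive star.
Proof.
move=> X; rewrite [LHS]starE bar_star starE barK !trmx_mul trmxK.
by rewrite trmx_inv P_tr -!mulmxA (mulKmx unitP) mulVmx// mulmx1.
Qed.

Lemma star0 : star 0 = 0.
Proof. by rewrite !starE bar0 trmx0 mulmx0 mul0mx. Qed.

Lemma star1 : star 1%:M = 1%:M.
Proof. by rewrite !starE bar1 trmx1 mulmx1 mulVmx. Qed.

Lemma commutantD X Y : commutant X -> commutant Y -> commutant (X + Y).
Proof. by move=> BX BY a Ga; rewrite mulmxDr mulmxDl BX// BY. Qed.

Lemma commutantZ c X : commutant X -> commutant (c *: X).
Proof. by move=> BX a Ga; rewrite -scalemxAr -scalemxAl BX. Qed.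

Lemma commutantN X : commutant X -> commutant (- X).
Proof. by move=> BX a Ga; rewrite mulmxN mulNmx BX. Qed.

Lemma commutantM X Y : commutant X -> commutant Y -> commutant (X *m Y).
Proof. by move=> BX BY a Ga; rewrite mulmxA BX// -!mulmxA BY. Qed.

Lemma commutant1 : commutant 1%:M.
Proof. by move=> a _; rewrite mulmx1 mul1mx. Qed.

Lemma commutant_bar X : commutant X -> commutant (bar X).
Proof. by move=> BX a Ga; rewrite -(Gam_bar Ga) -!barM BX. Qed.

Lemma commutant_star X : commutant X -> commutant (star X).
Proof.
by move=> BX a /Gam_star[b Gb <-]; rewrite -starM -(BX b Gb) starM.
Qed.

Hint Resolve commutantD commutantN commutantZ commutantM commutant1
  commutant_bar commutant_star : core.

Lemma hform_adj X v (w : 'cV[C]_n) : hform (X *m v) w = hform v (star X *m w).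
Proof.
rewrite /hform barM trmx_mul.
suff E : P *m (star X *m w) = (bar X)^T *m P *m w.
  by rewrite -[X in _ = fun_of_matrix X _ _]mulmxA E !mulmxA.
by rewrite !starE -!mulmxA mulKVmx.
Qed.

(** * Self-adjoint idempotents of the commutant *)

Definition projection p := [/\ commutant p, star p = p & p *m p = p].

Lemma projection_bar p : projection p -> projection (bar p).
Proof.
by move=> [Bp sp pp]; split; rewrite -?bar_star ?sp -?barM ?pp //;
  exact: commutant_bar.
Qed.

Lemma projectionB e p : projection e -> projection p -> e *m p = p ->
  projection (e - p).
Proof.
move=> [Be se ee] [Bp sp pp] ep; split.
- exact/commutantD/commutantN.
- by rewrite starD starN se sp.
- have pe : p *m e = p by rewrite -sp -se -starM ep.
  by rewrite mulmxBl !mulmxBr ee pe ep pp subrr subr0.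
Qed.

(** For [w] in the image of [q j], the squared length of [w] is the sum over [k] of those of
    [q k *m w]. The term [k = j] exhausts it, and the other terms, being non-negative, vanish. *)
Lemma projections_sum1_orth (J : finType) (q : J -> M) :
  (forall j, projection (q j)) -> \sum_j q j = 1%:M ->
  forall i j, i != j -> q i *m q j = 0.
Proof.
move=> pq q1 i j ij; apply: mulmx_cV_ext => v; rewrite mul0mx -mulmxA.
pose w := q j *m v; have [_ _ qq] := pq j.
have qw : q j *m w = w by rewrite mulmxA qq.
have hq k : hform (q k *m w) (q k *m w) = hform w (q k *m w).
  by have [_ sk kk] := pq k; rewrite hform_adj sk mulmxA kk.
have h_ge0 (x : 'cV[C]_n) : 0 <= hform x x.
  have [->|/hform_gt0/ltW//] := eqVneq x 0.
  by rewrite /hform mulmx0 mxE.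
have : \sum_(k | k != j) hform (q k *m w) (q k *m w) = 0.
  apply: (addrI (hform w w)); rewrite addr0.
  transitivity (\sum_k hform (q k *m w) (q k *m w)).
    by rewrite [RHS](bigD1 j)//= qw.
  transitivity (hform w (\sum_k q k *m w)).
    by rewrite /hform mulmx_sumr summxE; apply: eq_bigr => k _; exact: hq.
  by rewrite -mulmx_suml q1 mul1mx.
move=> /psumr_eq0P => /(_ (fun _ _ => h_ge0 _) i ij) h0.
apply/eqP; apply: contraT => /hform_gt0.
by rewrite h0 ltxx.
Qed.

Section OrthogonalProjection.
Variable V : {vspace 'cV[C]_n}.
Hypothesis VGam : forall a v, Gam a -> v \in V -> a *m v \in V.

Let d := \dim V.
Let b : 'M[C]_(n, d) := \matrix_(i, j) (vbasis V)`_j i 0.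

Let bE (x : 'cV[C]_d) : b *m x = \sum_j x j 0 *: (vbasis V)`_j.
Proof.
apply/colP => i; rewrite summxE mxE; apply: eq_bigr => j _.
by rewrite !mxE mulrC.
Qed.

Let bV (x : 'cV[C]_d) : b *m x \in V.
Proof.
rewrite bE; apply: memv_suml => j _; apply/memvZ/vbasis_mem.
by apply: mem_nth; rewrite size_tuple.
Qed.

Let b_surj v : v \in V -> exists x, v = b *m x.
Proof.
move=> /coord_vbasis ->; exists (\col_j coord (vbasis V) j v).
by rewrite bE; apply: eq_bigr => j _; rewrite mxE.
Qed.

Let b_inj (x : 'cV[C]_d) : b *m x = 0 -> x = 0.
Proof.
rewrite bE; have /freeP fV := basis_free (vbasisP V).
move=> /(fV (fun j => x j 0)) x0.
by apply/colP => j; rewrite x0 mxE.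
Qed.

(* The orthogonal projection on the span of the columns of [b] is
   [b (b^* b)^-1 b^*], adjoints being taken for the form [P]. *)
Lemma orthogonal_projection : exists2 p, projection p &
  forall v, (v \in V) = (p *m v == v).
Proof.
pose bs := (bar b)^T *m P.
have H_unit : bs *m b \in unitmx.
  apply: unitmx_ker => x Hx0; apply: b_inj; apply/eqP; apply: contraT.
  move=> /hform_gt0; rewrite /hform barM trmx_mul -!mulmxA.
  by rewrite [X in _ *m X]mulmxA [X in _ *m X](_ : _ = bs *m b *m x) ?Hx0;
     [rewrite mulmx0 mxE ltxx | rewrite !mulmxA].
pose p := b *m invmx (bs *m b) *m bs.
have pb : p *m b = b by rewrite /p -mulmxA -mulmxA mulVmx ?mulmx1.
have memV v : (v \in V) = (p *m v == v).
  apply/idP/eqP => [/b_surj[x ->]|<-]; first by rewrite mulmxA pb.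
  by rewrite /p -!mulmxA bV.
have pp : p *m p = p by rewrite {2}/p mulmxA (mulmxA p) pb.
have sp : star p = p.
  have bbs : bar bs = b^T *m P by rewrite barM bar_tr barK P_bar.
  have HT : (bar (bs *m b))^T = bs *m b.
    by rewrite barM bbs trmx_mul trmx_mul trmxK P_tr mulmxA.
  have E : (bar p)^T *m P = P *m p.
    rewrite {1}/p barM barM bar_inv bbs !trmx_mul trmx_inv HT trmxK P_tr.
    by rewrite /p /bs !mulmxA.
  by rewrite !starE -mulmxA E (mulKmx unitP).
move: p pb memV pp sp => p pb memV pp sp; exists p => //; split => // a Ga.
(* Stability of [V] gives [p g p = g p]. The adjoint of this identity for [b'], where [star b' = a],
   is [p a p = p a]; together they say that [p] commutes with [a]. *)
have pap g : Gam g -> p *m (g *m p) = g *m p.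
  move=> Gg; apply: mulmx_cV_ext => v; rewrite -!mulmxA.
  by apply/eqP; rewrite -memV VGam// memV mulmxA pp.
have [b' Gb Eb] := Gam_star Ga.
have := congr1 star (pap _ Gb); rewrite !starM sp Eb => <-.
by rewrite -mulmxA pap.
Qed.
End OrthogonalProjection.

(** * Minimal projections and Schur's lemma *)

Lemma corner_eigenvector p X : p *m p = p -> p != 0 ->
  exists c (w : 'cV[C]_n), [/\ w != 0, p *m w = w & p *m X *m w = c *: w].
Proof.
move=> pp p0.
(* A rank factorisation identifies the corner of [p] with the square matrices of size [\rank p];
   this size is positive, so an eigenvalue exists over the closed field. *)
have [r [cb [rb [r0 cr rc]]]] : exists r (cb : 'M[C]_(n, r)) (rb : 'M[C]_(r,
  n)),
    [/\ (0 < r)%N, cb *m rb = p & rb *m cb = 1%:M].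
  exists (\rank p); move: (mulmx_base p) (col_base_full p) (row_base_free p).
  move: (col_base p) (row_base p) => cb rb cr cf rf.
  exists cb, rb; split => //; first by rewrite lt0n mxrank_eq0.
  apply: (row_full_inj cf); apply: (row_free_inj rf).
  by rewrite /= mulmx1 -mulmxA -mulmxA cr mulmxA cr pp.
have [c /eigenvalueP[u uc u0]] := eigenvalue_closed (rb *m X *m cb)^T r0.
have {}uc : rb *m X *m cb *m u^T = c *: u^T.
  by rewrite -[LHS]trmxK trmx_mul trmxK uc linearZ.
exists c, (cb *m u^T); split.
- apply: contraTneq u0 => cu0; rewrite negbK -[u]trmxK.
  by rewrite -(mul1mx u^T) -rc -mulmxA cu0 mulmx0 trmx0.
- by rewrite -cr -mulmxA (mulmxA rb) rc mul1mx.
- by rewrite scalemxAr -uc -cr !mulmxA.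
Qed.

(** Minimality is encoded as Schur's lemma for the image of [p]: the corner of [p] in the commutant
    consists of scalars. *)
Definition minproj p := [/\ projection p, p != 0 &
  forall X, commutant X -> exists c, p *m X *m p = c *: p].

(** An eigenspace of [p X p] inside the image of [p] is stable under [Gam]. Its orthogonal
    projection is nonzero and lies below [p], so it is [p], and [p X p] is scalar. *)
Lemma minimal_minproj p : projection p -> p != 0 ->
  (forall q, projection q -> p *m q = q -> q = 0 \/ q = p) -> minproj p.
Proof.
move=> pp p0 pmin; split=> // X BX; have [Bp sp pp'] := pp.
have [c [w [w0 pw Xw]]] := corner_eigenvector X pp' p0.
pose Y := p *m X *m p; pose V : {vspace 'cV[C]_n} :=
  (lker (linfun (mulmx (1%:M - p))) :&: lker (linfun (mulmx (Y - c%:M))))%VS.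
have memV v : (v \in V) = (p *m v == v) && (Y *m v == c *: v).
  rewrite memv_cap !memv_ker !lfunE /= !mulmxBl mul1mx mul_scalar_mx !subr_eq0.
  by rewrite eq_sym.
have BY : commutant Y by rewrite /Y; auto.
have [a v Ga|q qq Vq] := @orthogonal_projection V.
  rewrite !memV => /andP[/eqP pv /eqP Yv]; rewrite !mulmxA -Bp// -BY//.
  by rewrite -(mulmxA a p) -(mulmxA a Y) pv Yv scalemxAr !eqxx.
have pq : p *m q = q.
  apply: mulmx_cV_ext => v; have : q *m v \in V by case: qq => _ _ qq;
    rewrite Vq mulmxA qq.
  by rewrite memV mulmxA => /andP[/eqP].
have q0 : q != 0.
  have : w \in V by rewrite memV pw eqxx /Y -!mulmxA pw mulmxA Xw eqxx.
  by rewrite Vq => /eqP; apply: contra_eq_neq => ->; rewrite mul0mx eq_sym.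
have [/eqP|qp] := pmin q qq pq; first by rewrite (negPf q0).
exists c; rewrite -/Y -[in RHS]qp.
have -> : Y = Y *m q by rewrite qp /Y -[RHS]mulmxA pp'.
apply: mulmx_cV_ext => v; have : q *m v \in V by case: qq => _ _ qq;
  rewrite Vq mulmxA qq.
by rewrite memV => /andP[_ /eqP Yq]; rewrite -mulmxA Yq scalemxAl.
Qed.

Lemma projection_rank_lt e q : projection e -> projection q -> e *m q = q ->
  q != e -> (\rank q < \rank e)%N.
Proof.
move=> [_ se _] [_ sq qq] eq qe.
have qe' : q *m e = q by rewrite -sq -se -starM eq.
rewrite ltn_neqAle -{2}qe' mxrankM_maxr andbT; apply: contra qe => rk.
have le : (q <= e)%MS by rewrite -qe' submxMl.
have [_ E] := mxrank_leqif_sup le.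
have /submxP[D De] : (e <= q)%MS by rewrite -E.
by rewrite -eq De -mulmxA qq.
Qed.

Lemma minproj_exists e : projection e -> e != 0 ->
  exists2 p, minproj p & e *m p = p.
Proof.
have [m] := ubnP (\rank e); elim: m e => // m IHm e lt_em pe e0.
have [[q [pq eq q0 qe]]|nq] := pselect (exists q, [/\ projection q, e *m q = q,
    q != 0 & q != e]).
  have [|p mp qp] := IHm q _ pq q0.
    by rewrite (leq_trans (projection_rank_lt pe pq eq qe)).
  by exists p => //; rewrite -qp mulmxA eq.
exists e; last by case: pe.
apply: minimal_minproj => // q pq eq.
have [|q0] := eqVneq q 0; first by left.
by have [|qe] := eqVneq q e; [right | case: nq; exists q].
Qed.

(** The scalar is the ratio of the squared lengths of [X *m p *m v] and [p *m v], for any [v] where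
    the former is nonzero. *)
Lemma minproj_pos p X : minproj p -> commutant X -> X *m p != 0 ->
  exists2 l, 0 < l & p *m star X *m X *m p = l *: p.
Proof.
move=> [[Bp sp pp] p0 pm] BX Xp0.
have [|c Ec] := pm (star X *m X); first by auto.
rewrite mulmxA in Ec; exists c => //.
have [v Xpv] : exists v, X *m p *m v != 0.
  apply/not_existsP => Xv; move: Xp0; apply/negP/negPn/eqP.
  by apply: mulmx_cV_ext => v; rewrite mul0mx; apply/eqP/negPn/negP.
have pv : p *m v != 0.
  by apply: contraNneq Xpv => pv; rewrite -mulmxA pv mulmx0.
have := hform_gt0 Xpv; rewrite hform_adj starM sp !mulmxA Ec -scalemxAl.
have -> : hform v (c *: (p *m v)) = c * hform v (p *m v).
  by rewrite /hform -scalemxAr mxE.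
by rewrite -{1}pp -{1}sp -mulmxA -hform_adj pmulr_lgt0// hform_gt0.
Qed.

(** * Partial isometries and equivalence of projections *)

Definition partial_iso p q u := [/\ commutant u, star u *m u = p,
  u *m star u = q, u *m p = u & q *m u = u].

Definition equivp p q := exists u, partial_iso p q u.

Lemma partial_iso_star p q u : projection p -> projection q ->
  partial_iso p q u -> partial_iso q p (star u).
Proof.
move=> [_ sp _] [_ sq _] [Bu uu uu' up qu]; split; rewrite ?starK //;
  first by auto.
- by rewrite -sq -starM qu.
- by rewrite -sp -starM up.
Qed.

(** Minimality of [p] makes [star Y *m Y] a positive multiple of [p], and [s] is the root of that
    multiple. With [u = s^-1 *: Y], minimality of [q] gives [u *m star u = c *: q], and
    [u = u *m star u *m u = c *: u] forces [c = 1]. The statement exposes [s] because its reality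
    makes the normalisation of a real [Y] real. *)
Lemma partial_iso_normalize p q Y : minproj p -> minproj q -> commutant Y ->
  Y *m p = Y -> q *m Y = Y -> Y != 0 ->
  exists s, [/\ 0 < s, s^* = s & partial_iso p q (s^-1 *: Y)].
Proof.
move=> mp mq BY Yp qY Y0.
have [[Bp sp pp] p0 _] := mp; have [[Bq sq qq] _ qm] := mq.
have [|l l0 El] := minproj_pos mp BY; first by rewrite Yp.
have [s [s0 s1 ss]] := gt0_sqrtC l0; exists s; split => //.
pose u := s^-1 *: Y.
have Bu : commutant u by rewrite /u; auto.
have su : star u = s^-1 *: star Y by rewrite starZ fmorphV /= s1.
have uu : star u *m u = p.
  rewrite su /u -scalemxAl -scalemxAr scalerA -{2}Yp -{1}Yp starM sp !mulmxA.
  by rewrite El scalerA -ss -invfM mulVf ?scale1r// mulf_neq0// gt_eqF.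
have up : u *m p = u by rewrite /u -scalemxAl Yp.
have qu : q *m u = u by rewrite /u -scalemxAr qY.
split => //.
have [|c Ec] := qm (u *m star u); first by auto.
have {}Ec : u *m star u = c *: q.
  by rewrite -Ec -{1}qu -{2}qu starM sq !mulmxA.
have : u = c *: u by rewrite -{1}up -uu mulmxA Ec -scalemxAl qu.
have u0 : u != 0 by apply: contraNneq p0 => u0; rewrite -uu u0 mulmx0.
move/eqP; rewrite -subr_eq0 -{1}(scale1r u) -scalerBl scaler_eq0 (negPf u0)
  orbF.
by rewrite subr_eq0 Ec => /eqP <-; rewrite scale1r.
Qed.

Lemma equivp_of_neq0 p q X : minproj p -> minproj q -> commutant X ->
  q *m X *m p != 0 -> equivp p q.
Proof.
move=> mp mq BX Y0; have [[Bp sp pp] p0 _] := mp; have [[Bq sq qq] _ _] := mq.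
have [||||||s [_ _ ?]] := @partial_iso_normalize p q (q *m X *m p) => //.
- by auto.
- by rewrite -mulmxA pp.
- by rewrite !mulmxA qq.
by exists (s^-1 *: (q *m X *m p)).
Qed.

Lemma nequivp p q X : minproj p -> minproj q -> ~ equivp p q -> commutant X ->
  q *m X *m p = 0.
Proof.
move=> mp mq npq BX; apply/eqP/negPn/negP => Y0.
exact/npq/(equivp_of_neq0 mp mq BX).
Qed.

Lemma equivp_refl p : projection p -> equivp p p.
Proof. by move=> [Bp sp pp]; exists p; split; rewrite ?sp. Qed.

Lemma equivp_sym p q : projection p -> projection q -> equivp p q -> equivp q p.
Proof. by move=> pp pq [u]; exists (star u); exact: partial_iso_star. Qed.

Lemma equivp_trans p q r : equivp p q -> equivp q r -> equivp p r.
Proof.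
move=> [u [Bu uu uu' up qu]] [w [Bw ww ww' wq rw]]; exists (w *m u); split.
- by auto.
- by rewrite starM -mulmxA (mulmxA _ w) ww qu.
- by rewrite starM -mulmxA (mulmxA u) uu' mulmxA wq.
- by rewrite -mulmxA up.
- by rewrite mulmxA rw.
Qed.

Lemma partial_iso_bar p q u :
  partial_iso p q u -> partial_iso (bar p) (bar q) (bar u).
Proof.
by move=> [Bu uu uu' up qu]; split; rewrite -?bar_star -?barM ?uu ?uu' ?up ?qu
  //; auto.
Qed.

Lemma equivp_bar p q : equivp p q -> equivp (bar p) (bar q).
Proof. by move=> [u /partial_iso_bar]; exists (bar u). Qed.

Lemma minproj_bar p : minproj p -> minproj (bar p).
Proof.
move=> [pp p0 pm]; split; first exact: projection_bar.
  by apply: contra p0 => /eqP p0; rewrite -(barK p) p0 bar0.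
move=> X BX; have [|c Ec] := pm (bar X); first by auto.
by exists (c^*); rewrite -barZ -Ec !barM barK.
Qed.

Lemma minproj_transport p g : minproj p -> commutant g -> g *m p = g ->
  star g *m g = p -> minproj (g *m star g).
Proof.
move=> [[Bp sp pp] p0 pm] Bg gp gg; split.
- split; [by auto | by rewrite starM starK |].
  by rewrite -mulmxA (mulmxA _ g) gg -sp -starM gp.
- apply: contra p0 => /eqP g0; rewrite -pp -gg -mulmxA (mulmxA g).
  by rewrite g0 mul0mx mulmx0.
- move=> X BX; have [|c Ec] := pm (star g *m X *m g); first by auto.
  have pg : p *m star g = star g by rewrite -sp -starM gp.
  exists c; have -> : c *: (g *m star g) = g *m (c *: p) *m star g.
    by rewrite -scalemxAr gp -scalemxAl.
  by rewrite -Ec !mulmxA gp -[RHS]mulmxA pg.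
Qed.

(** Encodes the antilinear map [v |-> X *m bar v] on the image of [p], whose square is [X *m bar X]:
    [b] is false for a real structure and true for a quaternionic one. The free factor [c] defers
    normalisation to [structure_sign_iso]. *)
Definition structure_sign (b : bool) p := exists X c, [/\ commutant X,
  p *m X = X, X *m bar p = X, 0 < c & X *m bar X = ((-1) ^+ b * c) *: p].

Lemma partial_iso_neq0 p q u : p != 0 -> partial_iso p q u -> u != 0.
Proof.
by move=> p0 [_ uu _ _ _]; apply: contraNneq p0 => u0; rewrite -uu u0 mulmx0.
Qed.

Lemma scale_neq0_inj c l (m k : nat) (A : 'M[C]_(m, k)) :
  A != 0 -> c *: A = l *: A -> c = l.
Proof.
move=> A0 /eqP; rewrite -subr_eq0 -scalerBl scaler_eq0 (negPf A0) orbF subr_eq0.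
by move/eqP.
Qed.

Lemma partial_iso_unitary p u : partial_iso (bar p) p u ->
  (u *m bar u) *m star (u *m bar u) = p.
Proof.
move=> [Bu uu uu' up pu]; rewrite starM -mulmxA (mulmxA (bar u)) -bar_star.
by rewrite -barM uu' mulmxA up.
Qed.

Lemma partial_iso_square p u : minproj p -> partial_iso (bar p) p u ->
  exists2 c, u *m bar u = c *: p & c * c^* = 1.
Proof.
move=> [[Bp sp pp] p0 pm] iu; have [Bu uu uu' up pu] := iu.
have bup : bar u *m p = bar u by rewrite -[p in LHS]barK -barM up.
have [|c Ec] := pm (u *m bar u); first by auto.
move: Ec; rewrite mulmxA pu -mulmxA bup => Ec; exists c => //.
apply: (@scale_neq0_inj _ _ _ _ p) => //; rewrite scale1r.
rewrite -[RHS](partial_iso_unitary iu) Ec starZ sp.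
by rewrite -scalemxAl -scalemxAr scalerA pp.
Qed.

(** Normalising [X] gives a partial isometry [u] with [u *m bar u] unitary in the corner of [p],
    hence a unimodular multiple of [p]. That multiple is the given sign times a positive number,
    which must be 1. *)
Lemma structure_sign_iso b p : minproj p -> structure_sign b p ->
  exists2 u, partial_iso (bar p) p u & u *m bar u = (-1) ^+ b *: p.
Proof.
move=> mp [X [c [BX pX Xp c0 XX]]]; have [[Bp sp pp] p0 pm] := mp.
have X0 : X != 0.
  apply: contraNneq p0 => X0; move: XX; rewrite X0 mul0mx => /esym/eqP.
  by rewrite scaler_eq0 mulf_eq0 signr_eq0 (gt_eqF c0).
have [s [s0 s1 iu]] := partial_iso_normalize (minproj_bar mp) mp BX Xp pX X0.
exists (s^-1 *: X) => //; have [l El ll] := partial_iso_square mp iu.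
rewrite El; congr (_ *: _).
move: El; rewrite barZ fmorphV /= s1 -scalemxAl -scalemxAr XX !scalerA.
move=> /(scale_neq0_inj p0) El.
have {El}[d d0 El] : exists2 d, 0 < d & l = (-1) ^+ b * d.
  by exists (s^-1 * s^-1 * c); [rewrite !mulr_gt0// invr_gt0|rewrite -El; ring].
move: ll; rewrite El rmorphM rmorph_sign /= (geC0_conj (ltW d0)) mulrACA.
rewrite -signr_addb addbb mul1r -expr2 => /eqP; rewrite pexpr_eq1 ?(ltW d0)//.
by move=> /eqP ->; rewrite mulr1.
Qed.

(** If [u *m bar u = c *: p], computing [u *m bar u *m u] in two ways gives both [c *: u] and its
    conjugate multiple. So [c] is real, and its sign is the type. *)
Lemma equivp_bar_sign p : minproj p -> equivp (bar p) p ->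
  exists b, structure_sign b p.
Proof.
move=> mp [u iu]; have [c Ec cc] := partial_iso_square mp iu.
have [[Bp sp pp] p0 pm] := mp; have [Bu uu uu' up pu] := iu.
have u0 : u != 0.
  by apply: contraNneq p0 => u0; rewrite -uu' u0 mul0mx.
have cr : c \is Num.real.
  apply/CrealP; apply: (scale_neq0_inj u0).
  have := congr1 (mulmx u) (congr1 (@bar _ _ _) Ec).
  by rewrite barM barK barZ mulmxA Ec -scalemxAr up -scalemxAl pu.
exists (c < 0), u, `|c|; split => //; last by rewrite -realEsign.
rewrite normr_gt0; apply: contra_eq_neq cc => ->.
by rewrite mul0r eq_sym oner_eq0.
Qed.

(** Two partial isometries from [bar p] to [p] differ by a scalar [c], so their squares differ by
    the non-negative factor [c * c^*], which cannot reverse the sign. *)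
Lemma structure_sign_inj b b' p : minproj p ->
  structure_sign b p -> structure_sign b' p -> b = b'.
Proof.
move=> mp /(structure_sign_iso mp)[u [Bu uu uu' up pu] Eu].
move=> /(structure_sign_iso mp)[w [Bw ww ww' wp pw] Ew].
have [[Bp sp pp] p0 pm] := mp.
have [|c Ec] := pm (w *m star u); first by auto.
have usp : star u *m p = star u by rewrite -[in LHS]sp -starM pu.
have {}Ec : w = c *: u.
  have := congr1 (mulmxr u) Ec; rewrite /= mulmxA pw -2!mulmxA pu uu wp.
  by rewrite -scalemxAl pu.
move: Ew; rewrite Ec barZ -scalemxAl -scalemxAr scalerA Eu scalerA.
move=> /(scale_neq0_inj p0) E; have := mul_conjC_ge0 c.
move: E; case: (b); case: (b') => //=; rewrite ?expr0 ?expr1.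
- by rewrite mulrN1 => /eqP; rewrite eqr_oppLR => /eqP ->;
    rewrite oppr_ge0 ler10.
- by rewrite mulr1 => ->; rewrite oppr_ge0 ler10.
Qed.

Lemma structure_sign_equivp b p q : projection q -> equivp p q ->
  structure_sign b p -> structure_sign b q.
Proof.
move=> [_ sq _] [f [Bf ff ff' fp qf]] [X [c [BX pX Xp c0 XX]]].
exists (f *m X *m bar (star f)), c; split => //.
- by auto 8.
- by rewrite !mulmxA qf.
- by rewrite -mulmxA -barM -{1}sq -starM qf.
- rewrite !barM barK mulmxA -(mulmxA (f *m X)) (mulmxA (bar (star f))) -barM ff.
  rewrite mulmxA -(mulmxA f) Xp -(mulmxA f) XX -scalemxAr -scalemxAl fp.
  by rewrite ff'.
Qed.

Lemma structure_sign_bar b p : structure_sign b p -> structure_sign b (bar p).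
Proof.
move=> [X [c [BX pX Xp c0 XX]]]; exists (bar X), c; split => //; first by auto.
- by rewrite -barM pX.
- by rewrite -barM Xp.
- by rewrite -barM XX barZ rmorphM rmorph_sign /= (geC0_conj (ltW c0)).
Qed.

Lemma structure_sign_equivp_bar b p : minproj p -> structure_sign b p ->
  equivp (bar p) p.
Proof. by move=> mp /(structure_sign_iso mp)[u iu _]; exists u. Qed.

(** * Real blocks and their equivalence *)

Definition block p := minproj p /\
  (bar p = p \/ p *m bar p = 0 /\ ~ structure_sign false p).

Definition real_hull p := if bar p == p then p else p + bar p.

Lemma real_hull_bar p : bar (real_hull p) = real_hull p.
Proof. by rewrite /real_hull; case: eqVneq => // _;
  rewrite barD barK addrC. Qed.

Lemma real_hull_real p : bar p = p -> real_hull p = p.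
Proof. by rewrite /real_hull => ->; rewrite eqxx. Qed.

(** A real [p] is its own real structure, as [p *m bar p = p]; a block that is not real admits none
    by definition. *)
Lemma block_sign p : block p -> bar p = p <-> structure_sign false p.
Proof.
move=> [[[Bp sp pp] p0 _] [rp|[_ np]]]; split => //.
- by exists p, 1; rewrite rp expr0 mul1r scale1r pp.
- by move=> rp; case: np; exists p, 1; rewrite rp expr0 mul1r scale1r pp.
Qed.

Lemma block_orth p : block p -> bar p <> p ->
  [/\ p *m bar p = 0, bar p *m p = 0 & real_hull p = p + bar p].
Proof.
move=> [_ [//|[pp _]]] np; split => //.
- by rewrite -[p in LHS]barK -barM barK pp bar0.
- by rewrite /real_hull; case: eqP.
Qed.

Lemma real_hull_mulr p : block p -> real_hull p *m p = p.
Proof.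
move=> bp; have [[[_ _ pp] _ _] _] := bp.
have [rp|np] := pselect (bar p = p); first by rewrite real_hull_real.
by have [pq qp ->] := block_orth bp np; rewrite mulmxDl pp qp addr0.
Qed.

Lemma real_hull_projection p : block p -> projection (real_hull p).
Proof.
move=> bp; have [[[Bp sp pp] _ _] _] := bp.
have [rp|np] := pselect (bar p = p); first by rewrite real_hull_real.
have [pq qp ->] := block_orth bp np; split; first by auto.
- by rewrite starD -bar_star sp.
- by rewrite mulmxDl !mulmxDr -barM pp pq qp addr0 add0r.
Qed.

Lemma real_hull_neq0 p : block p -> real_hull p != 0.
Proof.
move=> bp; have [[_ p0 _] _] := bp; apply: contraNneq p0 => e0.
by rewrite -(real_hull_mulr bp) e0 mul0mx.
Qed.

(* For a real structure [u], one of the two elements [p + star u] and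
   ['i *: (p - star u)] is non-zero; both are fixed by [f |-> bar f *m star u],
   which makes the range projection real. *)
Lemma real_minproj e p : projection e -> bar e = e -> minproj p -> e *m p = p ->
  structure_sign false p ->
  exists q, [/\ minproj q, e *m q = q & bar q = q].
Proof.
move=> [Be se ee] re mp ep /(structure_sign_iso mp)[u iu].
rewrite expr0 scale1r => Eu.
have [[Bp sp pp] p0 pm] := mp; have [Bu uu uu' up pu] := iu.
have usp : star u *m p = star u by rewrite -[in LHS]sp -starM pu.
have ubp : bar p *m star u = star u.
  by have := congr1 star up; rewrite starM -bar_star sp.
have ebp : e *m bar p = bar p by rewrite -[in LHS]re -barM ep.
have eus : e *m star u = star u by rewrite -ubp mulmxA ebp.
have uus : bar (star u) *m star u = p by rewrite bar_star -starM Eu.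
suff [f [Bf f0 fp ef fu]] : exists f, [/\ commutant f, f != 0, f *m p = f,
    e *m f = f & bar f *m star u = f].
  have [|l l0 El] := minproj_pos mp Bf; first by rewrite fp.
  have [s [s0 s1 ss]] := gt0_sqrtC l0.
  pose g := s^-1 *: f.
  have sV : (s^-1)^* = s^-1 by rewrite fmorphV /= s1.
  have gp : g *m p = g by rewrite /g -scalemxAl fp.
  have Bg : commutant g by rewrite /g; auto.
  have gg : star g *m g = p.
    rewrite /g starZ sV -scalemxAl -scalemxAr scalerA -{2}fp -{1}fp starM sp.
    by rewrite !mulmxA El scalerA -ss -invfM mulVf ?scale1r// mulf_neq0//
      gt_eqF.
  (* Conjugating [g] multiplies it on the right by [u], and [u *m star u = p] is absorbed in
     [g *m star g], which is therefore real. *)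
  have gu : bar g = g *m u.
    rewrite -[in LHS]gp barM -uu mulmxA; congr (_ *m _).
    by rewrite /g barZ sV -scalemxAl fu.
  exists (g *m star g); split; first exact: minproj_transport gp gg.
    by rewrite mulmxA /g -scalemxAr ef.
  by rewrite barM bar_star gu starM mulmxA -(mulmxA g) uu' gp.
have [z|z] := eqVneq (p + star u) 0.
  exists ('i *: (p - star u)); split; first by auto 8.
  - move/eqP: z; rewrite addr_eq0 => /eqP {1}->; rewrite -opprD -mulr2n.
    rewrite scaler_eq0 negb_or neq0Ci oppr_eq0 -scaler_nat scaler_eq0 pnatr_eq0
      /=.
    by apply: contraNneq p0 => u0; rewrite -Eu -[u]starK u0 star0 mul0mx.
  - by rewrite -scalemxAl mulmxBl pp usp.
  - by rewrite -scalemxAr mulmxBr ep eus.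
  - rewrite barZ conjCi barD barN -scalemxAl mulmxBl ubp uus.
    by rewrite scaleNr -scalerN opprB.
exists (p + star u); split => //; first by auto.
- by rewrite mulmxDl pp usp.
- by rewrite mulmxDr ep eus.
- by rewrite barD mulmxDl ubp uus addrC.
Qed.

Lemma block_exists e : projection e -> bar e = e -> e != 0 ->
  exists2 p, block p & e *m real_hull p = real_hull p.
Proof.
move=> pe re e0; have [p mp ep] := minproj_exists pe e0.
have [sg|nsg] := pselect (structure_sign false p).
  have [q [mq eq rq]] := real_minproj pe re mp ep sg.
  by exists q; [split => //; left | rewrite real_hull_real].
have [[Bp sp pp] p0 pm] := mp.
(* With [Y = bar p *m p], the element [X = p *m bar p] satisfies [X *m bar X = star Y *m Y], a
   positive multiple of [p] unless [Y] vanishes. *)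
have pbp : p *m bar p = 0.
  apply: contra_notP nsg => /eqP pbp.
  have qp : bar p *m p != 0.
    by apply: contraNneq pbp => qp; rewrite -[p in X in X *m _]barK -barM qp
      bar0.
  have [|l l0 El] := minproj_pos mp _ qp; first by auto.
  exists (p *m bar p), l; split => //; first by auto.
  - by rewrite mulmxA pp.
  - by rewrite -mulmxA -barM pp.
  - rewrite expr0 mul1r -El barM barK -bar_star sp mulmxA.
    by rewrite -!mulmxA (mulmxA (bar p)) -barM pp.
exists p; first by split => //; right.
rewrite /real_hull; case: eqP => // _.
by rewrite mulmxDr ep -[e in X in _ + X]re -barM ep.
Qed.

Lemma block_decomposition e : projection e -> bar e = e ->
  exists2 s : seq M, forall p, p \in s -> block p &
    \sum_(p <- s) real_hull p = e.
Proof.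
have [m] := ubnP (\rank e); elim: m e => // m IHm e lt_em pe re.
have [e0|e0] := eqVneq e 0; first by exists [::] => //; rewrite big_nil.
have [p bp ep] := block_exists pe re e0.
have php := real_hull_projection bp.
have [Be se ee] := pe; have [Bh sh hh] := php.
have he : real_hull p *m e = real_hull p by rewrite -sh -{1}se -starM ep.
have pe' := projectionB pe php ep.
have [||s sP ssum] := IHm (e - real_hull p) _ pe'.
- suff lt : (\rank (e - real_hull p)%R < \rank e)%N
    by exact: leq_trans lt lt_em.
  apply: (projection_rank_lt pe pe'); first by rewrite mulmxBr ee ep.
  by rewrite -subr_eq0 addrAC subrr sub0r oppr_eq0 real_hull_neq0.
- by rewrite barD barN re real_hull_bar.
exists (p :: s); last by rewrite big_cons ssum addrC subrK.
by move=> q; rewrite inE => /predU1P[->//|/sP].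
Qed.

(** Equivalence up to conjugation is the relation between blocks, because [p] and [bar p] have the
    same real hull. *)
Definition equivb p q := equivp p q \/ equivp (bar p) q.

Lemma equivb_sign b p q : projection q -> equivb p q ->
  structure_sign b p -> structure_sign b q.
Proof.
move=> pq [pq'|pq'] sg; apply: (structure_sign_equivp _ pq') => //.
exact: structure_sign_bar.
Qed.

Lemma equivb_sym p q : projection p -> projection q -> equivb p q -> equivb q p.
Proof.
move=> pp pq [pq'|pq']; [left|right].
  exact: equivp_sym.
by rewrite -[p]barK; apply/equivp_bar/equivp_sym => //; exact: projection_bar.
Qed.

Lemma equivb_trans p q r : equivb p q -> equivb q r -> equivb p r.
Proof.
move=> [pq|pq] [qr|qr].
- by left; exact: equivp_trans qr.
- by right; apply: equivp_trans qr; exact: equivp_bar.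
- by right; exact: equivp_trans qr.
- by left; apply: equivp_trans qr; rewrite -[p]barK; exact: equivp_bar.
Qed.

Lemma equivb_refl p : block p -> equivb p p.
Proof. by move=> [[pp _ _] _]; left; exact: equivp_refl. Qed.

Lemma nequivb p q X : block p -> block q -> ~ equivb p q -> commutant X ->
  real_hull q *m X *m real_hull p = 0.
Proof.
move=> bp bq npq BX; have [mp _] := bp; have [mq _] := bq.
have key p' q' : p' = p \/ p' = bar p -> q' = q \/ q' = bar q ->
    q' *m X *m p' = 0.
  move=> Hp Hq; apply: nequivp => //.
  - by case: Hp => -> //; exact: minproj_bar.
  - by case: Hq => -> //; exact: minproj_bar.
  - case: Hp Hq => -> [] -> E; apply: npq.
    + by left.
    + by right; rewrite -[q]barK; exact: equivp_bar.
    + by right.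
    + by left; rewrite -[p]barK -[q]barK; exact: equivp_bar.
rewrite /real_hull; case: eqP => _; case: eqP => _;
  rewrite ?(mulmxDl, mulmxDr) !key ?addr0//; by [left|right].
Qed.

Lemma nequivb_mulmx p q X Y Z : block p -> block q -> ~ equivb p q ->
  commutant X -> commutant Y -> commutant Z ->
  real_hull q *m X = X -> Z *m real_hull p = Z -> X *m Y *m Z = 0.
Proof.
move=> bp bq npq BX BY BZ qX Zp.
have BXYZ : commutant (X *m Y *m Z) by auto.
have := nequivb bp bq npq BXYZ.
by rewrite !mulmxA qX -[X in X = _ -> _]mulmxA Zp.
Qed.

(** A complex partial isometry [f] becomes real by adding its conjugate. When [p] and [bar p] are
    orthogonal, all cross terms vanish and the sum is a partial isometry between the hulls. When [p]
    is real, the sum has to be rescaled and may be zero; then [f] is purely imaginary and ['i *: f]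
    replaces it. *)
Lemma block_iso p q : block p -> block q -> equivb p q ->
  exists2 F, partial_iso (real_hull p) (real_hull q) F & bar F = F.
Proof.
move=> bp bq pq; have [mp _] := bp; have [mq _] := bq.
have [[Bp sp pp] p0 pm] := mp; have [[Bq sq qq] q0 qm] := mq.
have [rp|np] := pselect (bar p = p).
  have rq : bar q = q.
    by apply/(block_sign bq)/(equivb_sign _ pq)/(block_sign bp).
  rewrite !real_hull_real//.
  have {pq}[f [Bf ff ff' fp qf]] : equivp p q by case: pq; rewrite ?rp.
  have [g [Bg gp qg g0 rg]] : exists g,
      [/\ commutant g, g *m p = g, q *m g = g, g != 0 & bar g = g].
    have [z|z] := eqVneq (f + bar f) 0.
      exists ('i *: f); split; first by auto.
      - by rewrite -scalemxAl fp.
      - by rewrite -scalemxAr qf.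
      - rewrite scaler_eq0 negb_or neq0Ci /=.
        by apply: (@partial_iso_neq0 p q) => //; split.
      - move/eqP: z; rewrite addrC addr_eq0 => /eqP z.
        by rewrite barZ conjCi z scalerN scaleNr opprK.
    exists (f + bar f); split => //; first by auto.
    - by rewrite mulmxDl fp -{1}rp -barM fp.
    - by rewrite mulmxDr qf -{1}rq -barM qf.
    - by rewrite barD barK addrC.
  have [s [s0 s1 ig]] := partial_iso_normalize mp mq Bg gp qg g0.
  by exists (s^-1 *: g) => //; rewrite barZ fmorphV /= s1 rg.
have nq : bar q <> q.
  have qp : equivb q p by exact: equivb_sym pq.
  move=> rq; apply: np; apply/(block_sign bp); apply: (equivb_sign _ qp) => //.
  exact/(block_sign bq).
have [pbp bpp ->] := block_orth bp np; have [qbq bqq ->] := block_orth bq nq.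
(* The variable [p'] is [p] or [bar p], according to which of them is equivalent to [q]. *)
suff main p' : p' *m bar p' = 0 -> projection p' -> equivp p' q ->
    exists2 F, partial_iso (p' + bar p') (q + bar q) F & bar F = F.
  case: pq => pq; first exact: main pq.
  rewrite addrC -[p in _ + p]barK; apply: main => //;
    last exact: projection_bar.
  by rewrite barK.
move=> pbp' [Bp' sp' pp'] [f [Bf ff ff' fp qf]].
have bpp' : bar p' *m p' = 0.
  by rewrite -[X in _ *m X]barK -barM pbp' bar0.
have bfp : bar f *m bar p' = bar f by rewrite -barM fp.
have bqf : bar q *m bar f = bar f by rewrite -barM qf.
have psf : p' *m star f = star f by rewrite -{1}sp' -starM fp.
have sfq : star f *m q = star f by rewrite -{1}sq -starM qf.
have z1 : star f *m bar f = 0 by rewrite -sfq -bqf mulmxA -(mulmxA _ q) qbq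
  mulmx0 mul0mx.
have z2 : bar f *m star f = 0.
  by rewrite -bfp -psf mulmxA -(mulmxA _ (bar p')) bpp' mulmx0 mul0mx.
have z1' : bar (star f) *m f = 0 by rewrite -[f in _ *m f]barK -barM z1 bar0.
have z2' : f *m bar (star f) = 0 by rewrite -{1}[f]barK -barM z2 bar0.
exists (f + bar f); last by rewrite barD barK addrC.
split; first by auto.
- by rewrite starD -bar_star mulmxDl !mulmxDr z1 z1' -barM ff addr0 add0r.
- by rewrite starD -bar_star mulmxDl !mulmxDr z2 z2' -barM ff' addr0 add0r.
- rewrite mulmxDl !mulmxDr fp bfp.
  have -> : f *m bar p' = 0 by rewrite -fp -mulmxA pbp' mulmx0.
  have -> : bar f *m p' = 0 by rewrite -bfp -mulmxA bpp' mulmx0.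
  by rewrite add0r addr0.
- rewrite mulmxDl !mulmxDr qf bqf.
  have -> : q *m bar f = 0 by rewrite -bqf mulmxA qbq mul0mx.
  have -> : bar q *m f = 0 by rewrite -qf mulmxA bqq mul0mx.
  by rewrite add0r addr0.
Qed.

Lemma corner_scalar w X : minproj w -> bar w = w -> commutant X -> bar X = X ->
  exists2 c, c^* = c & w *m X *m w = c *: w.
Proof.
move=> [_ w0 wm] rw BX rX; have [c Ec] := wm X BX; exists c => //.
apply: (scale_neq0_inj w0); rewrite -Ec -{1}rw -barZ -Ec !barM rX rw.
by [].
Qed.

(** * Corners of the real commutant *)

Definition complex_corner w c := c *: w + c^* *: bar w.

(** The quaternion [a + b j] as a pair of complex numbers, with [j] represented by [u + bar u]. For
    a block [w] that is not real and [u *m bar u = - w], this element squares to minus the hull of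
    [w], and moving a complex number past it conjugates that number. *)
Definition quaternion_corner w u a b :=
  a *: w + b *: u + (a^* *: bar w + b^* *: bar u).

Section ComplexCorner.
Variable w : M.
Hypothesis bw : block w.
Hypothesis nrw : bar w <> w.

Let e := real_hull w.
Let w_proj : projection w. Proof. by have [[]] := bw. Qed.
Let ww : w *m w = w. Proof. by have [] := w_proj. Qed.
Let w0 : w != 0. Proof. by have [[]] := bw. Qed.
Let eE : e = w + bar w. Proof. by have [] := block_orth bw nrw. Qed.
Let wbw : w *m bar w = 0. Proof. by have [] := block_orth bw nrw. Qed.
Let bww : bar w *m w = 0. Proof. by have [] := block_orth bw nrw. Qed.
Let bwbw : bar w *m bar w = bar w. Proof. by rewrite -barM ww. Qed.

Lemma hull_corner X : bar X = X -> e *m X *m e =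
  w *m X *m w + w *m X *m bar w + (bar (w *m X *m w) + bar (w *m X *m bar w)).
Proof.
move=> rX; rewrite eE !barM barK rX !mulmxDl !mulmxDr.
by rewrite [X in _ + X]addrC.
Qed.

Lemma complex_cornerD l c c' : l^* = l ->
  complex_corner w (l * c + c') = l *: complex_corner w c + complex_corner w c'.
Proof.
move=> rl; rewrite /complex_corner rmorphD rmorphM /= rl !scalerDl scalerDr.
by rewrite !scalerA addrACA.
Qed.

Lemma complex_cornerM c c' :
  complex_corner w (c * c') = complex_corner w c *m complex_corner w c'.
Proof.
rewrite /complex_corner rmorphM mulmxDl !mulmxDr -!scalemxAl -!scalemxAr.
by rewrite ww bwbw wbw bww !scaler0 addr0 add0r !scalerA.
Qed.

Lemma complex_corner1 : complex_corner w 1 = e.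
Proof. by rewrite /complex_corner conjC1 !scale1r eE. Qed.

Lemma complex_corner_inj : injective (complex_corner w).
Proof.
move=> c c' /(congr1 (mulmx w)).
rewrite /complex_corner !mulmxDr -!scalemxAr wbw !scaler0 !addr0 ww.
exact: scale_neq0_inj.
Qed.

Lemma complex_corner_bar c : bar (complex_corner w c) = complex_corner w c.
Proof. by rewrite /complex_corner barD !barZ barK conjCK addrC. Qed.

Lemma complex_corner_commutant c : commutant (complex_corner w c).
Proof. by have [Bw _ _] := w_proj; rewrite /complex_corner; auto 8. Qed.

(** The off-diagonal part [w *m X *m bar w] vanishes by Schur's lemma, and the two diagonal parts
    are conjugate. *)
Lemma complex_corner_surj X : ~ equivp (bar w) w -> commutant X -> bar X = X ->
  exists c, e *m X *m e = complex_corner w c.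
Proof.
have [mw _] := bw; have [_ _ wm] := mw.
move=> nw BX rX; have [c Ec] := wm X BX; exists c.
by rewrite hull_corner// Ec (nequivp (minproj_bar mw) mw nw BX) barZ bar0
  !addr0.
Qed.

Section QuaternionCorner.
Variable u : M.
Hypothesis iu : partial_iso (bar w) w u.
Hypothesis uu : u *m bar u = - w.

Let ubw : u *m bar w = u. Proof. by have [] := iu. Qed.
Let wu : w *m u = u. Proof. by have [] := iu. Qed.
Let uw : u *m w = 0. Proof. by rewrite -ubw -mulmxA bww mulmx0. Qed.
Let bwu : bar w *m u = 0. Proof. by rewrite -wu mulmxA bww mul0mx. Qed.
Let u_u : u *m u = 0. Proof. by rewrite -{2}wu mulmxA uw mul0mx. Qed.

Let barE (X Y Z : M) : X *m Y = Z -> bar X *m bar Y = bar Z.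
Proof. by move=> <-; rewrite barM. Qed.

Let buu : bar u *m u = - bar w.
Proof. by have := barE uu; rewrite barK barN. Qed.
Let buw : bar u *m w = bar u.
Proof. by have := barE ubw; rewrite barK. Qed.
Let bwbu : bar w *m bar u = bar u. Proof. exact: barE. Qed.
Let bubw : bar u *m bar w = 0. Proof. by have := barE uw; rewrite bar0. Qed.
Let wbu : w *m bar u = 0. Proof. by have := barE bwu; rewrite barK bar0. Qed.
Let bubu : bar u *m bar u = 0. Proof. by have := barE u_u; rewrite bar0. Qed.

Lemma quaternion_cornerD l a b a' b' : l^* = l ->
  quaternion_corner w u (l * a + a') (l * b + b') =
  l *: quaternion_corner w u a b + quaternion_corner w u a' b'.
Proof.
move=> rl; rewrite /quaternion_corner !rmorphD !rmorphM /= rl.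
by apply/matrixP => i j; rewrite !mxE; ring.
Qed.

Lemma quaternion_cornerM a b a' b' :
  quaternion_corner w u (a * a' - b * b'^*) (a * b' + b * a'^*) =
  quaternion_corner w u a b *m quaternion_corner w u a' b'.
Proof.
rewrite /quaternion_corner !mulmxDl !mulmxDr -!scalemxAl -!scalemxAr.
rewrite ww wu ubw uw bwu u_u uu buu buw bwbu bubw wbu bubu wbw bww bwbw.
rewrite !rmorphB !rmorphD !rmorphM /= !conjCK.
by apply/matrixP => i j; rewrite !mxE; ring.
Qed.

Lemma quaternion_corner1 : quaternion_corner w u 1 0 = e.
Proof.
by rewrite /quaternion_corner conjC1 conjC0 !scale1r !scale0r !addr0 eE.
Qed.

Lemma quaternion_corner_inj a b a' b' :
  quaternion_corner w u a b = quaternion_corner w u a' b' -> a = a' /\ b = b'.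
Proof.
move=> E; split.
  have := congr1 (fun X => w *m X *m w) E.
  rewrite /quaternion_corner !(mulmxDl, mulmxDr) -!scalemxAr -!scalemxAl.
  rewrite ww wu uw wbw wbu mul0mx !scaler0 !addr0 ww.
  exact: scale_neq0_inj.
have := congr1 (fun X => w *m X *m bar w) E.
rewrite /quaternion_corner !(mulmxDl, mulmxDr) -!scalemxAr -!scalemxAl.
rewrite ww wu ubw wbw wbu mul0mx !scaler0 !add0r !addr0.
apply: scale_neq0_inj.
by apply: contraNneq w0 => u0; rewrite -oppr_eq0 -uu u0 mul0mx.
Qed.

Lemma quaternion_corner_bar a b :
  bar (quaternion_corner w u a b) = quaternion_corner w u a b.
Proof. by rewrite /quaternion_corner !barD !barZ !barK !conjCK addrC. Qed.

Lemma quaternion_corner_commutant a b : commutant (quaternion_corner w u a b).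
Proof.
have [Bw _ _] := w_proj; have [Bu _ _ _ _] := iu.
by rewrite /quaternion_corner; auto 8.
Qed.

Lemma quaternion_corner_surj X : commutant X -> bar X = X ->
  exists a b, e *m X *m e = quaternion_corner w u a b.
Proof.
have [mw _] := bw; have [[Bw sw _] _ wm] := mw; have [Bu suu uu' _ _] := iu.
move=> BX rX; have [a Ea] := wm X BX.
(* The off-diagonal part [w *m X *m bar w] is carried by [star u] into the corner of [w], where it
   is a scalar; multiplying back by [u] recovers it. *)
have [|b Eb] := wm (X *m bar w *m star u); first by auto.
exists a, b; rewrite hull_corner// Ea.
have suw : star u *m w = star u by rewrite -[in LHS]sw -starM wu.
have -> : w *m X *m bar w = b *: u.
  have := congr1 (mulmxr u) Eb; rewrite /= -scalemxAl wu => <-.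
  by rewrite -!mulmxA wu suu bwbw.
by rewrite !barZ.
Qed.

End QuaternionCorner.
End ComplexCorner.

End StarAlgebra.

(** * Matrix units *)

Section MatrixUnits.
Variables (R C : comNzRingType) (iota : {rmorphism R -> C}) (n : nat).
Local Notation M := 'M[C]_n.
Variables (A : assocAlgType R) (theta : A -> M).
Hypothesis thetaL : forall c x y, theta (c *: x + y)
  = iota c *: theta x + theta y.
Hypothesis thetaM : forall x y, theta (amul x y) = theta x *m theta y.
Hypothesis theta1 : theta aone = 1%:M.
Hypothesis theta_inj : injective theta.
Let B (X : M) : Prop := exists x, theta x = X.

Variables (I : finType) (D : I -> algType R) (m : I -> nat).
Variable phi : forall i, D i -> M.
Hypothesis phiL : forall i c (x y : D i),
  phi (c *: x + y) = iota c *: phi x + phi y.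
Hypothesis phiM : forall i (x y : D i), phi (x * y) = phi x *m phi y.
Hypothesis phi_inj : forall i, injective (@phi i).
Hypothesis phiB : forall i (x : D i), B (phi x).
Hypothesis phi_surj : forall i X, B X ->
  exists d : D i, phi (1 : D i) *m X *m phi (1 : D i) = phi d.
Variables F F' : forall i, 'I_(m i) -> M.
Hypothesis BF : forall i a, B (@F i a).
Hypothesis BF' : forall i a, B (@F' i a).
Hypothesis F_phi1 : forall i a, @F i a *m phi (1 : D i) = F a.
Hypothesis phi1_F' : forall i a, phi (1 : D i) *m @F' i a = F' a.
Hypothesis F'F : forall i a b,
  @F' i a *m F b = if a == b then phi (1 : D i) else 0.
Hypothesis F'XF : forall i j (a : 'I_(m i)) (b : 'I_(m j)) X,
  i != j -> B X -> F' a *m X *m F b = 0.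
Hypothesis FF' : \sum_i \sum_(a < m i) F a *m F' a = 1%:M.

Let thetaD x y : theta (x + y) = theta x + theta y.
Proof. by rewrite -{1}(scale1r x) thetaL rmorph1 scale1r. Qed.

Let theta0 : theta 0 = 0.
Proof. by apply: (addIr (theta 0)); rewrite -thetaD !add0r. Qed.

Let phiD i (x y : D i) : phi (x + y) = phi x + phi y.
Proof. by rewrite -{1}(scale1r x) phiL rmorph1 scale1r. Qed.

Let phi0 i : phi (0 : D i) = 0.
Proof. by apply: (addIr (phi (0 : D i))); rewrite -phiD !add0r. Qed.

Let BM X Y : B X -> B Y -> B (X *m Y).
Proof. by move=> [x <-] [y <-]; exists (amul x y). Qed.

Let Bsum (J : Type) (r : seq J) (X : J -> M) :
  (forall j, B (X j)) -> B (\sum_(j <- r) X j).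
Proof.
move=> BX; apply: big_ind => //; first by exists 0.
by move=> _ _ [x <-] [y <-]; exists (x + y).
Qed.

Let phi_sum i (J : Type) (r : seq J) (d : J -> D i) :
  phi (\sum_(j <- r) d j) = \sum_(j <- r) phi (d j).
Proof. exact: (big_morph _ (@phiD i) (phi0 i)). Qed.

Let phiV i (X : M) : D i := xget 0 [set d | phi d = X].

(** Compressing [x] by the matrix units lands in the corner modelled by [D i]; [phi_surj] ensures
    that [phiV] does not fall back on its default 0. *)
Let coef (x : A) : direct_sum (fun i => gl (D i) (m i)) :=
  fun i => \matrix_(a, b) phiV i (F' a *m theta x *m F b).

Let coefE x i a b : phi (coef x i a b) = F' a *m theta x *m F b.
Proof.
rewrite mxE; apply: (@xgetPex _ 0 [set d : D i | phi d = _]).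
have [|d Ed] := @phi_surj i (F' a *m theta x *m F b).
  by apply: BM => //; apply: BM => //; exists x.
by exists d; rewrite /= -Ed !mulmxA phi1_F' -mulmxA F_phi1.
Qed.

Let coef_morphism : alg_morphism coef.
Proof.
split.
- move=> c x y; apply: functional_extensionality_dep => i.
  apply/matrixP => a b; apply: phi_inj; rewrite coefE.
  rewrite [RHS](_ : _ = phi (c *: coef x i a b + coef y i a b)); last first.
    by congr (phi _); rewrite !mxE.
  rewrite phiL !coefE thetaL mulmxDr mulmxDl.
  by rewrite -scalemxAr -scalemxAl.
- move=> x y; apply: functional_extensionality_dep => i.
  apply/matrixP => a b; apply: phi_inj; rewrite coefE thetaM.
  rewrite [RHS](_ : _ = phi (\sum_c coef x i a c * coef y i c b)); last first.
    by congr (phi _); rewrite mxE.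
  rewrite phi_sum; under eq_bigr do rewrite phiM !coefE.
  (* Inserting the resolution [FF'] of the identity between the factors produces the matrix product;
     the terms of the other classes vanish by [F'XF]. *)
  rewrite -[theta x in LHS]mulmx1 -FF' (bigD1 i)//= mulmxDr mulmx_sumr.
  rewrite mulmxDl mulmxDr mulmxDl -[RHS]addr0; congr (_ + _).
    rewrite mulmx_suml mulmx_sumr mulmx_suml; apply: eq_bigr => c _.
    by rewrite !mulmxA.
  rewrite mulmx_sumr !mulmx_suml mulmx_sumr mulmx_suml big1// => j ij.
  rewrite mulmx_sumr mulmx_suml mulmx_sumr mulmx_suml big1// => c _.
  rewrite !mulmxA F'XF ?mul0mx//; first by rewrite eq_sym.
  by exists x.
- apply: functional_extensionality_dep => i.
  apply/matrixP => a b; apply: phi_inj; rewrite coefE theta1 mulmx1 F'F.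
  by rewrite mxE; case: eqP => // _; rewrite phi0.
Qed.

(** Inserting [FF'] on both sides reconstructs [x] from its coefficients; this yields injectivity
    and the form of a preimage. *)
Let theta_coef x : theta x =
  \sum_i \sum_(a < m i) \sum_(b < m i) F a *m phi (coef x i a b) *m F' b.
Proof.
rewrite -[LHS]mul1mx -[LHS]mulmx1 -{1}FF' mulmx_suml mulmx_suml.
apply: eq_bigr => i _; rewrite !mulmx_suml; apply: eq_bigr => a _.
rewrite -{1}FF' mulmx_sumr (bigD1 i)//= [X in _ + X]big1 ?addr0; last first.
  move=> j ij; rewrite mulmx_sumr big1// => b _.
  rewrite mulmxA -(mulmxA (F a)) -(mulmxA (F a)) F'XF ?mulmx0 ?mul0mx//.
    by rewrite eq_sym.
  by exists x.
rewrite mulmx_sumr; apply: eq_bigr => b _.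
by rewrite coefE !mulmxA.
Qed.

Lemma matrix_units_iso : alg_iso A (direct_sum (fun i => gl (D i) (m i))).
Proof.
exists coef; first exact: coef_morphism.
have inj : injective coef.
  by move=> x y E; apply: theta_inj; rewrite theta_coef E -theta_coef.
have surj g : exists x, coef x = g.
  have : B (\sum_i \sum_(a < m i) \sum_(b < m i) F a *m phi (g i a b) *m F' b).
    by do 3!(apply: Bsum => ?); do 2!apply: BM => //.
  move=> [x Ex]; exists x; apply: functional_extensionality_dep => i.
  apply/matrixP => a b; apply: phi_inj; rewrite coefE Ex.
  rewrite (bigD1 i)//= mulmxDr mulmxDl [X in _ + X](_ : _ = 0) ?addr0;
    last first.
    rewrite mulmx_sumr mulmx_suml big1// => j ji.
    rewrite mulmx_sumr mulmx_suml big1// => c _.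
    rewrite mulmx_sumr mulmx_suml big1// => d _.
    have := @F'XF i j a c 1%:M; rewrite mulmx1 !mulmxA => ->; rewrite ?mul0mx//.
      by rewrite eq_sym.
    by exists aone.
  rewrite mulmx_sumr mulmx_suml (bigD1 a)//= [X in _ + X]big1 ?addr0;
    last first.
    move=> c ca; rewrite mulmx_sumr mulmx_suml big1// => d _.
    by rewrite !mulmxA F'F eq_sym (negPf ca) !mul0mx.
  rewrite mulmx_sumr mulmx_suml (bigD1 b)//= [X in _ + X]big1 ?addr0;
    last first.
    by move=> d db; rewrite -!mulmxA F'F (negPf db) !mulmx0.
  rewrite !mulmxA F'F eqxx -mulmxA F'F eqxx -!phiM mul1r mulr1.
  by [].
have [h hK] := choice surj.
by exists h => // x; apply: inj; rewrite hK.
Qed.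

End MatrixUnits.

(** * Representations and projections *)

Lemma conjcE (R : realType) (x : R[i]) : conjc x = x^*.
Proof. by []. Qed.

Section ImageOfProjection.
Variables (K : fieldType) (n : nat).
Implicit Types (p q : 'M[K]_n) (v : 'cV[K]_n).

Definition vsim p : {vspace 'cV[K]_n} := limg (linfun (mulmx p)).

Lemma mem_vsim p v : p *m p = p -> (v \in vsim p) = (p *m v == v).
Proof.
move=> pp; apply/memv_imgP/eqP => [[u _ ->]|pv].
  by rewrite lfunE /= mulmxA pp.
by exists v; rewrite ?memvf// lfunE /= pv.
Qed.

Lemma vsim_mulmx p v : p *m v \in vsim p.
Proof. by apply/memv_imgP; exists v; rewrite ?memvf// lfunE. Qed.

Lemma subv_vsim p q : p *m p = p -> (vsim q <= vsim p)%VS = (p *m q == q).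
Proof.
move=> pp; apply/subvP/eqP => [qp|pq v].
  by apply: mulmx_cV_ext => v; have := qp _ (vsim_mulmx q v);
     rewrite mem_vsim// -mulmxA => /eqP.
by case/memv_imgP => u _ ->; rewrite lfunE /= -pq -mulmxA vsim_mulmx.
Qed.

Lemma vsim0 : vsim 0 = 0%VS.
Proof.
apply/vspaceP => v; rewrite memv0 mem_vsim ?mulmx0// mul0mx.
by rewrite eq_sym.
Qed.

Lemma dim_vsim_mulmx (u p q : 'M[K]_n) :
  p *m p = p -> q *m q = q -> q *m u = u -> (exists u', u *m p *m u' = q) ->
  (\dim (vsim q) <= \dim (vsim p))%N.
Proof.
move=> pp qq qu [u' uu'].
apply: (@leq_trans (\dim (linfun (mulmx u) @: vsim p))).
  apply: dimvS; apply/subvP => v; rewrite mem_vsim// => /eqP <-.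
  rewrite -uu' -!mulmxA; apply/memv_imgP; exists (p *m (u' *m v)).
    exact: vsim_mulmx.
  by rewrite lfunE.
by rewrite -(limg_ker_dim (linfun (mulmx u)) (vsim p)) leq_addl.
Qed.

End ImageOfProjection.

Lemma linear_mulmx (K : pzRingType) (n : nat) (f : 'cV[K]_n -> 'cV[K]_n) :
  linear f -> exists A : 'M[K]_n, forall v, f v = \sum_j v j 0 *: col j A.
Proof.
move=> lf; have f0 : f 0 = 0.
  have := lf (-1) 0 0; rewrite scaler0 addr0 scaleN1r => E.
  by rewrite {1}E addNr.
have fD : {morph f : x y / x + y} by move=> x y;
  rewrite -{1}(scale1r x) lf scale1r.
have fZ c x : f (c *: x) = c *: f x by rewrite -[c *: x]addr0 lf f0 addr0.
exists (\matrix_(i, j) f (delta_mx j 0) i 0) => v.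
rewrite {1}(matrix_sum_delta v) (big_morph _ fD f0); apply: eq_bigr => j _.
rewrite big_ord1 fZ; congr (_ *: _).
by apply/colP => i; rewrite !mxE.
Qed.

Section Representation.
Variables (R : realType) (n : nat) (X : Type) (S : set X).
Local Notation C := R[i].
Local Notation E := 'cV[C]_n.
Variable (rho : X -> E -> E) (act : X -> 'M[C]_n).
Hypothesis rhoE : forall x v, rho x v = act x *m v.
Let Gam : set 'M[C]_n := act @` S.
Variable P : 'M[C]_n.
Hypothesis H : adjoint_setting Gam P.
Implicit Types (p q w u : 'M[C]_n) (v : E).

Let linearE (f : E -> E) : linear f -> exists A, forall v, f v = A *m v.
Proof.
move=> /linear_mulmx[A fA]; exists A => v; rewrite fA.
by apply/colP => i; rewrite summxE mxE; apply: eq_bigr => j _;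
  rewrite !mxE mulrC.
Qed.

Let act_bar x : S x -> bar (act x) = act x.
Proof. by move=> Sx; case: H => + _ _ _ _; apply; exists x. Qed.

Lemma subrep_projection V : subrep S rho V ->
  exists2 p, projection Gam P p & V = vsim p.
Proof.
move=> SV; have [|p pp Vp] := orthogonal_projection H (V := V).
  by move=> _ v [x Sx <-] Vv; rewrite -rhoE SV.
exists p => //; apply/vspaceP => v; rewrite Vp mem_vsim//.
by case: pp.
Qed.

Lemma projection_subrep p : projection Gam P p -> subrep S rho (vsim p).
Proof.
move=> [Bp _ pp] x v Sx; rewrite !mem_vsim// rhoE => /eqP pv.
by rewrite mulmxA -Bp; [rewrite -mulmxA pv | exists x].
Qed.

Lemma vsim_inj p q : projection Gam P p -> projection Gam P q ->
  vsim p = vsim q -> p = q.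
Proof.
move=> [_ sp pp] [_ sq qq] pq.
have /eqP pq' : p *m q == q by rewrite -subv_vsim// pq subvv.
have /eqP qp : q *m p == p by rewrite -subv_vsim// pq subvv.
by rewrite -sp -qp (starM H) sp sq.
Qed.

(** A subrepresentation of the image of [p] is the image of a projection [q] below [p]. For minimal
    [p] this [q] is [c *: p] with [c] idempotent, so [c] is 0 or 1. *)
Lemma irrep_minproj p : projection Gam P p ->
  irrep S rho (vsim p) <-> minproj Gam P p.
Proof.
move=> pp; have [Bp sp ppp] := pp; split=> [[_ p0 pmin]|mp].
  apply: (minimal_minproj H) => //.
    by apply: contra p0 => /eqP ->; rewrite vsim0.
  move=> q pq /eqP; rewrite -subv_vsim// => qp.
  have [q0|qp'] := pmin _ (projection_subrep pq) qp; last by right;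
    exact: vsim_inj.
  left; apply: mulmx_cV_ext => v; rewrite mul0mx; apply/eqP.
  by rewrite -memv0 -q0 vsim_mulmx.
have [_ p0 pm] := mp; split; first exact: projection_subrep.
  apply: contra p0 => /eqP p0; apply/eqP/mulmx_cV_ext => v.
  by rewrite mul0mx; apply/eqP; rewrite -memv0 -p0 vsim_mulmx.
move=> W /subrep_projection[q pq ->]; rewrite subv_vsim// => /eqP Epq.
have [Bq sq qq] := pq; have [c Ec] := pm q Bq.
have qp : q *m p = q by rewrite -{1}sq -{1}sp -(starM H) Epq sq.
rewrite Epq qp in Ec.
have [c0|c0] := eqVneq c 0; first by left; rewrite Ec c0 scale0r vsim0.
right; congr vsim; have : c = 1.
  apply: (mulfI c0); apply: (scale_neq0_inj p0);
    rewrite mulr1 -Ec -[in RHS]qq Ec.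
  by rewrite -scalemxAl -scalemxAr ppp scalerA.
by rewrite Ec => ->; rewrite scale1r.
Qed.

Lemma irrep_projection V : irrep S rho V ->
  exists2 p, minproj Gam P p & V = vsim p.
Proof.
move=> iV; have [sV _ _] := iV; have [p pp Vp] := subrep_projection sV.
by exists p => //; apply/irrep_minproj; rewrite -?Vp.
Qed.

Lemma iso_repP p q : minproj Gam P p -> minproj Gam P q ->
  iso_rep S rho (vsim p) (vsim q) <-> equivp Gam P p q.
Proof.
move=> mp mq; have [[Bp sp pp] p0 pm] := mp; have [[Bq sq qq] q0 qm] := mq.
split.
  move=> [f [lf [fV finj _] fS]]; have [A fA] := linearE lf.
  (* The map [f] is equivariant only on the image of [p], so its matrix is cut off to [A *m p],
     which lies in the commutant; [q *m A *m p] is nonzero because [f] is injective on that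
     image. *)
  apply: (equivp_of_neq0 H mp mq (X := A *m p)).
    move=> _ [x Sx <-]; apply: mulmx_cV_ext => v.
    have := fS x (p *m v) Sx (vsim_mulmx p v).
    rewrite !rhoE !fA => E1.
    have -> : act x *m (A *m p) *m v = act x *m (A *m (p *m v))
      by rewrite !mulmxA.
    rewrite -E1 (mulmxA (act x)) Bp; last by exists x.
    by rewrite !mulmxA.
  rewrite -mulmxA -[X in _ *m X]mulmxA pp.
  apply: contraNneq p0 => qAp; apply/eqP/mulmx_cV_ext => v; rewrite mul0mx.
  apply: finj; rewrite ?in_setE/= ?vsim_mulmx ?mem0v//.
  have := fV (p *m v); rewrite /= vsim_mulmx mem_vsim// fA => /(_ isT) /eqP E1.
  by rewrite !fA mulmx0 -E1 !mulmxA -(mulmxA q) qAp mul0mx.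
move=> [u [Bu uu uu' up qu]]; exists (mulmx u); split.
- by move=> c v w; rewrite mulmxDr scalemxAr.
- split.
  + by move=> v _ /=; rewrite mem_vsim// mulmxA qu.
  + move=> v w; rewrite !in_setE /= !mem_vsim// => /eqP pv /eqP pw uvw.
    by rewrite -pv -pw -uu -!mulmxA uvw.
  + move=> v /=; rewrite mem_vsim// => /eqP qv; exists (star P u *m v) => /=.
      by rewrite mem_vsim// mulmxA -{1}sp -(starM H) up.
    by rewrite mulmxA uu' qv.
- by move=> x v Sx _; rewrite !rhoE !mulmxA Bu//; exists x.
Qed.

(** Here [V'] is the conjugate of [V]. Entrywise conjugation commutes with the action, whose
    matrices are real, and exchanges linear and antilinear maps. *)
Lemma conj_iso_rep_bar (V W V' : {vspace E}) :
  (forall v, (v \in V') = (bar v \in V)) ->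
  conj_iso_rep S rho V W <-> iso_rep S rho V' W.
Proof.
move=> V'V; have rho_bar x v : S x -> rho x (bar v) = bar (rho x v).
  by move=> Sx; rewrite !rhoE barM act_bar.
split=> -[f [lf [fV finj fsurj] fS]]; exists (f \o @bar _ n 1); split.
- by move=> c u v /=; rewrite barD barZ lf conjcE conjCK.
- split.
  + by move=> v /=; rewrite V'V; exact: fV.
  + move=> v w; rewrite !in_setE /= !V'V => vV wV /finj; rewrite !in_setE /=.
    by move=> /(_ vV wV) /(congr1 (@bar _ n 1)); rewrite !barK.
  + move=> w /fsurj[v /= vV <-]; exists (bar v); last by rewrite /= barK.
    by rewrite /= V'V barK.
- move=> x v Sx; rewrite V'V => vV /=.
  by rewrite -rho_bar// fS.
- by move=> c u v /=; rewrite barD barZ lf conjcE.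
- split.
  + by move=> v /= vV; apply: fV; rewrite /= V'V barK.
  + move=> v w; rewrite !in_setE /= => vV wV /finj;
      rewrite !in_setE /= !V'V !barK.
    by move=> /(_ vV wV) /(congr1 (@bar _ n 1)); rewrite !barK.
  + move=> w /fsurj[v /= vV <-]; exists (bar v); last by rewrite /= barK.
    by rewrite /= -V'V.
- move=> x v Sx vV /=.
  by rewrite -rho_bar// fS// V'V barK.
Qed.

Lemma conj_iso_repP p q : minproj Gam P p -> minproj Gam P q ->
  conj_iso_rep S rho (vsim p) (vsim q) <-> equivp Gam P (bar p) q.
Proof.
move=> mp mq; rewrite -(iso_repP (minproj_bar H mp) mq).
have [[_ _ pp] _ _] := mp.
apply: conj_iso_rep_bar => v; rewrite !mem_vsim -?barM ?pp//.
apply/eqP/eqP => [<-|E1]; first by rewrite barM !barK mulmxA pp.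
by rewrite -{1}[v]barK -barM E1 barK.
Qed.

Lemma structure_mapP (b : bool) p : minproj Gam P p ->
  structure_map S rho (vsim p) ((-1) ^+ b) <-> structure_sign Gam b p.
Proof.
move=> mp; have [[Bp sp pp] p0 pm] := mp.
have pbp : bar p *m bar p = bar p by rewrite -barM pp.
split.
  move=> [j [aj jS jV jj]].
  (* Composed with conjugation, [j] becomes linear; cutting its matrix off by [bar p] gives the [X]
     of [structure_sign], with [c = 1]. *)
  have [|A jA] := linearE (f := j \o @bar _ n 1).
    by move=> c u v /=; rewrite barD barZ aj conjcE conjCK.
  have XE v : A *m bar p *m v = j (p *m bar v).
    by rewrite -[p *m bar v]barK barM barK -mulmxA -jA.
  exists (A *m bar p), 1; split => //.
  - move=> _ [x Sx <-]; apply: mulmx_cV_ext => v.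
    rewrite -[LHS]mulmxA XE -rhoE -jS ?vsim_mulmx// -[RHS]mulmxA XE.
    rewrite rhoE (barM (act x)) act_bar//.
    by rewrite !mulmxA Bp//; exists x.
  - apply: mulmx_cV_ext => v; rewrite -[LHS]mulmxA XE; apply/eqP.
    by rewrite -mem_vsim//; apply: jV; exact: vsim_mulmx.
  - by rewrite -mulmxA pbp.
  - apply: mulmx_cV_ext => v; rewrite mulr1 -[LHS]mulmxA XE.
    rewrite (barM _ v) barK XE barK.
    have /eqP -> : p *m j (p *m v) == j (p *m v).
      by rewrite -mem_vsim//; apply: jV; exact: vsim_mulmx.
    by rewrite jj ?vsim_mulmx// scalemxAl.
move=> /(structure_sign_iso H mp)[u [Bu uu uu' up pu] Eu].
exists (mulmx u \o @bar _ n 1); split.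
- by move=> c v w /=; rewrite barD barZ mulmxDr scalemxAr conjcE.
- move=> x v Sx _ /=; rewrite !rhoE barM act_bar//.
  by rewrite !mulmxA Bu//; exists x.
- by move=> v _ /=; rewrite mem_vsim// mulmxA pu.
- move=> v; rewrite mem_vsim// => /eqP pv /=.
  by rewrite barM barK mulmxA Eu -scalemxAl pv.
Qed.

(** * Independence of multiplicities from the decomposition *)

Section Counting.
Variables (N : nat) (q : 'I_N -> 'M[C]_n).
Hypothesis q_min : forall j, minproj Gam P (q j).
Hypothesis q_orth : forall i j, i != j -> q i *m q j = 0.
Hypothesis q_sum : \sum_j q j = 1%:M.

Let qq j : q j *m q j = q j. Proof. by have [[]] := q_min j. Qed.

Lemma orthogonal_decomposition : decomposition S rho (fun j => vsim (q j)).
Proof.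
split.
- by move=> j; apply/irrep_minproj => //; have [] := q_min j.
- apply/directv_sum_independent => us us_q us0 i _.
  have := congr1 (mulmx (q i)) us0; rewrite mulmx0 mulmx_sumr (bigD1 i)//=.
  rewrite big1 ?addr0 => [|j ji].
    by have := us_q i isT; rewrite mem_vsim// => /eqP ->.
  have := us_q j isT; rewrite mem_vsim// => /eqP <-.
  by rewrite mulmxA q_orth ?mul0mx// eq_sym.
- apply/vspaceP => v; rewrite memvf -[v]mul1mx -q_sum mulmx_suml.
  by apply/memv_sumr => j _; exact: vsim_mulmx.
Qed.

Variables (T : 'M[C]_n -> Prop) (TV : {vspace E} -> Prop).
Hypothesis T_equivp : forall p p', minproj Gam P p -> minproj Gam P p' ->
  T p -> equivp Gam P p p' -> T p'.
Hypothesis equivp_T : forall p p', minproj Gam P p -> minproj Gam P p' ->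
  T p -> T p' -> equivp Gam P p p'.
Hypothesis TVE : forall p, minproj Gam P p -> TV (vsim p) <-> T p.

Let z := \sum_(j | `[< T (q j) >]) q j.

Let zz : z *m z = z.
Proof.
rewrite mulmx_suml; apply: eq_bigr => j Tj.
rewrite mulmx_sumr (bigD1 j)//= qq big1 ?addr0// => i /andP[_ ij].
by rewrite q_orth// eq_sym.
Qed.

(** By Schur's lemma a [q i] annihilates every irrep not equivalent to its image. Hence [z] fixes
    the summands of type [T] and kills the others, and its image is the sum of the former. *)
Let isotypic_dim k (V : 'I_k -> {vspace E}) : decomposition S rho V ->
  \dim (vsim z) = (\sum_(j | `[< TV (V j) >]) \dim (V j))%N.
Proof.
move=> [iV dV fV].
have zV j v : v \in V j -> z *m v = if `[< TV (V j) >] then v else 0.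
  have [p mp ->] := irrep_projection (iV j).
  have [[_ _ pp] _ _] := mp; rewrite mem_vsim// => /eqP pv.
  have kill i : ~ equivp Gam P p (q i) -> q i *m v = 0.
    move=> npq; rewrite -pv mulmxA.
    have := nequivp H mp (q_min i) npq (@commutant1 _ _ _).
    by rewrite mulmx1 => ->; rewrite mul0mx.
  rewrite /z mulmx_suml; case: asboolP => [/(TVE mp) Tp|nTp].
    rewrite -[RHS]mul1mx -q_sum mulmx_suml [RHS](bigID (fun i => `[< T (q i)
      >])) /=.
    rewrite [X in _ + X]big1 ?addr0// => i /asboolP nTi; apply: kill => pq.
    exact: nTi (T_equivp mp (q_min i) Tp pq).
  rewrite big1// => i /asboolP Ti; apply: kill => pq.
  apply: nTp; apply/(TVE mp); apply: (T_equivp (q_min i) mp Ti).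
  apply: equivp_sym pq => //; by [have [] := mp | have [] := q_min i].
have -> : vsim z = (\sum_(j | `[< TV (V j) >]) V j)%VS.
  apply/vspaceP => v; rewrite mem_vsim//; apply/eqP/memv_sumP => [zv|].
    have /memv_sumP[vs vsV Ev] : v \in (\sum_j V j)%VS by rewrite fV memvf.
    exists vs; first by move=> j _; exact: vsV.
    rewrite -zv Ev mulmx_sumr [RHS]big_mkcond /=; apply: eq_bigr => j _.
    by rewrite (zV j)// vsV.
  move=> [vs vsV ->]; rewrite mulmx_sumr; apply: eq_bigr => j Tj.
  by rewrite (zV j) ?Tj// vsV.
suff /directvP : directv (\sum_(j | `[< TV (V j) >]) V j) by [].
apply/directv_sum_independent => us usV us0 i Ti.
have /directv_sum_independent dV' := dV.
have := dV' (fun j => if `[< TV (V j) >] then us j else 0).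
move=> /(_ _ _ i isT); rewrite Ti; apply.
  by move=> j _; case: ifP => [/usV//|_]; rewrite mem0v.
by rewrite -big_mkcond.
Qed.

Lemma decomposition_card k (V : 'I_k -> {vspace E}) : decomposition S rho V ->
  #|[pred j | `[< TV (V j) >]]| = #|[pred j | `[< T (q j) >]]|.
Proof.
(* The common dimension of the irreps of type [T]; if there are none, the value 1 keeps [d]
   positive, so that it can be cancelled. *)
have [d d0 dT] : exists2 d, (0 < d)%N &
    forall p, minproj Gam P p -> T p -> \dim (vsim p) = d.
  have [[p [mp Tp]]|nT] := pselect (exists p, minproj Gam P p /\ T p);
    last first.
    by exists 1%N => // p mp Tp; case: nT; exists p.
  exists (\dim (vsim p)).
    rewrite lt0n dimv_eq0; have [pp _ _] := mp.
    by have /(irrep_minproj pp)[] := mp.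
  have dimle p1 p2 : minproj Gam P p1 -> minproj Gam P p2 -> T p1 -> T p2 ->
      (\dim (vsim p2) <= \dim (vsim p1))%N.
    move=> mp1 mp2 T1 T2; have [u [_ uu uu' up qu]] := equivp_T mp1 mp2 T1 T2.
    apply: (@dim_vsim_mulmx _ _ u); [by have [[]] := mp1|by have [[]]
      := mp2|by []|].
    by exists (star P u); rewrite up.
  by move=> p' mp' Tp'; apply/eqP; rewrite eqn_leq !dimle.
have card_dim k' (V' : 'I_k' -> {vspace E}) : decomposition S rho V' ->
    (#|[pred j | `[< TV (V' j) >]]| * d)%N = \dim (vsim z).
  move=> dV'; rewrite (isotypic_dim dV') -sum_nat_const.
  apply: eq_bigr => j /asboolP; have [iV _ _] := dV'.
  by have [p mp ->] := irrep_projection (iV j) => /(TVE mp) Tp; rewrite dT.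
move=> dV; apply/eqP; rewrite -(eqn_pmul2r d0) (card_dim _ _ dV).
rewrite -(card_dim _ _ orthogonal_decomposition); apply/eqP; congr (_ * _)%N.
by apply: eq_card => j; rewrite !inE; apply: asbool_equiv_eq; exact: TVE.
Qed.

End Counting.

(** The images of the [q j] form a decomposition, so [xget] does not return its default 0; whichever
    decomposition it selects, [decomposition_card] gives the same count. *)
Lemma multiplicity_forE N (q : 'I_N -> 'M[C]_n)
    (r : {vspace E} -> {vspace E} -> Prop) (W : {vspace E}) w :
  (forall j, minproj Gam P (q j)) -> (forall i j, i != j -> q i *m q j = 0) ->
  \sum_j q j = 1%:M -> minproj Gam P w ->
  (forall p, minproj Gam P p -> r W (vsim p) <-> equivp Gam P w p) ->
  multiplicity_for S rho r W = #|[pred j | `[< equivp Gam P w (q j) >]]|.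
Proof.
move=> q_min q_orth q_sum mw rW.
rewrite /multiplicity_for; set A := [set m | _].
have : A (xget 0%N A).
  apply: xgetPex; exists #|[pred j | `[< r W (vsim (q j)) >]]|, N, (fun j =>
    vsim (q j)).
  by split=> //; exact: orthogonal_decomposition.
move=> [k [V [dV <-]]].
apply: (decomposition_card q_min q_orth q_sum (T := equivp Gam P w)
  (TV := r W)) dV => //.
- by move=> p p' _ _; exact: equivp_trans.
- move=> p p' [pp _ _] [pp' _ _] wp wp'; have [pw _ _] := mw.
  by apply: (equivp_trans H) wp'; exact: equivp_sym.
Qed.

End Representation.

(** * Classification of the real commutant *)

Section FiniteClasses.

Lemma class_representatives (T : eqType) (Q : T -> Prop) (r : T -> T -> Prop)
    (s : seq T) :
  (forall x, Q x -> r x x) -> (forall x y, Q x -> Q y -> r x y -> r y x) ->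
  (forall x, x \in s -> Q x) ->
  exists k (w : 'I_k -> T), [/\ forall i, w i \in s,
    forall i j, r (w i) (w j) -> i = j & forall x, x \in s
      -> exists i, r (w i) x].
Proof.
move=> rr rs sQ.
suff [ws [wss wr sw]] : exists ws : seq T, [/\ {subset ws <= s},
    pairwise (fun x y => ~~ `[< r x y >]) ws &
    forall x, x \in s -> exists2 y, y \in ws & r y x].
  exists (size ws), (fun i => tnth (in_tuple ws) i); split.
  - by move=> i; apply/wss/mem_tnth.
  - have lt_nr (i j : 'I_(size ws)) : (i < j)%N ->
        ~ r (tnth (in_tuple ws) i) (tnth (in_tuple ws) j).
      have [x0 _] : exists x0 : T, True by exists (tnth (in_tuple ws) i).
      move=> ij; rewrite !(tnth_nth x0).
      by apply/asboolPn; move/pairwiseP: wr; apply => //; exact: ltn_ord.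
    move=> i j rij; apply/val_inj; case: (ltngtP i j) => // /lt_nr; first by [].
    case; apply: rs rij; apply/sQ/wss/mem_tnth.
  - move=> x /sw[y yw ryx]; have /tnthP[i Ei] : y \in in_tuple ws by [].
    by exists i; rewrite -Ei.
elim: s sQ => [|x s IHs] sQ; first by exists [::].
have [|ws [wss wr sw]] := IHs _; first by move=> y ys; apply: sQ;
  rewrite inE ys orbT.
have [[y yw ryx]|nx] := pselect (exists2 y, y \in ws & r y x).
  exists ws; split => // [z /wss zs|z]; first by rewrite inE zs orbT.
  by rewrite inE => /predU1P[->|/sw//]; exists y.
exists (x :: ws); split.
- by move=> z; rewrite !inE => /predU1P[->|/wss ->]; rewrite ?eqxx ?orbT.
- rewrite /= wr andbT; apply/allP => y yw; apply/asboolPn => rxy; apply: nx.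
  exists y => //; apply: rs rxy; apply: sQ; rewrite inE ?eqxx//.
  by rewrite wss ?orbT.
- move=> z; rewrite inE => /predU1P[->|/sw[y yw ryz]].
    by exists x; rewrite ?inE ?eqxx//; apply/rr/sQ; rewrite inE eqxx.
  by exists y; rewrite // inE yw orbT.
Qed.

Lemma card_enumeration (T : finType) (A : pred T) k : k = #|A| ->
  exists f : 'I_k -> T, [/\ injective f, forall a, A (f a) &
    forall (V : nmodType) (F : T -> V), \sum_(a < k) F (f a)
      = \sum_(j | A j) F j].
Proof.
move=> ->; exists (@enum_val T A); split; first exact: enum_val_inj.
  by move=> a; exact: enum_valP.
by move=> V F; rewrite -big_enum_val.
Qed.

Lemma card_nth (T : Type) (x0 : T) (A : T -> Prop) (t : seq T) :
  #|[pred j : 'I_(size t) | `[< A (nth x0 t j) >]]| =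
  (\sum_(x <- t) nat_of_bool `[< A x >])%N.
Proof.
rewrite -sum1_card big_mkcond (big_nth x0) big_mkord; apply: eq_bigr => j _.
by rewrite inE; case: asboolP.
Qed.

End FiniteClasses.

Lemma alg_iso_trans (R : pzRingType) (A B D : assocAlgType R) :
  alg_iso A B -> alg_iso B D -> alg_iso A D.
Proof.
move=> [f [fL fM f1] fb] [g [gL gM g1] gb]; exists (g \o f);
  last exact: bij_comp.
split=> [c x y|x y|] /=; [by rewrite fL gL|by rewrite fM gM|by rewrite f1 g1].
Qed.

Lemma direct_sum3_iso (R : pzRingType) (I J K : finType)
    (A : (I + J + K)%type -> assocAlgType R) :
  alg_iso (direct_sum A) (direct_sum (fun i => A (inl (inl i))) *
    direct_sum (fun j => A (inl (inr j))) * direct_sum (fun k => A (inr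
      k)))%type.
Proof.
exists (fun x => (((fun i => x (inl (inl i))), (fun j => x (inl (inr j)))),
                  (fun k => x (inr k)))); first by [].
exists (fun y => (fun u => match u as u return A u with
  | inl (inl i) => y.1.1 i | inl (inr j) => y.1.2 j | inr k => y.2 k end)).
  by move=> x; apply: functional_extensionality_dep => -[[i|j]|k].
by move=> [[y1 y2] y3].
Qed.

(** * The corners as real numbers, complex numbers and quaternions *)

Section CornerModels.
Variables (R : realType) (n : nat).
Local Notation C := R[i].
Variables (Gam : set 'M[C]_n) (P : 'M[C]_n).
Hypothesis H : adjoint_setting Gam P.
Implicit Types (w u : 'M[C]_n).

Definition corner_model (D : algType R) w (phi : D -> 'M[C]_n) : Prop :=
  [/\ forall c x y, phi (c *: x + y) = c%:C%C *: phi x + phi y,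
      {morph phi : x y / x * y >-> x *m y}, phi 1 = real_hull w &
      [/\ injective phi, forall x, commutant Gam (phi x) /\ bar (phi x)
        = phi x &
          forall X, commutant Gam X -> bar X = X ->
            exists d, real_hull w *m X *m real_hull w = phi d]].

Let conj_realc (c : R) : (c%:C%C)^* = c%:C%C.
Proof. exact: conjc_real. Qed.

Lemma real_corner_model w : block Gam P w -> bar w = w ->
  @corner_model R^o w (fun c => c%:C%C *: w).
Proof.
move=> [mw _] rw; have [[Bw sw ww] w0 wm] := mw; split.
- by move=> c x y; rewrite rmorphD rmorphM scalerDl scalerA.
- by move=> x y; rewrite rmorphM -scalemxAl -scalemxAr ww scalerA.
- by rewrite rmorph1 scale1r real_hull_real.
- split.
  + by move=> x y /(scale_neq0_inj w0) /complexI.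
  + by move=> x; rewrite barZ rw conj_realc; split => //; exact: commutantZ.
  + move=> X BX rX; have [c rc] := corner_scalar mw rw BX rX.
    rewrite real_hull_real// => ->; have /CrealP/complex_realP[d ->] := rc.
    by exists d.
Qed.

Lemma complex_corner_model w : block Gam P w -> bar w <> w ->
  ~ equivp Gam P (bar w) w ->
  @corner_model (Rcomplex R) w (fun c => complex_corner w c).
Proof.
move=> bw nw nbw; split.
- move=> c x y; rewrite -(complex_cornerD w x y (conj_realc c));
    congr complex_corner.
  by case: x y => a b [a' b']; apply/eqP; rewrite eq_complex /= !mul0r subr0
    addr0 !eqxx.
- by move=> x y; exact: (complex_cornerM bw nw).
- exact: (complex_corner1 bw nw).
- split.
  + exact: (complex_corner_inj bw nw).
  + move=> x; split; first exact: (complex_corner_commutant H bw).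
    exact: complex_corner_bar.
  + by move=> X BX rX; exact: (complex_corner_surj H bw nw nbw BX rX).
Qed.

Definition quaternion_embedding w u (x : quaternion R) : 'M[C]_n :=
  let: (a, b, c, d) := x in quaternion_corner w u (a +i* b)%C (c +i* d)%C.

Lemma quaternion_corner_model w u : block Gam P w -> bar w <> w ->
  partial_iso Gam P (bar w) w u -> u *m bar u = - w ->
  @corner_model (quaternion R) w (quaternion_embedding w u).
Proof.
move=> bw nw iu uu; split.
- move=> c [[[a1 b1] c1] d1] [[[a2 b2] c2] d2].
  have -> : c *: ((a1, b1, c1, d1) : quaternion R) + (a2, b2, c2, d2) =
    (c * a1 + a2, c * b1 + b2, c * c1 + c2, c * d1 + d2) by [].
  rewrite /quaternion_embedding -(quaternion_cornerD w u _ _ _ _ (conj_realc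
    c)).
  by apply: (congr2 (quaternion_corner w u)); apply/eqP;
    rewrite eq_complex /= !mul0r subr0 addr0 !eqxx.
- move=> [[[a1 b1] c1] d1] [[[a2 b2] c2] d2].
  have -> : ((a1, b1, c1, d1) : quaternion R) * (a2, b2, c2, d2) =
    (a1 * a2 - b1 * b2 - c1 * c2 - d1 * d2, a1 * b2 + b1 * a2 + c1 * d2 - d1 *
      c2,
     a1 * c2 - b1 * d2 + c1 * a2 + d1 * b2,
     a1 * d2 + b1 * c2 - c1 * b2 + d1 * a2) by [].
  rewrite /quaternion_embedding -(quaternion_cornerM bw nw iu uu).
  rewrite -!conjcE; apply: (congr2 (quaternion_corner w u)); apply/eqP;
    by rewrite eq_complex /=; apply/andP; split; apply/eqP; ring.
- by rewrite -(quaternion_corner1 bw nw u).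
- split.
  + move=> [[[a1 b1] c1] d1] [[[a2 b2] c2] d2].
    by move=> /(quaternion_corner_inj bw nw iu uu)[[-> ->] [-> ->]].
  + move=> [[[a b] c] d]; split; last exact: quaternion_corner_bar.
    exact: (quaternion_corner_commutant H bw iu).
  + move=> X BX rX.
    have [[a b] [[c d] ->]] := quaternion_corner_surj H bw nw iu BX rX.
    by exists (a, b, c, d).
Qed.

End CornerModels.

(** * Classes of blocks and their multiplicities *)

Section Classification.
Variables (R : realType) (n : nat) (X : Type) (S : set X).
Local Notation C := R[i].
Local Notation M := 'M[C]_n.
Variable (rho : X -> 'cV[C]_n -> 'cV[C]_n) (act : X -> M).
Hypothesis rhoE : forall x v, rho x v = act x *m v.
Let Gam : set M := act @` S.
Variable P : M.
Hypothesis H : adjoint_setting Gam P.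
Implicit Types (p q w u : M).

Variables (N : nat) (b : 'I_N -> M).
Hypothesis bB : forall j, block Gam P (b j).
Hypothesis b_sum : \sum_j real_hull (b j) = 1%:M.

Let b_min j : minproj Gam P (b j). Proof. by have [] := bB j. Qed.

Let b_orth i j : i != j -> real_hull (b i) *m real_hull (b j) = 0.
Proof.
by apply: (projections_sum1_orth H) b_sum i j => k; exact: real_hull_projection.
Qed.

Let proj_of p : minproj Gam P p -> projection Gam P p. Proof. by case. Qed.

(** The hulls sum to the identity, so one of them does not annihilate [p]; by Schur's lemma [p] is
    equivalent to that block or to its conjugate. *)
Lemma minproj_equivb p : minproj Gam P p -> exists j, equivb Gam P (b j) p.
Proof.
move=> mp; have [pp p0 _] := mp.
have [j /eqP bp] : exists j, real_hull (b j) *m p != 0.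
  apply/not_existsP => nb; move/eqP: p0; apply.
  rewrite -[p]mul1mx -b_sum mulmx_suml big1// => j _.
  by apply/eqP/negPn/negP/nb.
exists j; apply: contra_notP bp => nbp.
have nbp1 : ~ equivp Gam P p (b j).
  by move=> pb; apply: nbp; left; apply: equivp_sym pb => //; exact: proj_of.
have nbp2 : ~ equivp Gam P p (bar (b j)).
  move=> pb; apply: nbp; right; apply: equivp_sym pb => //.
  by apply: projection_bar => //; exact: proj_of.
have bp1 := nequivp H mp (b_min j) nbp1 (@commutant1 _ _ _).
have bp2 := nequivp H mp (minproj_bar H (b_min j)) nbp2 (@commutant1 _ _ _).
rewrite !mulmx1 in bp1 bp2; rewrite /real_hull; case: eqP => // _.
by rewrite mulmxDl bp1 bp2 addr0.
Qed.

(** The common value of the three kinds of multiplicity, and the size of the matrix algebra attached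
    to the class. *)
Definition class_size w : nat := #|[pred j | `[< equivb Gam P w (b j) >]]|.

(** Refines the real decomposition to minimal projections, since multiplicities are counted in
    complex irreps. *)
Let parts p : seq M := if bar p == p then [:: p] else [:: p; bar p].
Let t := flatten [seq parts (b j) | j <- enum 'I_N].
Let q (j : 'I_(size t)) : M := nth 0 t j.

Let sum_t (V : nmodType) (F : M -> V) :
  \sum_(p <- t) F p = \sum_j \sum_(p <- parts (b j)) F p.
Proof. by rewrite /t big_flatten big_map enumT. Qed.

Let parts_min j p : p \in parts (b j) -> minproj Gam P p.
Proof.
rewrite /parts; case: eqP => _; rewrite !inE; first by move/eqP->.
by move=> /orP[]/eqP-> //; exact: minproj_bar.
Qed.

Let q_min j : minproj Gam P (q j).
Proof.
have : q j \in t by rewrite mem_nth.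
by case/flatten_mapP => k _; exact: parts_min.
Qed.

Let q_sum : \sum_j q j = 1%:M.
Proof.
rewrite -[RHS]b_sum -[LHS](big_mkord xpredT (fun j => nth 0 t j)).
rewrite -(big_nth 0 xpredT id) sum_t; apply: eq_bigr => j _.
by rewrite /parts /real_hull; case: eqP => _; rewrite !big_cons big_nil addr0.
Qed.

Let multE (r : {vspace 'cV[C]_n} -> {vspace 'cV[C]_n} -> Prop) W w :
  minproj Gam P w ->
  (forall p, minproj Gam P p -> r W (vsim p) <-> equivp Gam P w p) ->
  multiplicity_for S rho r W =
  (\sum_j \sum_(p <- parts (b j)) nat_of_bool `[< equivp Gam P w p >])%N.
Proof.
move=> mw rW.
have q_orth := projections_sum1_orth H (fun j => proj_of (q_min j)) q_sum.
rewrite (multiplicity_forE rhoE H q_min q_orth q_sum mw rW).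
by rewrite (card_nth 0 (equivp Gam P w)) (sum_t (V := nat)).
Qed.

Let class_sizeE w :
  class_size w = (\sum_j nat_of_bool `[< equivb Gam P w (b j) >])%N.
Proof. by rewrite /class_size -sum1_card big_mkcond. Qed.

(** Equivalence preserves the type, so only real blocks are equivalent to [w], and each of them
    contributes one irrep. *)
Lemma real_multiplicity w : block Gam P w -> bar w = w ->
  multiplicity S rho (vsim w) = class_size w.
Proof.
move=> bw rw; have [mw _] := bw.
rewrite /multiplicity (multE (w := w))//; last by move=> p mp; exact: iso_repP.
rewrite class_sizeE; apply: eq_bigr => j _; rewrite /parts.
have E : equivb Gam P w (b j) <-> equivp Gam P w (b j).
  by rewrite /equivb rw; split => [[]|]; [| |left].
case: eqP => rb; rewrite !big_cons big_nil ?addn0.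
  by congr nat_of_bool; apply: asbool_equiv_eq; rewrite E.
have nwb : ~ equivb Gam P w (b j).
  move=> wb; apply: rb; apply/(block_sign (bB j)).
  by apply: (equivb_sign H (proj_of (b_min j)) wb); apply/(block_sign bw).
have nwb1 : ~ equivp Gam P w (b j) by move/E.
have nwb2 : ~ equivp Gam P w (bar (b j)).
  by move=> wb; apply: nwb; right; rewrite -[b j]barK; exact: equivp_bar.
by rewrite !asboolF.
Qed.

Let equivp_barr w p : equivp Gam P w (bar p) <-> equivp Gam P (bar w) p.
Proof. by split => /(equivp_bar H); rewrite barK. Qed.

(** At most one of [b j] and its conjugate is equivalent to [w], for otherwise [w] would be
    equivalent to its own conjugate. *)
Let complex_parts w j : minproj Gam P w -> ~ equivp Gam P (bar w) w ->
  (\sum_(p <- parts (b j)) nat_of_bool `[< equivp Gam P w p >])%N =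
  `[< equivb Gam P w (b j) >].
Proof.
move=> mw nw; have pw := proj_of mw; have pj := proj_of (b_min j).
have excl : equivp Gam P w (b j) -> ~ equivp Gam P (bar w) (b j).
  move=> wb /(equivp_trans H) bwb; apply: nw; apply: bwb.
  exact: equivp_sym wb.
rewrite /parts; case: eqP => rb; rewrite !big_cons big_nil ?addn0.
  have E : equivp Gam P w (b j) <-> equivp Gam P (bar w) (b j).
    by rewrite -{1}rb equivp_barr.
  have n1 : ~ equivp Gam P w (b j) by move=> wb; apply: (excl wb); apply/E.
  have n2 : ~ equivb Gam P w (b j) by case=> [//|/E].
  by rewrite !asboolF.
rewrite /equivb asbool_or (asbool_equiv_eq (equivp_barr w (b j))).
by case: asboolP => [/excl nwb|_]; case: asboolP => // /nwb.
Qed.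

Lemma complex_multiplicity w : block Gam P w -> ~ equivp Gam P (bar w) w ->
  conj_pair_multiplicity S rho (vsim w) = class_size w.
Proof.
move=> bw nw; have [mw _] := bw; have pw := proj_of mw.
have mbw := minproj_bar H mw.
have nbw : ~ equivp Gam P (bar (bar w)) (bar w).
  by move/(equivp_bar H); rewrite !barK.
rewrite /conj_pair_multiplicity (multE (w := w))//; last first.
  by move=> p mp; exact: iso_repP.
rewrite (multE (w := bar w))//; last by move=> p mp; exact: conj_iso_repP.
rewrite class_sizeE -[RHS]minnn; congr minn; apply: eq_bigr => j _.
  exact: complex_parts.
rewrite (complex_parts j mbw nbw); congr nat_of_bool; apply: asbool_equiv_eq.
by rewrite /equivb barK; split=> -[]; by [left|right].
Qed.

(** Both halves of a block in the class are equivalent to [w], so each block counts twice before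
    halving. *)
Lemma quaternionic_multiplicity w : block Gam P w -> bar w <> w ->
  equivp Gam P (bar w) w -> pair_multiplicity S rho (vsim w) = class_size w.
Proof.
move=> bw nrw bww; have [mw _] := bw; have pw := proj_of mw.
rewrite /pair_multiplicity /multiplicity (multE (w := w))//; last first.
  by move=> p mp; exact: iso_repP.
rewrite class_sizeE -[RHS]doubleK; congr half; rewrite -muln2 big_distrl /=.
apply: eq_bigr => j _; have pj := proj_of (b_min j).
have E : equivb Gam P w (b j) <-> equivp Gam P w (b j).
  split=> [[//|]|]; last by left.
  by apply: (equivp_trans H); apply: equivp_sym => //; exact: projection_bar.
have E' : equivp Gam P w (bar (b j)) <-> equivp Gam P w (b j).
  rewrite equivp_barr -E; split=> [|/E wb]; first by right.
  exact: (equivp_trans H) wb.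
rewrite (asbool_equiv_eq E) /parts; case: eqP => rb; rewrite !big_cons big_nil.
  rewrite addn0 asboolF// => /E wb; apply: nrw; apply/(block_sign bw).
  apply: (equivb_sign H pw (equivb_sym H pw pj wb)).
  exact/(block_sign (bB j)).
by rewrite (asbool_equiv_eq E') addn0 muln2 addnn.
Qed.

Lemma real_irrepP p : minproj Gam P p ->
  real_irrep S rho (vsim p) <-> structure_sign Gam false p.
Proof.
move=> mp; rewrite /real_irrep -(structure_mapP rhoE H false mp) expr0.
split=> [[]//|sp]; split => //; apply/(irrep_minproj rhoE H) => //.
exact: proj_of.
Qed.

Lemma quaternionic_irrepP p : minproj Gam P p ->
  quaternionic_irrep S rho (vsim p) <-> structure_sign Gam true p.
Proof.
move=> mp; rewrite /quaternionic_irrep -(structure_mapP rhoE H true mp) expr1.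
split=> [[]//|sp]; split => //; apply/(irrep_minproj rhoE H) => //.
exact: proj_of.
Qed.

Lemma complex_irrepP p : minproj Gam P p ->
  complex_irrep S rho (vsim p) <-> ~ equivp Gam P (bar p) p.
Proof.
move=> mp; rewrite /complex_irrep (conj_iso_repP rhoE H mp mp).
split=> [[]//|sp]; split => //; apply/(irrep_minproj rhoE H) => //.
exact: proj_of.
Qed.

Lemma class_choice (Q : 'I_N -> Prop) :
  exists k (w : 'I_k -> 'I_N), [/\ forall i, Q (w i),
    forall i j, equivb Gam P (b (w i)) (b (w j)) -> i = j &
    forall j, Q j -> exists i, equivb Gam P (b (w i)) (b j)].
Proof.
have [||j|k [w [ws w_inj w_ex]]] := @class_representatives _ (fun=> True)
    (fun i j => equivb Gam P (b i) (b j)) [seq j <- enum 'I_N | `[< Q j >]].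
- by move=> i _; exact: equivb_refl.
- by move=> i j _ _; apply: equivb_sym => //; exact: proj_of.
- by [].
exists k, w; split => //.
  by move=> i; have := ws i; rewrite mem_filter => /andP[/asboolP].
by move=> j Qj; apply: w_ex; rewrite mem_filter mem_enum andbT; apply/asboolP.
Qed.

Variables (A : assocAlgType R) (theta : A -> M).
Hypothesis thetaL : forall c x y,
  theta (c *: x + y) = c%:C%C *: theta x + theta y.
Hypothesis thetaM : forall x y, theta (amul x y) = theta x *m theta y.
Hypothesis theta1 : theta aone = 1%:M.
Hypothesis theta_inj : injective theta.
Hypothesis theta_im : forall Y,
  (exists x, theta x = Y) <-> commutant Gam Y /\ bar Y = Y.

Lemma class_units w m : block Gam P w -> m = class_size w ->
  exists f : 'I_m -> 'I_N, exists F : 'I_m -> M,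
  [/\ injective f, forall a, partial_iso Gam P (real_hull w) (real_hull (b (f
    a))) (F a),
      forall a, bar (F a) = F a &
      \sum_(a < m) F a *m star P (F a) =
      \sum_(j | `[< equivb Gam P w (b j) >]) real_hull (b j)].
Proof.
move=> bw mE; have [f [f_inj fA fsum]] := card_enumeration mE.
have /choice[F FP] : forall a, exists F,
    partial_iso Gam P (real_hull w) (real_hull (b (f a))) F /\ bar F = F.
  move=> a; have /asboolP wf := fA a.
  by have [F iF rF] := block_iso H bw (bB (f a)) wf; exists F.
exists f, F; split => //; [by move=> a; case: (FP a)..|].
rewrite -(fsum _ (fun j => real_hull (b j))); apply: eq_bigr => a _.
by have [[]] := FP a.
Qed.

Lemma class_units_orth w m (f : 'I_m -> 'I_N) (F : 'I_m -> M) a a' :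
  injective f ->
  (forall a, partial_iso Gam P (real_hull w) (real_hull (b (f a))) (F a)) ->
  star P (F a) *m F a' = if a == a' then real_hull w else 0.
Proof.
move=> f_inj iF; have [_ FF _ _ hF] := iF a; have [_ _ _ _ hF'] := iF a'.
case: eqVneq => [<-//|aa'].
have [_ sh _] := real_hull_projection H (bB (f a)).
rewrite -hF (starM H) sh -hF' -mulmxA (mulmxA (real_hull _)) b_orth.
  by rewrite mul0mx mulmx0.
by apply: contra aa' => /eqP/f_inj ->.
Qed.

Lemma classification : exists (k l s : nat)
    (Wr : 'I_k -> {vspace 'cV[C]_n})
    (Wc : 'I_l -> {vspace 'cV[C]_n})
    (Wh : 'I_s -> {vspace 'cV[C]_n}),
  [/\ representatives (real_irrep S rho) (iso_rep S rho) Wr,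
      representatives (complex_irrep S rho) (iso_or_conj S rho) Wc,
      representatives (quaternionic_irrep S rho) (iso_rep S rho) Wh &
      alg_iso A
        (direct_sum (fun i => gl R^o (multiplicity S rho (Wr i))) *
         direct_sum (fun i => gl (Rcomplex R)
                                 (conj_pair_multiplicity S rho (Wc i))) *
         direct_sum (fun i => gl (quaternion R)
                                 (pair_multiplicity S rho (Wh i))))%type].
Proof.
have [k [wr [wrQ wr_inj wr_ex]]] := class_choice (fun j => bar (b j) = b j).
have [l [wc [wcQ wc_inj wc_ex]]] :=
  class_choice (fun j => ~ equivp Gam P (bar (b j)) (b j)).
have [s [wh [whQ wh_inj wh_ex]]] := class_choice
  (fun j => bar (b j) <> b j /\ equivp Gam P (bar (b j)) (b j)).
exists k, l, s, (fun i => vsim (b (wr i))), (fun i => vsim (b (wc i))),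
  (fun i => vsim (b (wh i))).
have equivb_common i j p : minproj Gam P p -> equivb Gam P (b i) p ->
    equivb Gam P (b j) p -> equivb Gam P (b i) (b j).
  move=> mp ip jp; apply: (equivb_trans H ip).
  by apply: equivb_sym jp => //; exact: proj_of.
have sign_common e j p : minproj Gam P p -> equivb Gam P (b j) p ->
    structure_sign Gam e p -> structure_sign Gam e (b j).
  move=> mp jp; apply: (equivb_sign H) => //; first exact: proj_of.
  by apply: equivb_sym jp => //; exact: proj_of.
have self_conj i p : minproj Gam P p -> equivb Gam P (b i) p ->
    equivp Gam P (bar p) p -> equivp Gam P (bar (b i)) (b i).
  move=> mp ip bpp; have pp := proj_of mp; have pi := proj_of (b_min i).
  have ip' : equivp Gam P (b i) p.
    case: ip => // /(equivp_bar H); rewrite barK => ip.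
    exact: (equivp_trans H) ip bpp.
  apply: (equivp_trans H (equivp_bar H ip')); apply: (equivp_trans H bpp).
  exact: equivp_sym ip'.
(* Self-conjugacy provides a sign, and the real one is excluded because the block is not real. *)
have whS i : structure_sign Gam true (b (wh i)).
  have [nr bww] := whQ i; have [e sg] := equivp_bar_sign H (b_min (wh i)) bww.
  move: e sg => -[] sg; first exact: sg.
  by case: nr; apply/(block_sign (bB _)).
split.
- split=> [i|V rV]; first by apply/real_irrepP => //; apply/(block_sign (bB _)).
  have [p mp Vp] := irrep_projection rhoE H (proj1 rV); rewrite Vp in rV *.
  move/(real_irrepP mp): rV => sp; have [j jp] := minproj_equivb mp.
  have [i ij] := wr_ex j (proj2 (block_sign (bB j)) (sign_common _ _ _ mp jp
    sp)).
  have ip := equivb_trans H ij jp; exists i; split.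
    apply/(iso_repP rhoE H) => //; case: ip => //.
    by rewrite wrQ.
  move=> i' /(iso_repP rhoE H (b_min _) mp) ip'.
  by apply: wr_inj; apply: (equivb_common _ _ p) => //; left.
- split=> [i|V cV]; first exact/complex_irrepP.
  have [p mp Vp] := irrep_projection rhoE H (proj1 cV); rewrite Vp in cV *.
  move/(complex_irrepP mp): cV => np; have [j jp] := minproj_equivb mp.
  have isoE i : iso_or_conj S rho (vsim (b (wc i))) (vsim p) <->
      equivb Gam P (b (wc i)) p.
    by rewrite /iso_or_conj (iso_repP rhoE H (b_min _) mp)
      (conj_iso_repP rhoE H (b_min _) mp).
  have [|i ij] := wc_ex j.
    move=> bjj; apply: np; have pj : equivb Gam P p (b j).
      by apply: equivb_sym jp => //; exact: proj_of.
    have jp' : equivp Gam P (b j) p.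
      case: jp => // jp; apply: (equivp_trans H) jp; apply: equivp_sym => //.
      - by apply: projection_bar => //; exact: proj_of.
      - exact: proj_of.
    apply: (equivp_trans H _ jp'); apply: (equivp_trans H _ bjj).
    apply: (equivp_sym H); [exact/(projection_bar H)/proj_of..|].
    exact: equivp_bar.
  exists i; split; first by apply/isoE; exact: (equivb_trans H) ij jp.
  move=> i' /isoE ip'; apply: wc_inj; apply: (equivb_common _ _ p) => //.
  exact: (equivb_trans H) ij jp.
- split=> [i|V qV]; first exact/quaternionic_irrepP.
  have [p mp Vp] := irrep_projection rhoE H (proj1 qV); rewrite Vp in qV *.
  move/(quaternionic_irrepP mp): qV => sp; have [j jp] := minproj_equivb mp.
  have sj := sign_common _ _ _ mp jp sp.
  have [|i ij] := wh_ex j.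
    split; last exact: (structure_sign_equivp_bar H (b_min j) sj).
    move/(block_sign (bB j)) => sj'.
    by have := structure_sign_inj H (b_min j) sj sj'.
  have ip := equivb_trans H ij jp; exists i; split.
    apply/(iso_repP rhoE H) => //; case: ip => // ip.
    apply: (equivp_trans H) ip; have [_ bww] := whQ i.
    by apply: equivp_sym bww => //; [apply: projection_bar => //|];
      exact: proj_of.
  move=> i' /(iso_repP rhoE H (b_min _) mp) ip'.
  by apply: wh_inj; apply: (equivb_common _ _ p) => //; left.
pose I := ('I_k + 'I_l + 'I_s)%type.
pose W (i : I) : 'I_N :=
  match i with inl (inl i) => wr i | inl (inr i) => wc i | inr i => wh i end.
pose D (i : I) : algType R := match i with
  inl (inl i) => R^o | inl (inr i) => Rcomplex R | inr i => quaternion R end.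
pose m (i : I) : nat := match i with
  | inl (inl i) => multiplicity S rho (vsim (b (wr i)))
  | inl (inr i) => conj_pair_multiplicity S rho (vsim (b (wc i)))
  | inr i => pair_multiplicity S rho (vsim (b (wh i))) end.
suff : alg_iso A (direct_sum (fun i : I => gl (D i) (m i))).
  move=> /alg_iso_trans; apply.
  exact: (direct_sum3_iso (fun i : I => gl (D i) (m i))).
have /choice[u uP] : forall i : 'I_s, exists u,
    partial_iso Gam P (bar (b (wh i))) (b (wh i)) u /\ u *m bar u = - b (wh i).
  move=> i; have [u iu uu] := structure_sign_iso H (b_min (wh i)) (whS i).
  by exists u; split => //; rewrite uu expr1 scaleN1r.
pose phi (i : I) : D i -> M := match i return D i -> M with
  | inl (inl i) => fun c => c%:C%C *: b (wr i)
  | inl (inr i) => complex_corner (b (wc i))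
  | inr i => quaternion_embedding (b (wh i)) (u i) end.
have c_nr i : bar (b (wc i)) <> b (wc i).
  by move=> r; apply: (wcQ i); rewrite r; apply: equivp_refl; exact: proj_of.
have model i : corner_model Gam (b (W i)) (phi i).
  case: i => [[i|i]|i].
  - exact: (real_corner_model (bB _) (wrQ i)).
  - exact: (complex_corner_model H (bB _) (c_nr i) (wcQ i)).
  - have [nr _] := whQ i; have [iu uu] := uP i.
    exact: (quaternion_corner_model H (bB _) nr iu uu).
have mE i : m i = class_size (b (W i)).
  case: i => [[i|i]|i].
  - exact: (real_multiplicity (bB _) (wrQ i)).
  - exact: (complex_multiplicity (bB _) (wcQ i)).
  - by have [nr bww] := whQ i; exact: (quaternionic_multiplicity (bB _) nr bww).
(* The type of a class, with [None] for complex type. It is preserved by [equivb], so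
   representatives of different types are never equivalent. *)
pose ty (i : I) : option bool :=
  match i with inl (inl _) => Some false | inl (inr _) => None | inr _ => Some
    true end.
have tyP i e : structure_sign Gam e (b (W i)) <-> ty i = Some e.
  have sinj := structure_sign_inj H (b_min (W i)).
  case: i sinj => [[i|i]|i] /= sinj; split.
  - by have /(block_sign (bB _)) s0 := wrQ i; move=> /(sinj _ _ s0) ->.
  - by move=> [<-]; apply/(block_sign (bB _)).
  - by move=> /(structure_sign_equivp_bar H (b_min _)) /(wcQ i).
  - by [].
  - by move=> /(sinj _ _ (whS i)) ->.
  - by move=> [<-].
have W_inj i j : equivb Gam P (b (W i)) (b (W j)) -> i = j.
  move=> ij; have pW i' := proj_of (b_min (W i')).
  have ji := equivb_sym H (pW i) (pW j) ij.
  have : ty i = ty j.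
    case Ei : (ty i) => [e|]; case Ej : (ty j) => [e'|] //.
    - move/tyP: Ei => /(equivb_sign H (pW j) ij) /tyP.
      by rewrite Ej.
    - by move/tyP: Ei => /(equivb_sign H (pW j) ij) /tyP; rewrite Ej.
    - by move/tyP: Ej => /(equivb_sign H (pW i) ji) /tyP; rewrite Ei.
  case: i j ij {ji} => [[i|i]|i] [[j|j]|j] //= ij _.
  - by rewrite (wr_inj _ _ ij).
  - by rewrite (wc_inj _ _ ij).
  - by rewrite (wh_inj _ _ ij).
have W_ex j : exists i, equivb Gam P (b (W i)) (b j).
  have [rb|nr] := pselect (bar (b j) = b j).
    by have [i ij] := wr_ex j rb; exists (inl (inl i)).
  have [cb|nc] := pselect (equivp Gam P (bar (b j)) (b j)).
    by have [i ij] := wh_ex j (conj nr cb); exists (inr i).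
  by have [i ij] := wc_ex j nc; exists (inl (inr i)).
have ex i := class_units (bB (W i)) (mE i).
pose f i := sval (cid (ex i)); pose F i := sval (cid (svalP (cid (ex i)))).
have FP i : [/\ injective (f i),
    forall a, partial_iso Gam P (real_hull (b (W i))) (real_hull (b (f i a)))
      (F i a),
    forall a, bar (F i a) = F i a &
    \sum_(a < m i) F i a *m star P (F i a) =
    \sum_(j | `[< equivb Gam P (b (W i)) (b j) >]) real_hull (b j)].
  exact: (svalP (cid (svalP (cid (ex i))))).
move: f F FP => f F FP {ex}.
have phi1 i : phi i 1 = real_hull (b (W i)) by have [] := model i.
have BF i a : commutant Gam (F i a) by have [_ /(_ a)[]] := FP i.
have F_hull i a : F i a *m real_hull (b (W i)) = F i a.
  by have [_ /(_ a)[]] := FP i.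
have hull_F i a : real_hull (b (W i)) *m star P (F i a) = star P (F i a).
  have [_ sh _] := real_hull_projection H (bB (W i)).
  by rewrite -{1}sh -(starM H) F_hull.
apply: (@matrix_units_iso R C (real_complex R) n A theta thetaL thetaM theta1
  theta_inj I D m phi _ _ _ _ _ F (fun i a => star P (F i a))).
- by move=> i; have [] := model i.
- by move=> i; have [] := model i.
- by move=> i; have [_ _ _ []] := model i.
- by move=> i x; apply/theta_im; have [_ _ _ [_ ]] := model i.
- by move=> i Y /theta_im[BY rY]; have [_ _ -> [_ _ ]] := model i; exact.
- move=> i a; apply/theta_im; split; first exact: BF.
  by have [_ _ ->] := FP i.
- move=> i a; apply/theta_im; split; first exact: (commutant_star H).
  by rewrite (bar_star H); have [_ _ ->] := FP i.
- by move=> i a; rewrite phi1 F_hull.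
- by move=> i a; rewrite phi1 hull_F.
- move=> i a a'; rewrite phi1; have [f_inj iF _ _] := FP i.
  exact: (class_units_orth _ _ f_inj iF).
- move=> i j a a' Y ij /theta_im[BY _].
  have nji : ~ equivb Gam P (b (W j)) (b (W i)).
    by move/W_inj => ji; rewrite ji eqxx in ij.
  exact: (nequivb_mulmx H (bB (W j)) (bB (W i)) nji
    (commutant_star H (BF i a)) BY (BF j a') (hull_F i a) (F_hull j a')).
- rewrite -b_sum.
  transitivity (\sum_i \sum_(j | `[< equivb Gam P (b (W i)) (b j) >]) real_hull
    (b j)).
    by apply: eq_bigr => i _; have [_ _ _ ->] := FP i.
  (* Each block is equivalent to exactly one representative, so after the exchange every hull occurs
     once. *)
  rewrite (exchange_big_dep xpredT)//=; apply: eq_bigr => j _.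
  have [i ij] := W_ex j; rewrite (bigD1 i) /=; last exact/asboolP.
  rewrite big1 ?addr0// => i' /andP[/asboolP i'j /eqP]; case.
  exact/W_inj/(equivb_common _ _ (b j)).
Qed.

End Classification.

(** * The theorem for automorphic algebras *)

(** Computes a Hermitian form at [u + i v], with [x] and [y] in the role of the transposes of [u]
    and [v]; symmetry of the real form supplies the equality that cancels the cross terms. *)
Lemma imaginary_form_expand (K : comNzRingType) m n (x y : 'M[K]_(m, n))
    (Q : 'M[K]_n) (u v : 'M[K]_(n, m)) i :
  i * i = -1 -> x *m Q *m v = y *m Q *m u ->
  (x - i *: y) *m Q *m (u + i *: v) = x *m Q *m u + y *m Q *m v.
Proof.
move=> ii cross; rewrite mulmxBl mulmxBl !mulmxDr -!scalemxAl -!scalemxAr cross.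
by rewrite scalerA ii scaleN1r opprD opprK addrA addrK.
Qed.

Section RealForm.
Variables (R : realType) (n : nat).
Local Notation C := R[i].

Definition cplx m k (X : 'M[R]_(m, k)) : 'M[C]_(m, k)
  := map_mx (real_complex R) X.

Lemma bar_cplx m k (X : 'M[R]_(m, k)) : bar (cplx X) = cplx X.
Proof. by apply/matrixP => i j; rewrite !mxE -conjcE conjc_real. Qed.

Lemma cplxM m k l (X : 'M[R]_(m, k)) (Y : 'M[R]_(k, l)) :
  cplx (X *m Y) = cplx X *m cplx Y.
Proof. exact: map_mxM. Qed.

Lemma cplx_tr m k (X : 'M[R]_(m, k)) : cplx X^T = (cplx X)^T.
Proof. by apply/matrixP => i j; rewrite !mxE. Qed.

Lemma cplx_inj m k : injective (@cplx m k).
Proof. by move=> X Y /matrixP E; apply/matrixP => i j; have := E i j;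
  rewrite !mxE => -[]. Qed.

Lemma bar_real m k (X : 'M[C]_(m, k)) : bar X = X -> exists Y, X = cplx Y.
Proof.
move=> /matrixP XX; exists (\matrix_(i, j) complex.Re (X i j)).
apply/matrixP => i j; rewrite !mxE; have := XX i j; rewrite !mxE -conjcE.
by case: (X i j) => a b /= [] /eqP; rewrite eqNr => /eqP ->.
Qed.

Variables (Gam : set 'M[R]_n) (P : 'M[R]_n).
Hypothesis GamV : forall a, Gam a -> exists2 b, Gam b & a *m b = 1%:M.
Hypothesis P_tr : P^T = P.
Hypothesis P_gt0 : forall x : 'cV_n, x != 0 -> 0 < (x^T *m P *m x) 0 0.
Hypothesis P_Gam : forall a, Gam a -> a^T *m P *m a = P.

Let P_unit : P \in unitmx.
Proof.
apply: unitmx_ker => x Px0; apply/eqP; apply: contraT => /P_gt0.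
by rewrite -mulmxA Px0 mulmx0 mxE ltxx.
Qed.

Lemma hform_cplx (a b : 'cV[R]_n) (v := cplx a + 'i%C *: cplx b) :
  hform (cplx P) v v = ((a^T *m P *m a) 0 0 + (b^T *m P *m b) 0 0)%:C%C.
Proof.
have bv : (bar v)^T = (cplx a)^T - 'i%C *: (cplx b)^T.
  apply/matrixP => i j; rewrite !mxE -conjcE; apply/eqP.
  by rewrite eq_complex /=; apply/andP; split; apply/eqP; ring.
have cross : (cplx a)^T *m cplx P *m cplx b = (cplx b)^T *m cplx P *m cplx a.
  rewrite -!cplx_tr -!cplxM; congr cplx.
  transitivity (b^T *m P *m a)^T; first by rewrite !trmx_mul trmxK P_tr mulmxA.
  by apply/matrixP => i j; rewrite !ord1 mxE.
have -> : (a^T *m P *m a) 0 0 + (b^T *m P *m b) 0 0 =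
  (a^T *m P *m a + b^T *m P *m b) 0 0 by rewrite [RHS]mxE.
rewrite /hform bv /v.
rewrite [X in fun_of_matrix X _ _](_ : _ = cplx (a^T *m P *m a + b^T *m P *m
  b)).
  by rewrite mxE.
rewrite [RHS]map_mxD -!/(cplx _) !cplxM !cplx_tr.
by apply: imaginary_form_expand => //; rewrite -expr2 sqr_i.
Qed.

Lemma real_adjoint_setting : adjoint_setting [set cplx a | a in Gam] (cplx P).
Proof.
split.
- by move=> _ [a _ <-]; exact: bar_cplx.
- move=> _ [a Ga <-]; have [b Gb ab] := GamV Ga.
  exists (cplx b); first by exists b.
  rewrite starE bar_cplx -cplx_tr -mulmxA -cplxM.
  (* Invariance of [P] under [b] says that the adjoint of [b] is its inverse, namely [a]. *)
  have -> : b^T *m P = P *m a.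
    by rewrite -[in RHS](P_Gam Gb) -mulmxA (mulmx1C ab) mulmx1.
  by rewrite cplxM mulKmx// map_unitmx.
- exact: bar_cplx.
- by rewrite -cplx_tr P_tr.
- move=> v v0; pose a := \matrix_(i, j) complex.Re (v i j).
  pose b := \matrix_(i, j) complex.Im (v i j).
  have Ev : v = cplx a + 'i%C *: cplx b.
    by apply/matrixP => i j; rewrite !mxE -complexE.
  rewrite Ev hform_cplx ltcR.
  have ge0 (x : 'cV[R]_n) : 0 <= (x^T *m P *m x) 0 0.
    by have [->|x0] := eqVneq x 0; [rewrite mulmx0 mxE|exact/ltW/P_gt0].
  have [a0|/P_gt0 a0] := eqVneq a 0; last exact: ltr_pwDl.
  apply: ltr_wpDl => //; apply: P_gt0; apply: contra v0 => /eqP b0.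
  by rewrite Ev a0 b0 /cplx !map_mx0 scaler0 addr0.
Qed.

End RealForm.

Section AutomorphicEvaluation.
Variables (R : realType) (G : lieGroupType R) (K : subgroup G) (n : nat).
Variable sigma : proj_rep K n.
Local Notation A := (autAlg (conj_action sigma)).

(* Invariant functions are constant, hence determined by their value at 1. *)
Definition eval1 (f : A) : 'M[R[i]]_n := cplx (val f 1%g : 'M[R]_n).

Let constant (f : A) g : val f g = val f 1%g.
Proof.
have /aut_predP[_ /(_ g)/(congr1 (fun h => h g))] := valP f.
by rewrite /translate mulVg.
Qed.

Lemma eval1_linear c (f g : A) :
  eval1 (c *: f + g) = c%:C%C *: eval1 f + eval1 g.
Proof.
by apply/matrixP => i j; rewrite !mxE -rmorphM -rmorphD; congr (_%:C)%C.
Qed.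

Lemma eval1M (f g : A) : eval1 (amul f g) = eval1 f *m eval1 g.
Proof. exact: cplxM. Qed.

Lemma eval1_one : eval1 aone = 1%:M.
Proof. exact: map_mx1. Qed.

Lemma eval1_inj : injective eval1.
Proof.
move=> f g /cplx_inj E; apply/val_inj/funext => x.
by rewrite constant [RHS]constant.
Qed.

Lemma eval1_image (Y : 'M[R[i]]_n) : (exists f, eval1 f = Y) <->
  commutant [set cplx a | a in lift_mx sigma] Y /\ bar Y = Y.
Proof.
split.
  move=> [f <-]; split; last exact: bar_cplx.
  have /aut_predP[Ef _] := valP f.
  have inv : forall k, sgset K k -> conj_act sigma k (val f 1%g) = val f 1%g.
    move=> k Kk; have := Ef 1%g _ (subgroupV Kk).
    by rewrite constant invgK => E; exact: esym E.
  move=> _ [a Ga <-]; rewrite -!cplxM; congr cplx.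
  exact: (proj1 (lift_mx_invariant sigma _) inv).
move=> [BY /bar_real[m EY]]; rewrite {}EY in BY *.
have inv : forall a, lift_mx sigma a -> a *m m = m *m a.
  by move=> a Ga; apply: cplx_inj; rewrite !cplxM; apply: BY; exists a.
have fP : (fun=> m) \in aut_pred (conj_action sigma).
  apply/aut_predP; split => // g h Kh.
  by rewrite [RHS](proj2 (lift_mx_invariant sigma m) inv)//; exact: subgroupV.
by exists (exist (fun f => f \in aut_pred (conj_action sigma)) _ fP).
Qed.

End AutomorphicEvaluation.

Theorem theorem3p5 (R : realType) (G : lieGroupType R) (K : subgroup G)
    (cK : compact (sgset K)) (n : nat) (sigma : proj_rep K n) :
  let S := lift_group sigma in
  let rho := @lift_act R G n in
  exists (p q s : nat)
    (Wr : 'I_p -> {vspace 'cV[R[i]]_n})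
    (Wc : 'I_q -> {vspace 'cV[R[i]]_n})
    (Wh : 'I_s -> {vspace 'cV[R[i]]_n}),
  [/\ representatives (real_irrep S rho) (iso_rep S rho) Wr,
      representatives (complex_irrep S rho) (iso_or_conj S rho) Wc,
      representatives (quaternionic_irrep S rho) (iso_rep S rho) Wh &
      alg_iso (autAlg (conj_action sigma))
        (direct_sum (fun i => gl R^o (multiplicity S rho (Wr i))) *
         direct_sum (fun i => gl (Rcomplex R)
                                 (conj_pair_multiplicity S rho (Wc i))) *
         direct_sum (fun i => gl (quaternion R)
                                 (pair_multiplicity S rho (Wh i))))%type].
Proof.
move=> S rho; have [B HB] := lift_mx_bounded sigma cK.
have [P [PT P0 PG]] :=
  invariant_form (lift_mx1 sigma) (@lift_mxM _ _ _ _ sigma) (@lift_mxV _ _ _ _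
    sigma) HB.
have H := real_adjoint_setting (@lift_mxV _ _ _ _ sigma) PT P0 PG.
pose act (x : G * GL R n) := cplx (Defs.GLval x.2).
have Gact : act @` S = [set cplx a | a in lift_mx sigma].
  by rewrite /lift_mx image_comp.
have H' : adjoint_setting (act @` S) (cplx P) by rewrite Gact.
have p1 : projection (act @` S) (cplx P) 1%:M.
  split; [exact: commutant1 | exact: (star1 H') | exact: mulmx1].
have [s sB s1] := block_decomposition H' p1 (bar1 _ _).
have bB (j : 'I_(size s)) : block (act @` S) (cplx P) (nth 0 s j).
  by apply: sB; rewrite mem_nth.
have b1 : \sum_(j < size s) real_hull (nth 0 s j) = 1%:M.
  by rewrite -s1 (big_nth 0) big_mkord.
apply: (classification (rho := rho) (act := act) _ H' bB b1 (theta
  := @eval1 _ _ _ _ sigma)).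
- by [].
- exact: eval1_linear.
- exact: eval1M.
- exact: eval1_one.
- exact: eval1_inj.
- by move=> Y; rewrite eval1_image Gact.
Qed.
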